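(* Let $p>0$ be an odd integer and $r\in\mathbb C$. Then $V[p,r]\cong\mathcal F_{p,r}$ contains the following family of (sub)singular vectors: (1) singular vectors $u_{p,r}^{(n)}=\mathcal G^nQ\,v_{p,r-n-1/2}$, $n\in\mathbb Z_{\ge0}$; (2) subsingular vectors $w_{p,r}^{(n)}=\mathcal G^n\,v_{p,r-n}$, $n\in\mathbb Z_{>0}$.
   Context: The $N=1$ Heisenberg-Virasoro algebra $\mathcal{SH}$ is the complex Lie superalgebra with even basis elements $L(n),\alpha(n)$ ($n\in\mathbb Z$), odd basis elements $G(n+\frac12),\Psi(n+\frac12)$ ($n\in\mathbb Z$), and even central elements $C_L,C_\alpha,C_{L,\alpha}$, with (super)commutators, for $m,n\in\mathbb Z$: $[\alpha(m),\alpha(n)]=\delta_{m+n,0}\,m\,C_\alpha$; $[L(m),\alpha(n)]=-n\,\alpha(m+n)-\delta_{m+n,0}(m^2+m)C_{L,\alpha}$; $[L(m),L(n)]=(m-n)L(m+n)+\delta_{m+n,0}\frac{m^3-m}{12}C_L$; $[\Psi(m+\frac12),\Psi(n+\frac12)]_+=\delta_{m+n+1,0}C_\alpha$; $[\alpha(m),\Psi(n+\frac12)]=0$; $[G(m+\frac12),G(n+\frac12)]_+=2L(m+n+1)+\delta_{m+n+1,0}\frac{m^2+m}{3}C_L$; $[L(m),G(n+\frac12)]=(\frac m2-n-\frac12)G(m+n+\frac12)$; $[\alpha(m),G(n+\frac12)]=m\,\Psi(m+n+\frac12)$; $[\Psi(m+\frac12),L(n)]=\frac{2m+n+1}{2}\Psi(m+n+\frac12)$;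 $[\Psi(m+\frac12),G(n+\frac12)]_+=\alpha(m+n+1)+2m\,\delta_{m+n+1,0}C_{L,\alpha}$. Let $\mathcal{SH}^{+}$ be the span of $L(n),\alpha(n),G(n-\frac12),\Psi(n-\frac12)$, $n\ge1$. A singular vector is a nonzero vector annihilated by $\mathcal{SH}^+$. A subsingular vector in a module $V$ is a vector which is not singular but whose image in $V/N$ is a (nonzero) singular vector for some submodule $N\subset V$. Fix $c_L,c_{L,\alpha}\in\mathbb C$ with $c_{L,\alpha}\ne0$. For $p,r\in\mathbb C$ put $h_{p,r}=(1-p^2)\frac{c_L-3}{24}-rp$; $V[p,r]$ is the Verma $\mathcal{SH}$-module with highest weight vector $v$ satisfying $\mathcal{SH}^+v=0$, $L(0)v=h_{p,r}v$, $\alpha(0)v=(1+p)c_{L,\alpha}v$, on which $C_L,C_\alpha,C_{L,\alpha}$ act by $c_L,0,c_{L,\alpha}$. Free field realisation: let $M(1)$ be the rank two Heisenberg vertex algebra generated by $c(z),d(z)$ with $\langle c,c\rangle=\langle d,d\rangle=0$, $\langle c,d\rangle=2$, and $F^{(2)}$ the fermionic vertex superalgebra generated by odd fields $\Psi^\pm(z)=\sum_n\Psi^\pm(n+\frac12)z^{-n-1}$ with $\{\Psi^\pm(r),\Psi^\pm(s)\}=0$, $\{\Psi^+(r),\Psi^-(s)\}=\delta_{r+s,0}$. For $\gamma\in\mathbb Cc+\mathbb Cd$, $e^\gamma$ is the highest weight vector of the Heisenberg Fock module on which $c(0),d(0)$ act by $\langle c,\gamma\rangle,\langle d,\gamma\rangle$.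 Put $\overline d=d-\frac{c_L-3}{12}c$, $v_{p,r}=e^{-\frac{p+1}2\overline d+rc}$, $\mathcal F_{p,r}=(M(1)\otimes F^{(2)}).v_{p,r}$. $\mathcal{SH}$ acts on $\mathcal F_{p,r}$ by $\alpha(n)=-c_{L,\alpha}c(n)$, $\Psi(s)=-\sqrt2c_{L,\alpha}\Psi^-(s)$, $\sum L(n)z^{-n-2}=Y(\omega,z)$, $\sum G(n+\frac12)z^{-n-2}=Y(\tau,z)$, where $\omega=\frac12c(-1)d(-1)+\frac{c_L-3}{24}c(-2)-\frac12d(-2)+\frac12\Psi^+(-\frac32)\Psi^-(-\frac12)+\frac12\Psi^-(-\frac32)\Psi^+(-\frac12)$, $\tau=\sqrt2(\frac12c(-1)\Psi^+(-\frac12)+\frac12d(-1)\Psi^-(-\frac12)+\frac{c_L-3}{12}\Psi^-(-\frac32)-\Psi^+(-\frac32))$. For $p\notin\mathbb Z_{<0}$, $\mathcal F_{p,r}\cong V[p,r]$ with $v_{p,r}$ corresponding to the highest weight vector. Screening operators: for $\gamma\in\{\frac c2,c\}$ let $Y(e^\gamma,z)=\exp\left(\sum_{n\ge1}\gamma(-n)\frac{z^n}n\right)\exp\left(-\sum_{n\ge1}\gamma(n)\frac{z^{-n}}n\right)e^\gamma z^{\gamma(0)}$, where the shift operator $e^\gamma$ sends $v_{p,s}$ to $v_{p,s+1/2}$ (if $\gamma=\frac c2$) or $v_{p,s+1}$ (if $\gamma=c$) and commutes with all $\Psi^\pm(s)$ and all $c(n),d(n)$, $n\ne0$. Let $p$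 be odd. On $\bigoplus_{m\in\mathbb Z}\mathcal F_{p,r+m/2}$ (the $\Pi(0)^{1/2}\otimes F^{(2)}$-module generated by $v_{p,r}$, $\Pi(0)^{1/2}=\mathbb C[\mathbb Z\frac c2]\otimes M(1)$) set $a=\Psi^-(-\frac12)e^{c/2}$, $Y(a,z)=\Psi^-(z)Y(e^{c/2},z)=\sum_{j\in\mathbb Z}a_jz^{-j-1}$, $Q=a_0$, $S=\sum_{i\ge1}\frac1ia_{-i}a_i$, $e^c_0=$ coefficient of $z^{-1}$ in $Y(e^c,z)$, and $\mathcal G=e^c_0-S$. Thus $Q:\mathcal F_{p,s}\to\mathcal F_{p,s+1/2}$ and $\mathcal G:\mathcal F_{p,s}\to\mathcal F_{p,s+1}$. *)

(* Defs.v *)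
From HB Require Import structures.
From mathcomp Require Import all_boot all_order all_algebra.
From mathcomp Require Import finmap mathcomp_extra boolp classical_sets fsbigop.
From mathcomp Require Import monalg.
Set Implicit Arguments.
Unset Strict Implicit.
Unset Printing Implicit Defensive.
Import Order.TTheory GRing.Theory Num.Theory.
Local Open Scope ring_scope.

(* [SG n] and [SPsi n] are the odd elements G(n + 1/2) and Psi(n + 1/2). *)
Inductive SHgen : Type :=
  | SL of int | Sal of int | SG of int | SPsi of int
  | SCL | SCal | SCLal.

(* The basis elements spanning SH^+; G(n - 1/2), n >= 1, is [SG (n - 1)]. *)
Definition SHplus (x : SHgen) : bool :=
  match x with
  | SL n | Sal n => 0 < n
  | SG n | SPsi n => 0 <= n
  | _ => false
  end.

Section SHModules.
Context {C : numClosedFieldType}.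

Definition commut (V : lmodType C) (f g : V -> V) (u : V) : V :=
  f (g u) - g (f u).
Definition acommut (V : lmodType C) (f g : V -> V) (u : V) : V :=
  f (g u) + g (f u).

(* An SH-module is a vector space with one operator per basis element of SH,
   subject to the defining (super)commutation relations, i.e. a module over
   the associative algebra U(SH). *)
Record is_SHmodule (V : lmodType C) (act : SHgen -> V -> V) : Prop := {
  SH_linear : forall x, linear (act x);
  SH_CL : forall x u, commut (act SCL) (act x) u = 0;
  SH_Cal : forall x u, commut (act SCal) (act x) u = 0;
  SH_CLal : forall x u, commut (act SCLal) (act x) u = 0;
  SH_al_al : forall m n u,
    commut (act (Sal m)) (act (Sal n)) u
    = ((m + n == 0)%:R * m%:~R) *: act SCal u;
  SH_L_al : forall m n u,
    commut (act (SL m)) (act (Sal n)) u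
    = - n%:~R *: act (Sal (m + n)) u
      - ((m + n == 0)%:R * (m ^+ 2 + m)%:~R) *: act SCLal u;
  SH_L_L : forall m n u,
    commut (act (SL m)) (act (SL n)) u
    = (m - n)%:~R *: act (SL (m + n)) u
      + ((m + n == 0)%:R * ((m ^+ 3 - m)%:~R / 12%:R)) *: act SCL u;
  SH_Psi_Psi : forall m n u,
    acommut (act (SPsi m)) (act (SPsi n)) u
    = (m + n + 1 == 0)%:R *: act SCal u;
  SH_al_Psi : forall m n u,
    commut (act (Sal m)) (act (SPsi n)) u = 0;
  SH_G_G : forall m n u,
    acommut (act (SG m)) (act (SG n)) u
    = 2%:R *: act (SL (m + n + 1)) u
      + ((m + n + 1 == 0)%:R * ((m ^+ 2 + m)%:~R / 3%:R)) *: act SCL u;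
  SH_L_G : forall m n u,
    commut (act (SL m)) (act (SG n)) u
    = (m%:~R / 2%:R - n%:~R - 1 / 2%:R) *: act (SG (m + n)) u;
  SH_al_G : forall m n u,
    commut (act (Sal m)) (act (SG n)) u = m%:~R *: act (SPsi (m + n)) u;
  SH_Psi_L : forall m n u,
    commut (act (SPsi m)) (act (SL n)) u
    = ((2 * m + n + 1)%:~R / 2%:R) *: act (SPsi (m + n)) u;
  SH_Psi_G : forall m n u,
    acommut (act (SPsi m)) (act (SG n)) u
    = act (Sal (m + n + 1)) u
      + ((m + n + 1 == 0)%:R * (2 * m)%:~R) *: act SCLal u
}.

Definition is_SHhom (V W : lmodType C) (actV : SHgen -> V -> V)
    (actW : SHgen -> W -> W) (f : V -> W) : Prop :=
  linear f /\ forall x u, f (actV x u) = actW x (f u).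

Record is_submodule (V : lmodType C) (act : SHgen -> V -> V) (N : set V) :
    Prop := {
  subm_0 : N 0;
  subm_add : forall u v, N u -> N v -> N (u + v);
  subm_scale : forall (a : C) u, N u -> N (a *: u);
  subm_act : forall x u, N u -> N (act x u)
}.

Definition singular (V : lmodType C) (act : SHgen -> V -> V) (v : V) : Prop :=
  v <> 0 /\ forall x, SHplus x -> act x v = 0.

(* The class of [w] in V/N is a nonzero singular vector: the zero class of V/N
   is N, and SH acts on classes through representatives. *)
Definition singular_mod (V : lmodType C) (act : SHgen -> V -> V) (N : set V)
    (w : V) : Prop :=
  ~ N w /\ forall x, SHplus x -> N (act x w).

Definition subsingular (V : lmodType C) (act : SHgen -> V -> V) (w : V) :
    Prop :=
  ~ singular act w /\ exists2 N, is_submodule act N & singular_mod act N w.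

Definition hpr (cL p r : C) : C := (1 - p ^+ 2) * ((cL - 3%:R) / 24%:R) - r * p.

Record is_hw_vector (cL cLa p r : C) (V : lmodType C) (act : SHgen -> V -> V)
    (v : V) : Prop := {
  hw_plus : forall x, SHplus x -> act x v = 0;
  hw_L0 : act (SL 0) v = hpr cL p r *: v;
  hw_al0 : act (Sal 0) v = ((1 + p) * cLa) *: v;
  hw_CL : forall u, act SCL u = cL *: u;
  hw_Cal : forall u, act SCal u = 0;
  hw_CLal : forall u, act SCLal u = cLa *: u
}.

(* (V, v) is the Verma module V[p,r] with its highest weight vector, i.e. the
   module induced from the character of the nonnegative part of SH; it is
   given by its universal property, hence up to a unique isomorphism. *)
Definition is_verma (cL cLa p r : C) (V : lmodType C) (act : SHgen -> V -> V)
    (v : V) : Prop :=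
  [/\ is_SHmodule act,
      is_hw_vector cL cLa p r act v
    & forall (W : lmodType C) (actW : SHgen -> W -> W) (w : W),
        is_SHmodule actW -> is_hw_vector cL cLa p r actW w ->
        exists! f : V -> W, is_SHhom act actW f /\ f v = w].

End SHModules.

(* Basis of the Fock space: occupation numbers of the bosonic creation modes
   c(-k-1) = (false, k), d(-k-1) = (true, k), and the set of occupied fermionic
   creation modes Psi^+(-k-1/2) = (false, k), Psi^-(-k-1/2) = (true, k). The
   wedge product of the occupied modes is taken in increasing order for
   [mode_lt]. *)
Definition state : choiceType :=
  ({fsfun bool * nat -> nat with 0%N} * {fset bool * nat})%type.

Definition mode_lt (i j : bool * nat) : bool :=
  (i.1 < j.1)%N || (i.1 == j.1) && (i.2 < j.2)%N.

Section Fock.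
Context {C : numClosedFieldType}.

Definition Fock : lmodType C := {malg C[state]}.

Definition lin_ext (f : state -> Fock) (x : Fock) : Fock :=
  \sum_(s <- msupp x) x@_s *: f s.

Definition bcreate (i : bool * nat) : Fock -> Fock :=
  lin_ext (fun s => << ([fsfun s.1 with i |-> (s.1 i).+1], s.2) >>).

Definition bannih (i : bool * nat) : Fock -> Fock :=
  lin_ext (fun s =>
    (s.1 i)%:R *: << ([fsfun s.1 with i |-> (s.1 i).-1], s.2) >>).

Definition fsign (i : bool * nat) (F : {fset bool * nat}) : C :=
  (-1) ^+ #|` [fset j in F | mode_lt j i]%fset|.

Definition fcreate (i : bool * nat) : Fock -> Fock :=
  lin_ext (fun s =>
    if i \in s.2 then 0 else fsign i s.2 *: << (s.1, (i |` s.2)%fset) >>).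

Definition fannih (i : bool * nat) : Fock -> Fock :=
  lin_ext (fun s =>
    if i \in s.2 then fsign i s.2 *: << (s.1, (s.2 `\ i)%fset) >> else 0).

(* Coefficient of z^k in exp (\sum_(n >= 1) A n z^n), applied to v: the j-th
   power contributes the products A t_1 ... A t_j with t_1 + ... + t_j = k. *)
Definition exp_coef (A : nat -> Fock -> Fock) (k : nat) (v : Fock) : Fock :=
  \sum_(j < k.+1) (j`!%:R)^-1 *:
    \sum_(t : j.-tuple 'I_k.+1 |
            all (fun i : 'I_k.+1 => 0 < i)%N t
            && (\sum_(i <- t) (i : nat) == k)%N)
      foldr (fun i : 'I_k.+1 => A i) v t.

(* (x, y) stands for x c + y d. *)
Definition cdform (g h : C^o * C^o) : C :=
  2%:R * (g.1 * h.2 + g.2 * h.1).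

Definition cvec : C^o * C^o := (1, 0).
Definition dvec : C^o * C^o := (0, 1).

Section Realisation.
Context (cL p : C).

Definition dbar : C^o * C^o := dvec - ((cL - 3%:R) / 12%:R : C) *: cvec.

Definition weight (s : C) : C^o * C^o :=
  - ((p + 1) / 2%:R) *: dbar + s *: cvec.

(* The space of F_{p,s}. All the F_{p,s} have the same underlying space
   M(1) (x) F^(2), with basis obtained from v_{p,s} by the creation modes; p and
   s enter through the zero modes only. The index s records on which F_{p,s} an
   operator is meant to act. *)
Definition Fsp (s : C) : lmodType C := Fock.

(* v_{p,s} *)
Definition vac (s : C) : Fsp s := << ([fsfun], fset0) : state >>.

(* [osc false n] is c(n) and [osc true n] is d(n): zero modes act through the
   weight, and [h(m), h'(n)] = m <h, h'> delta_{m+n,0}. Recall that [Negz k] is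
   the integer - (k + 1). *)
Definition osc (b : bool) (s : C) (n : int) : Fsp s -> Fsp s :=
  match n with
  | Posz 0 => fun x => cdform (if b then dvec else cvec) (weight s) *: x
  | Posz k.+1 => fun x =>
      (k.+1%:R * cdform cvec dvec) *: bannih (~~ b, k) x
  | Negz k => bcreate (b, k)
  end.

(* [fer false n] is Psi^+(n + 1/2) and [fer true n] is Psi^-(n + 1/2). *)
Definition fer (b : bool) (s : C) (n : int) : Fsp s -> Fsp s :=
  match n with
  | Posz k => fannih (~~ b, k)
  | Negz k => fcreate (b, k)
  end.

Local Notation c := (osc false).
Local Notation d := (osc true).
Local Notation Psip := (fer false).
Local Notation Psim := (fer true).

Definition nord_cd (s : C) (k l : int) (x : Fsp s) : Fsp s :=
  if k < 0 then c k (d l x) else d l (c k x).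

(* :Psi^+(k + 1/2) Psi^-(l + 1/2): for b = false, and
   :Psi^-(k + 1/2) Psi^+(l + 1/2): for b = true. *)
Definition nord_fer (b : bool) (s : C) (k l : int) (x : Fsp s) : Fsp s :=
  if k < 0 then fer b k (fer (~~ b) l x) else - fer (~~ b) l (fer b k x).

(* Coefficient of z^(-n-2) in Y(omega, z). For a field a(z) = \sum a_n z^(-n-1)
   the coefficient of z^(-n-2) in its derivative is (- n - 1) a_n, and
   Psi^+(-3/2) Psi^-(-1/2) gives :(d/dz Psi^+)(z) Psi^-(z):. Applied to any
   vector, each infinite sum has only finitely many nonzero terms. *)
Definition Lop (s : C) (n : int) (x : Fsp s) : Fsp s :=
  (1 / 2%:R) *: \sum_(k \in [set: int]) nord_cd k (n - k) x
  + ((cL - 3%:R) / 24%:R * (- n - 1)%:~R) *: c n x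
  - (1 / 2%:R * (- n - 1)%:~R) *: d n x
  + (1 / 2%:R) *: \sum_(k \in [set: int])
        (- k - 1)%:~R *: nord_fer false k (n - k - 1) x
  + (1 / 2%:R) *: \sum_(k \in [set: int])
        (- k - 1)%:~R *: nord_fer true k (n - k - 1) x.

(* Coefficient of z^(-n-2) in Y(tau, z). *)
Definition Gop (s : C) (n : int) (x : Fsp s) : Fsp s :=
  sqrtC 2%:R *:
    ((1 / 2%:R) *: \sum_(k \in [set: int]) c k (Psip (n - k) x)
     + (1 / 2%:R) *: \sum_(k \in [set: int]) d k (Psim (n - k) x)
     + ((cL - 3%:R) / 12%:R * (- n - 1)%:~R) *: Psim n x
     - (- n - 1)%:~R *: Psip n x).

Definition FockAct (cLa : C) (s : C) (g : SHgen) : Fsp s -> Fsp s :=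
  match g with
  | SL n => Lop n
  | Sal n => fun x => - cLa *: c n x
  | SG n => Gop n
  | SPsi n => fun x => - (sqrtC 2%:R * cLa) *: Psim n x
  | SCL => fun x => cL *: x
  | SCal => fun _ => 0
  | SCLal => fun x => cLa *: x
  end.

(* The shift e^gamma, gamma = lam c, from F_{p,s} to F_{p,s+lam}: it sends
   v_{p,s} to v_{p,s+lam} and commutes with all the creation modes. *)
Definition shift (lam s : C) : Fsp s -> Fsp (s + lam) := fun x => x.

(* Coefficient of z^m in Y(e^gamma, z), gamma = lam c. The pair (i, j) collects
   z^i from the first exponential, z^(-j) from the second one, and z^(gamma(0)),
   which is z to the power <gamma, weight s> on F_{p,s}. *)
Definition Yexp (lam s : C) (m : int) (x : Fsp s) : Fsp (s + lam) :=
  \sum_(ij \in [set ij : nat * nat |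
          ij.1%:R - ij.2%:R + cdform (lam *: cvec) (weight s) = m%:~R :> C])
    exp_coef (fun n u => (lam / n%:R) *: @c (s + lam) (- n%:Z) u) ij.1
      (exp_coef (fun n u => - (lam / n%:R) *: @c (s + lam) n%:Z u) ij.2
        (shift lam x)).

(* a_j: coefficient of z^(-j-1) in Psi^-(z) Y(e^(c/2), z). *)
Definition amode (s : C) (j : int) (x : Fsp s) : Fsp (s + 1 / 2%:R) :=
  \sum_(k \in [set: int]) Psim k (Yexp (1 / 2%:R) (k - j) x).

Definition Qop (s : C) : Fsp s -> Fsp (s + 1 / 2%:R) := @amode s 0.

Definition Sop (s : C) (x : Fsp s) : Fsp (s + 1) :=
  \sum_(i \in [set i : nat | (0 < i)%N])
    (i%:R)^-1 *: (amode (- i%:Z) (amode i%:Z x) : Fsp (s + 1)).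

(* The operator written as a calligraphic G, not to be confused with the odd
   elements G(n + 1/2) of SH. *)
Definition scrG (s : C) (x : Fsp s) : Fsp (s + 1) :=
  Yexp 1 (-1) x - Sop x.

Fixpoint scrG_iter (s : C) (n : nat) (x : Fsp s) : Fsp (s + n%:R) :=
  if n is m.+1 then scrG (scrG_iter m x) else x.

Definition u_sing (r : C) (n : nat) : Fsp r :=
  scrG_iter n (Qop (vac (r - n%:R - 1 / 2%:R))).

Definition w_sub (r : C) (n : nat) : Fsp r := scrG_iter n (vac (r - n%:R)).

End Realisation.
End Fock.

(* Main.v *)
Require Import Defs.
From HB Require Import structures.
From mathcomp Require Import all_boot all_order all_algebra.
From mathcomp Require Import reals complex.
From mathcomp Require Import finmap mathcomp_extra boolp classical_sets functions fsbigop.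
From mathcomp Require Import monalg zify ring.
Set Implicit Arguments.
Unset Strict Implicit.
Unset Printing Implicit Defensive.
Import Order.TTheory GRing.Theory Num.Theory.
Local Open Scope ring_scope.

(** On F_(p,r) the nonzero modes of the fields do not depend on r, so all F_(p,r)
    are modelled on one Fock space. The relations of SH hold up to operators that
    (anti)commute with all modes, which Schur's lemma reduces to vacuum
    expectation values.

    The Verma property is proved without characters: in any highest weight module
    PBW straightening bounds the graded pieces from above by the number of Fock
    basis states of the same degree, and since p is not a negative integer the
    vacuum generates F_(p,r); so the PBW map is bijective, and running the same
    straightening in F_(p,r) (+) W yields the morphism to W.

    With E(m) the modes of Y(e^(c/2), z), one finds {G(n+1/2), a_j} =
    - sqrt 2 j E(-n-1-j) and, because the products of the modes E sum up to the
    modes of Y(e^c, z), [G(n+1/2), scrG] = sqrt 2 E(-n-1) Q. As Q^2 = 0 this makes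
    scrG^n Q v singular, and it makes scrG^n v singular modulo the submodule ker Q,
    but not singular: G(h-1/2) scrG^n v is a nonzero multiple of scrG^(n-1) Q v,
    for h = (p+1)/2. Finally scrG^n Q v is nonzero because its coefficient at
    c(-1)^(np) Psi^-(-h+1/2) v is (1/p!)^n. *)

(** Writing p + 1 = 2 h makes the exponents of z in Y(e^(c/2), z) and Y(e^c, z) integral on F_(p,s),
    since c(0) acts by -2 h. The index s enters only through the eigenvalue of d(0): the screening
    operators have one formula for all s, but their commutation relations compare G and L taken at s
    with G and L taken at s + 1/2 or s + 1. The relation [L, L] needs no vacuum expectation value,
    as L(k) is half of {G(1/2), G(k - 1/2)}; the same formula reduces the L part of SH^+ to the G
    part. Q intertwines the actions up to sign and Q scrG^n v = scrG^n Q v. Thus the vectors in (2)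
    lie outside ker Q because those in (1) are nonzero, and are singular modulo ker Q because those
    in (1) are singular. The bound on graded pieces suffices because PBW generators and Fock
    creation modes have the same degrees, so that the PBW map is square in each degree. A
    straightening in F_(p,r) (+) W has the same coefficients in both summands, so the action read
    off in F_(p,r) also describes the one on W. *)

Section LinearFunctions.
Context {R : nzRingType} {V W : lmodType R} (f : V -> W).
Hypothesis linf : linear f.

Lemma linear_fun0 : f 0 = 0.
Proof. by have := linf (-1) 0 0; rewrite !scaleN1r !addNr. Qed.
Lemma linear_funD : {morph f : x y / x + y}.
Proof. by move=> x y; have := linf 1 x y; rewrite !scale1r. Qed.
Lemma linear_funZ a : {morph f : x / a *: x}.
Proof. by move=> x; have := linf a x 0; rewrite linear_fun0 !addr0. Qed.

End LinearFunctions.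

(** * Sums with finite support *)

Section FiniteSupportSums.
Context {T T' : choiceType} {V W : zmodType}.
Implicit Types f g : T -> V.

(** A sum over [[set: T]] is 0 by convention when infinitely many terms are nonzero, so additivity,
    linearity and exchange of sums all require this condition. A sequence rather than a finite set
    is asked for because bounds often arise as images or concatenations. *)
Definition finsuppd (T : choiceType) (V : zmodType) (f : T -> V) :=
  exists l : seq T, forall k, k \notin l -> f k = 0.

Lemma sum_finsuppd f (l : {fset T}) : (forall k, k \notin l -> f k = 0) ->
  \sum_(k \in [set: T]) f k = \sum_(k <- l) f k.
Proof. by move=> h; apply: fsbigTE => k /h. Qed.

Lemma finsuppd_fset f : finsuppd f ->
  exists l : {fset T}, forall k, k \notin l -> f k = 0.
Proof.
move=> [l h]; exists [fset k | k in l]%fset => k; rewrite in_fset /= => kl.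
exact: h.
Qed.

Lemma finsuppd_add f g : finsuppd f -> finsuppd g ->
  finsuppd (fun k => f k + g k).
Proof.
move=> [l hl] [m hm]; exists (l ++ m) => k; rewrite mem_cat negb_or.
by move=> /andP[/hl -> /hm ->]; rewrite addr0.
Qed.

Lemma sum_add f g : finsuppd f -> finsuppd g ->
  \sum_(k \in [set: T]) (f k + g k) =
  \sum_(k \in [set: T]) f k + \sum_(k \in [set: T]) g k.
Proof.
move=> /finsuppd_fset[l hl] /finsuppd_fset[m hm].
rewrite !(@sum_finsuppd _ (l `|` m)%fset) ?big_split //= => k;
  rewrite in_fsetU negb_or => /andP[kl km].
- by rewrite hm.
- by rewrite hl.
- by rewrite hl // hm // addr0.
Qed.

Lemma finsuppd_map f (D : V -> W) : D 0 = 0 -> finsuppd f ->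
  finsuppd (fun k => D (f k)).
Proof. by move=> D0 [l hl]; exists l => k /hl ->. Qed.

Lemma sum_map f (D : V -> W) : D 0 = 0 -> {morph D : x y / x + y} ->
  finsuppd f ->
  D (\sum_(k \in [set: T]) f k) = \sum_(k \in [set: T]) D (f k).
Proof.
move=> D0 DD /finsuppd_fset[l hl].
rewrite !(@sum_finsuppd _ l) // ?(big_morph D DD D0) //.
by rewrite (@fsbigTE _ _ _ _ l) // => k /hl ->.
Qed.

Lemma sum_reindex f (h : T' -> T) : bijective h ->
  \sum_(k \in [set: T]) f k = \sum_(k \in [set: T']) f (h k).
Proof. exact: reindex_fsbigT. Qed.

Lemma sum_single f a : (forall k, k != a -> f k = 0) ->
  \sum_(k \in [set: T]) f k = f a.
Proof.
move=> h; rewrite (@sum_finsuppd _ [fset a]%fset) ?big_seq_fset1 //.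
by move=> k; rewrite in_fset1 => /h.
Qed.

Lemma sum_ind (P : V -> Prop) f : P 0 ->
  (forall x y, P x -> P y -> P (x + y)) -> (forall k, P (f k)) ->
  P (\sum_(k \in [set: T]) f k).
Proof. by move=> P0 PD Pf; apply: big_ind => // k _. Qed.

End FiniteSupportSums.

Lemma sum_exchange (T T' : choiceType) (V : zmodType) (f : T -> T' -> V) :
  finsuppd (fun p : T * T' => f p.1 p.2) ->
  \sum_(i \in [set: T]) \sum_(j \in [set: T']) f i j =
  \sum_(j \in [set: T']) \sum_(i \in [set: T]) f i j.
Proof.
move=> [l hl].
pose A := [fset k.1 | k in l]%fset; pose B := [fset k.2 | k in l]%fset.
have hA i j : i \notin A -> f i j = 0.
  move=> iA; apply: (hl (i, j)); apply: contra iA => ijl.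
  by apply/imfsetP; exists (i, j).
have hB i j : j \notin B -> f i j = 0.
  move=> jB; apply: (hl (i, j)); apply: contra jB => ijl.
  by apply/imfsetP; exists (i, j).
rewrite (@sum_finsuppd _ _ _ A); last first.
  by move=> i iA; apply: fsbig1 => j _; apply: hA.
rewrite (@sum_finsuppd _ _ _ B); last first.
  by move=> i iA; apply: fsbig1 => j _; apply: hB.
have E i : \sum_(j \in [set: T']) f i j = \sum_(j <- B) f i j.
  by apply: sum_finsuppd => j; apply: hB.
under eq_bigr => i _ do rewrite E.
rewrite exchange_big /=; apply: eq_bigr => j _.
by rewrite (@sum_finsuppd _ _ _ A) // => i; apply: hA.
Qed.

Lemma finsuppd_sum (T T' : choiceType) (V : zmodType) (f : T -> T' -> V) :
  finsuppd (fun p : T * T' => f p.1 p.2) ->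
  finsuppd (fun i => \sum_(j \in [set: T']) f i j).
Proof.
move=> [l hl]; exists [seq k.1 | k <- l] => i hi; apply: fsbig1 => j _.
by apply: (hl (i, j)); apply: contra hi => ij; apply/mapP; exists (i, j).
Qed.

Lemma finsuppd_swap (T T' : choiceType) (V : zmodType) (f : T -> T' -> V) :
  finsuppd (fun q : T * T' => f q.1 q.2) -> finsuppd (fun q : T' * T => f q.2 q.1).
Proof.
move=> [l hl]; exists [seq (q.2, q.1) | q <- l] => -[a j] h; apply: (hl (j, a)).
by apply: contra h => h; apply/mapP; exists (j, a).
Qed.

Lemma finsuppd_scale (T : choiceType) (R : pzRingType) (V : lmodType R) (a : R) (f : T -> V) :
  finsuppd f -> finsuppd (fun k => a *: f k).
Proof. by move=> [l hl]; exists l => k /hl ->; rewrite scaler0. Qed.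

Lemma sum_scale (T : choiceType) (R : pzRingType) (V : lmodType R) (a : R) (f : T -> V) :
  finsuppd f -> a *: (\sum_(k \in [set: T]) f k) = \sum_(k \in [set: T]) a *: f k.
Proof. exact: (sum_map (D := fun u : V => a *: u) (scaler0 _ a) (scalerDr a)). Qed.

Definition int_range (N : nat) : seq int :=
  [seq k%:Z - N%:Z | k <- iota 0 (2 * N).+1].

Lemma mem_int_range N (k : int) : (k \in int_range N) = (`|k| <= N%:Z).
Proof.
apply/mapP/idP => [[k1]|h]; first by rewrite mem_iota => hi ->; lia.
by exists (absz (k + N%:Z)); rewrite ?mem_iota; lia.
Qed.

Lemma finsuppd_int (V : zmodType) (f : int -> V) (N : nat) :
  (forall k : int, N%:Z < `|k| -> f k = 0) -> finsuppd f.
Proof.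
by move=> h; exists (int_range N) => k; rewrite mem_int_range -ltNge => /h.
Qed.

Lemma finsuppd_int2 (V : zmodType) (f : int -> int -> V) (N : nat) :
  (forall k l : int, N%:Z < `|k| \/ N%:Z < `|l| -> f k l = 0) ->
  finsuppd (fun p : int * int => f p.1 p.2).
Proof.
move=> h; exists [seq (k, l) | k <- int_range N, l <- int_range N] => -[k l].
move=> hkl; apply: h; apply/orP; apply: contraNT hkl; rewrite negb_or -!leNgt.
by move=> /andP[hk hl]; apply: allpairs_f; rewrite mem_int_range.
Qed.

Lemma sum_shift (V : zmodType) (a : int) (f : int -> V) :
  \sum_(k \in [set: int]) f k = \sum_(k \in [set: int]) f (k + a).
Proof.
by apply: sum_reindex; exists (fun k => k - a) => k; rewrite ?addrK ?subrK.
Qed.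

Lemma sum_reflect (V : zmodType) (a : int) (f : int -> V) :
  \sum_(k \in [set: int]) f k = \sum_(k \in [set: int]) f (a - k).
Proof.
by apply: sum_reindex; exists (fun k => a - k) => k; rewrite subKr.
Qed.

Lemma eq_sumT (T : choiceType) (V : zmodType) (f g : T -> V) : f =1 g ->
  \sum_(k \in [set: T]) f k = \sum_(k \in [set: T]) g k.
Proof. by move=> h; apply: eq_fsbigr => k _. Qed.

(** * The Fock space *)

(* Sealing the basis vectors keeps unification from unfolding them. *)
HB.lock Definition ket (C : numClosedFieldType) (s : state) : @Fock C := << s >>.

Section FockBasics.
Context {C : numClosedFieldType}.
Local Notation Fock := (@Fock C).
Implicit Types (x y : Fock) (s t : state) (i j : bool * nat).

(** [lin_ext] with an arbitrary target, as needed for the PBW map. The creation and annihilation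
    modes are instances of it, and inherit its linearity. *)
Definition flin (W : lmodType C) (f : state -> W) (x : Fock) : W :=
  \sum_(s <- msupp x) x@_s *: f s.

Lemma flinEw (W : lmodType C) (f : state -> W) x (D : {fset state}) :
  (msupp x `<=` D)%fset -> flin f x = \sum_(s <- D) x@_s *: f s.
Proof.
move=> h; rewrite /flin (big_fset_incl _ h) // => s sD sx.
by rewrite mcoeff_outdom ?scale0r.
Qed.

Lemma flin_linear (W : lmodType C) (f : state -> W) : linear (flin f).
Proof.
move=> a x y; pose D := (msupp x `|` msupp y `|` msupp (a *: x + y))%fset.
rewrite !(@flinEw _ _ _ D) ?fsubsetUr //; first last.
- by rewrite /D -fsetUA fsubsetUl.
- by rewrite /D (fsetUC (msupp x)) -fsetUA fsubsetUl.
rewrite scaler_sumr -big_split /=; apply: eq_bigr => s _.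
by rewrite mcoeffD mcoeffZ scalerDl scalerA.
Qed.

HB.instance Definition _ (W : lmodType C) (f : state -> W) :=
  GRing.isLinear.Build C Fock W *:%R (flin f) (flin_linear f).

Local Notation ket := (@ket C).

Lemma flinU (W : lmodType C) (f : state -> W) s : flin f (ket s) = f s.
Proof.
rewrite ket.unlock /flin (msuppU s (1 : C)) oner_eq0 big_seq_fset1 (mcoeffUU s (1 : C)).
by rewrite scale1r.
Qed.

Lemma state_ind (P : Fock -> Prop) :
  (forall a x y, P x -> P y -> P (a *: x + y)) -> (forall s, P (ket s)) ->
  forall x, P x.
Proof.
move=> Plin Ps x.
have P0 : P 0.
  by have := Plin (-1) _ _ (Ps ([fsfun], fset0)) (Ps ([fsfun], fset0));
    rewrite scaleN1r addNr.
rewrite (monalgE (x : {malg C[state]})); apply: big_ind => //.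
  by move=> u v hu hv; rewrite -(scale1r u); apply: Plin.
move=> s _; have -> : << x@_s *g s >> = x@_s *: ket s + 0.
  by apply/malgP => t; rewrite ket.unlock addr0 mcoeffZ !mcoeffU mulr_natr.
exact: Plin.
Qed.

Lemma mcoeff_state s t : (ket s)@_t = (s == t)%:R.
Proof. by rewrite ket.unlock (mcoeffU s (1 : C)). Qed.

HB.instance Definition _ i := GRing.isLinear.Build C Fock Fock *:%R
  (bcreate i) (flin_linear _).
HB.instance Definition _ i := GRing.isLinear.Build C Fock Fock *:%R
  (bannih i) (flin_linear _).
HB.instance Definition _ i := GRing.isLinear.Build C Fock Fock *:%R
  (fcreate i) (flin_linear _).
HB.instance Definition _ i := GRing.isLinear.Build C Fock Fock *:%R
  (fannih i) (flin_linear _).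

Lemma bcreateE i s : bcreate i (ket s) =
  ket ([fsfun s.1 with i |-> (s.1 i).+1], s.2) :> Fock.
Proof. by rewrite [LHS]flinU ket.unlock. Qed.
Lemma bannihE i s : bannih i (ket s) =
  (s.1 i)%:R *: ket ([fsfun s.1 with i |-> (s.1 i).-1], s.2) :> Fock.
Proof. by rewrite [LHS]flinU ket.unlock. Qed.
Lemma fcreateE i s : fcreate i (ket s) =
  if i \in s.2 then 0
  else fsign i s.2 *: ket (s.1, (i |` s.2)%fset) :> Fock.
Proof. by rewrite [LHS]flinU ket.unlock. Qed.
Lemma fannihE i s : fannih i (ket s) =
  if i \in s.2 then fsign i s.2 *: ket (s.1, (s.2 `\ i)%fset)
  else 0 :> Fock.
Proof. by rewrite [LHS]flinU ket.unlock. Qed.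

Lemma fsfun_with2C (f : {fsfun bool * nat -> nat with 0%N}) i j a b : i != j ->
  [fsfun [fsfun f with i |-> a] with j |-> b] =
  [fsfun [fsfun f with j |-> b] with i |-> a].
Proof.
move=> ij; apply/fsfunP => k; rewrite !fsfun_withE.
by case: eqP => // ->; rewrite eq_sym (negbTE ij).
Qed.

Lemma fsfun_with2 (f : {fsfun bool * nat -> nat with 0%N}) i a b :
  [fsfun [fsfun f with i |-> a] with i |-> b] = [fsfun f with i |-> b].
Proof. by apply/fsfunP => k; rewrite !fsfun_withE; case: eqP. Qed.

Lemma bcreateC i j x : bcreate i (bcreate j x) = bcreate j (bcreate i x).
Proof.
elim/state_ind: x => [a x y hx hy|s]; first by rewrite !linearP /= hx hy.
rewrite !bcreateE /= !fsfun_withE.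
have [->//|ij] := eqVneq i j.
by rewrite fsfun_with2C 1?eq_sym.
Qed.

Lemma bannihC i j x : bannih i (bannih j x) = bannih j (bannih i x).
Proof.
elim/state_ind: x => [a x y hx hy|s]; first by rewrite !linearP /= hx hy.
rewrite !bannihE /= !linearZ /= !bannihE /= !fsfun_withE.
have [->//|ij] := eqVneq i j.
by rewrite fsfun_with2C 1?eq_sym // !scalerA mulrC.
Qed.

Lemma bannih_create i j x : bannih i (bcreate j x) =
  bcreate j (bannih i x) + (i == j)%:R *: x.
Proof.
elim/state_ind: x => [a x y hx hy|s].
  by rewrite !linearP /= hx hy !scalerDr addrACA.
rewrite bannihE linearZ /= !bcreateE bannihE /= !fsfun_withE.
have [->|ij] := eqVneq i j; rewrite /= ?eqxx.
  rewrite !fsfun_with2 /= fsfun_with_id scale1r -surjective_pairing.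
  case: (s.1 j) (fsfun_with_id s.1 j) => [|n] h.
    by rewrite scale0r add0r scale1r.
  by rewrite /= h -surjective_pairing -natr1 scalerDl scale1r.
by rewrite scale0r addr0 fsfun_with2C 1?eq_sym.
Qed.

Lemma bcreate_fcreate i j x : bcreate i (fcreate j x) = fcreate j (bcreate i x).
Proof.
elim/state_ind: x => [a x y hx hy|s]; first by rewrite !linearP /= hx hy.
rewrite bcreateE !fcreateE /=; case: ifP; rewrite ?linear0 // linearZ /=.
by rewrite bcreateE.
Qed.
Lemma bcreate_fannih i j x : bcreate i (fannih j x) = fannih j (bcreate i x).
Proof.
elim/state_ind: x => [a x y hx hy|s]; first by rewrite !linearP /= hx hy.
rewrite bcreateE !fannihE /=; case: ifP; rewrite ?linear0 // linearZ /=.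
by rewrite bcreateE.
Qed.
Lemma bannih_fcreate i j x : bannih i (fcreate j x) = fcreate j (bannih i x).
Proof.
elim/state_ind: x => [a x y hx hy|s]; first by rewrite !linearP /= hx hy.
rewrite bannihE linearZ /= !fcreateE /=; case: ifP; rewrite ?linear0 ?scaler0 //.
by rewrite linearZ /= bannihE !scalerA mulrC.
Qed.
Lemma bannih_fannih i j x : bannih i (fannih j x) = fannih j (bannih i x).
Proof.
elim/state_ind: x => [a x y hx hy|s]; first by rewrite !linearP /= hx hy.
rewrite bannihE linearZ /= !fannihE /=; case: ifP; rewrite ?linear0 ?scaler0 //.
by rewrite linearZ /= bannihE !scalerA mulrC.
Qed.

Lemma mode_ltNge i j : i != j -> mode_lt j i = ~~ mode_lt i j.
Proof.
case: i j => [a k] [b l]; rewrite /mode_lt /= xpair_eqE.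
by case: a; case: b => //=; lia.
Qed.

Lemma fsignU i j (F : {fset bool * nat}) : j \notin F ->
  fsign i (j |` F)%fset = (-1) ^+ mode_lt j i * fsign i F :> C.
Proof.
move=> jF; rewrite /fsign -exprD; congr (_ ^+ _).
case: (boolP (mode_lt j i)) => h.
  have -> : [fset k in (j |` F) | mode_lt k i]%fset =
    (j |` [fset k in F | mode_lt k i])%fset.
    by apply/fsetP => k; rewrite !inE; case: eqP => // ->.
  by rewrite cardfsU1 !inE (negbTE jF).
congr #|` _|; apply/fsetP => k; rewrite !inE; case: eqP => // -> /=.
by rewrite (negbTE h) (negbTE jF).
Qed.

Lemma fsignD i j (F : {fset bool * nat}) : j \in F ->
  fsign i (F `\ j)%fset = (-1) ^+ mode_lt j i * fsign i F :> C.
Proof.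
move=> jF; have := @fsignU i j (F `\ j)%fset; rewrite fsetD1K // => -> //.
  by rewrite mulrA -signr_addb addbb mul1r.
by rewrite !inE eqxx.
Qed.

Lemma fsign_id i (F : {fset bool * nat}) : fsign i F * fsign i F = 1 :> C.
Proof. by rewrite /fsign -exprD addnn -muln2 exprM sqrr_sign. Qed.

Lemma sign_mode_lt i j : i != j ->
  (-1) ^+ mode_lt j i = - (-1) ^+ mode_lt i j :> C.
Proof.
by move=> /mode_ltNge ->; case: mode_lt; rewrite ?expr0 ?expr1 ?opprK.
Qed.

Lemma mode_ltxx i : mode_lt i i = false.
Proof. by rewrite /mode_lt !ltnn andbF. Qed.

Lemma fcreateC i j x : fcreate i (fcreate j x) = - fcreate j (fcreate i x).
Proof.
elim/state_ind: x => [a x y hx hy|s].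
  by rewrite !linearP /= hx hy.
have h k : fcreate k (fcreate k (ket s)) = 0 :> Fock.
  rewrite fcreateE; case: ifP; rewrite ?linear0 // linearZ /= fcreateE /=.
  by rewrite !inE eqxx scaler0.
have [->|ij] := eqVneq i j; first by rewrite h oppr0.
have ji : j != i by rewrite eq_sym.
rewrite !fcreateE; case: (boolP (i \in s.2)) => hi;
  case: (boolP (j \in s.2)) => hj; rewrite ?linear0 ?oppr0 //=.
- by rewrite linearZ /= fcreateE /= !inE hi orbT scaler0.
- by rewrite linearZ /= fcreateE /= !inE hj orbT scaler0 oppr0.
rewrite !linearZ /= !fcreateE /= !inE (negbTE hi) (negbTE hj) !orbF.
rewrite (negbTE ij) (negbTE ji) -scaleNr !scalerA fsetUCA.
by congr (_ *: _); rewrite !fsignU // (sign_mode_lt ij); ring.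
Qed.

Lemma fannihC i j x : fannih i (fannih j x) = - fannih j (fannih i x).
Proof.
elim/state_ind: x => [a x y hx hy|s].
  by rewrite !linearP /= hx hy.
have h k : fannih k (fannih k (ket s)) = 0 :> Fock.
  rewrite fannihE; case: ifP; rewrite ?linear0 // linearZ /= fannihE /=.
  by rewrite !inE eqxx scaler0.
have [->|ij] := eqVneq i j; first by rewrite h oppr0.
have ji : j != i by rewrite eq_sym.
rewrite !fannihE; case: (boolP (i \in s.2)) => hi;
  case: (boolP (j \in s.2)) => hj; rewrite ?linear0 ?oppr0 //=.
- rewrite !linearZ /= !fannihE /= !inE hi hj !andbT.
  rewrite (negbTE ij) (negbTE ji) /= -scaleNr !scalerA fsetDDl.
  rewrite fsetDDl (fsetUC [fset j]%fset).
  by congr (_ *: _); rewrite !fsignD // (sign_mode_lt ij); ring.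
- by rewrite linearZ /= fannihE /= !inE (negbTE hj) andbF scaler0 oppr0.
- by rewrite linearZ /= fannihE /= !inE (negbTE hi) andbF scaler0.
Qed.

Lemma fannih_create i j x : fannih i (fcreate j x) =
  - fcreate j (fannih i x) + (i == j)%:R *: x.
Proof.
elim/state_ind: x => [a x y hx hy|s].
  by rewrite !linearP /= hx hy !scalerDr addrACA.
rewrite fcreateE fannihE.
have [->|ij] := eqVneq i j.
  case: ifPn => h; rewrite ?linear0 ?add0r ?oppr0 ?add0r !linearZ /= ?scale1r ?scalerN.
    rewrite fcreateE /= !inE eqxx /= fsetD1K // scalerA fsignD // mode_ltxx.
    by rewrite mul1r fsign_id scale1r -surjective_pairing addNr.
  rewrite fannihE /= !inE eqxx /= scalerA fsignU // mode_ltxx mul1r fsign_id.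
  by rewrite scale1r fsetU1K // -surjective_pairing.
rewrite scale0r addr0; case: (boolP (i \in s.2)) => hi;
  case: (boolP (j \in s.2)) => hj; rewrite ?linear0 ?oppr0 //=.
- by rewrite linearZ /= fcreateE /= !inE hj eq_sym ij /= !(oppr0, scaler0).
- rewrite !linearZ /= fcreateE fannihE /= !inE hi (negbTE hj) andbF orbT.
  rewrite ?scalerN -scaleNr !scalerA; have -> : ((j |` s.2) `\ i = j |` (s.2 `\ i))%fset.
    by apply/fsetP => k; rewrite !inE; case: eqP => // ->; case: eqP ij.
  congr (_ *: _); rewrite fsignU // fsignD // (sign_mode_lt ij).
  by ring.
- by rewrite linearZ /= fannihE /= !inE (negbTE hi) (negbTE ij) scaler0.
Qed.

Definition vac0 : state := ([fsfun], fset0).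

(* [sdeg] is twice the conformal degree, so that it is an integer. *)
Definition bdeg (f : {fsfun bool * nat -> nat with 0%N}) : nat :=
  \sum_(i <- finsupp f) f i * (2 * i.2.+1).
Definition fdeg (F : {fset bool * nat}) : nat := \sum_(i <- F) (2 * i.2).+1.
Definition sdeg (s : state) : nat := (bdeg s.1 + fdeg s.2)%N.

Definition incr i s : state := ([fsfun s.1 with i |-> (s.1 i).+1], s.2).
Definition fins i s : state := (s.1, (i |` s.2)%fset).

Lemma bdegEw f (D : {fset bool * nat}) : (finsupp f `<=` D)%fset ->
  bdeg f = (\sum_(i <- D) f i * (2 * i.2.+1))%N.
Proof.
by move=> h; apply: big_fset_incl => // i _ hi; rewrite fsfun_dflt.
Qed.

Lemma sdeg_vac0 : sdeg vac0 = 0%N.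
Proof. by rewrite /sdeg /= /bdeg finsupp0 big_seq_fset0 /fdeg big_seq_fset0. Qed.

Lemma sdeg_incr i s : sdeg (incr i s) = (2 * i.2.+1 + sdeg s)%N.
Proof.
rewrite /sdeg /= addnA; congr addn.
set f := s.1; pose D := (i |` finsupp f)%fset.
rewrite !(@bdegEw _ D) ?fsubsetUr //; last first.
  by rewrite finsupp_with /=; exact: fsubset_refl.
have iD : i \in D by rewrite /D in_fset1U eqxx.
rewrite !(@big_fsetD1 _ _ _ _ i D) //= fsfun_with mulSn -addnA.
congr (_ + (_ + _))%N; apply: eq_big_seq => j; rewrite in_fsetD1 => /andP[ji _].
by rewrite fsfun_withE (negbTE ji).
Qed.

Lemma sdeg_fins i s : i \notin s.2 ->
  sdeg (fins i s) = ((2 * i.2).+1 + sdeg s)%N.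
Proof.
by move=> h; rewrite /sdeg /fdeg /fins /= big_fsetU1 //= addnCA.
Qed.

Variant state_spec s : Type :=
| StateVac of s = vac0
| StateIncr i s' of s = incr i s'
| StateFins i s' of s = fins i s' & i \notin s'.2.

Lemma stateP s : state_spec s.
Proof.
case: s => f F.
have [F0|[i iF]] := fset_0Vmem F; last first.
  apply: (@StateFins _ i (f, (F `\ i)%fset)); rewrite /fins /= ?inE ?eqxx //.
  by rewrite fsetD1K.
have [f0|[i hi]] := fset_0Vmem (finsupp f).
  apply: StateVac; rewrite F0; congr pair; apply/fsfunP => i.
  by rewrite fsfun0E fsfun_dflt // f0 inE.
apply: (@StateIncr _ i ([fsfun f with i |-> (f i).-1], F)).
rewrite /incr /= fsfun_with fsfun_with2 prednK ?fsfun_with_id //.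
by rewrite lt0n -mem_finsupp.
Qed.

(** Every basis state other than the vacuum arises, up to sign, from a state of smaller [sdeg] by
    one creation mode. *)
Lemma vac_ind (P : Fock -> Prop) :
  (forall a x y, P x -> P y -> P (a *: x + y)) -> P (ket vac0) ->
  (forall i x, P x -> P (bcreate i x)) ->
  (forall i x, P x -> P (fcreate i x)) -> forall x, P x.
Proof.
move=> Plin P0 Pb Pf; elim/state_ind => // s.
have PZ a x : P x -> P (a *: x).
  move=> hx; have {}P0 : P 0.
    by have := Plin (-1) _ _ P0 P0; rewrite scaleN1r addNr.
  by rewrite -[a *: x]addr0; apply: Plin.
have [n] := ubnP (sdeg s); elim: n s => // n IH s.
case: (stateP s) => [->//|i t ->|i t -> hi].
  by rewrite sdeg_incr -bcreateE => h; apply: Pb; apply: IH; lia.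
rewrite sdeg_fins // => h; have ht : P (ket t) by apply: IH; lia.
have := PZ (fsign i t.2) _ (Pf i _ ht).
by rewrite fcreateE (negbTE hi) scalerA fsign_id scale1r.
Qed.

Lemma mcoeff_bannih i x t : (bannih i x)@_t = (t.1 i).+1%:R * x@_(incr i t).
Proof.
elim/state_ind: x => [a x y hx hy|s].
  by rewrite linearP /= !mcoeffD !mcoeffZ hx hy; ring.
rewrite bannihE mcoeffZ !mcoeff_state; case: eqP => [<-|h].
  rewrite /= fsfun_with; case: (posnP (s.1 i)) => [h|h].
    case: eqP => [e|_]; last by rewrite h mul0r mulr0.
    by have := congr1 (fun u : state => u.1 i) e; rewrite h /= fsfun_with.
  rewrite prednK // /incr /= fsfun_with fsfun_with2 prednK //.
  by rewrite fsfun_with_id -surjective_pairing eqxx.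
case: eqP => [e|_]; last by rewrite !mulr0.
case: h; rewrite e /= fsfun_with /= fsfun_with2 fsfun_with_id.
by rewrite -surjective_pairing.
Qed.

Lemma mcoeff_fannih i x t : i \notin t.2 ->
  (fannih i x)@_t = fsign i t.2 * x@_(fins i t).
Proof.
move=> ht; elim/state_ind: x => [a x y hx hy|s].
  by rewrite linearP /= !mcoeffD !mcoeffZ hx hy; ring.
rewrite fannihE mcoeff_state; case: ifPn => hi; last first.
  rewrite mcoeff0; case: eqP => [e|_]; last by rewrite mulr0.
  by move: hi; rewrite e /= !inE eqxx.
rewrite mcoeffZ mcoeff_state; case: eqP => [<-|h].
  rewrite /fins /= fsetD1K // -surjective_pairing eqxx.
  by rewrite fsignD // mode_ltxx mul1r.
case: eqP => [e|_]; last by rewrite !mulr0.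
by case: h; rewrite e /= fsetU1K // -surjective_pairing.
Qed.

(** Up to a nonzero factor, the coefficient of x at a state other than the vacuum is a coefficient
    of some [bannih i x] or [fannih i x]. *)
Lemma annihilated_vac x : (forall i, bannih i x = 0) ->
  (forall i, fannih i x = 0) -> x = x@_vac0 *: ket vac0.
Proof.
move=> hb hf; apply/malgP => t; rewrite mcoeffZ mcoeff_state.
case: (stateP t) => [->|i s e|i s e hi]; first by rewrite eqxx mulr1.
  have -> : (vac0 == t) = false.
    apply/eqP => h; have := congr1 sdeg h; rewrite e sdeg_incr sdeg_vac0; lia.
  have := mcoeff_bannih i x s; rewrite hb mcoeff0 -e mulr0 => /esym/eqP.
  by rewrite mulf_eq0 pnatr_eq0 /= => /eqP.
have -> : (vac0 == t) = false.
  apply/eqP => h; have := congr1 sdeg h; rewrite e sdeg_fins // sdeg_vac0; lia.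
have := mcoeff_fannih x hi; rewrite hf mcoeff0 -e mulr0 => /(congr1 ( *%R (fsign i s.2))).
by rewrite mulr0 mulrA fsign_id mul1r.
Qed.

Lemma annih_finite x : exists N, forall i, (N <= i.2)%N ->
  bannih i x = 0 /\ fannih i x = 0.
Proof.
elim/state_ind: x => [a x y [M hM] [N hN]|s].
  exists (maxn M N) => i; rewrite geq_max => /andP[/hM[hx hx'] /hN[hy hy']].
  by rewrite !linearP /= hx hx' hy hy' scaler0 addr0.
exists (\max_(j <- finsupp s.1) j.2 + \max_(j <- s.2) j.2).+1 => i h.
have bound (l : {fset bool * nat}) : i \in l -> (i.2 <= \max_(j <- l) j.2)%N.
  by move=> hi; exact: (@leq_bigmax_seq _ (enum_fset l) xpredT (fun j => j.2) i hi isT).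
rewrite bannihE fannihE fsfun_dflt ?scale0r; last first.
  by apply: contraTN h => /bound /=; lia.
by case: ifPn => // /bound b; have := leq_trans h b; rewrite ltnNge leq_addl.
Qed.

End FockBasics.

(* [bos z b n] is c(n) or d(n), with z the eigenvalue of the zero mode. *)
HB.lock Definition bos (C : numClosedFieldType) (z : C) (b : bool) (n : int)
    (x : @Fock C) : @Fock C :=
  match n with
  | Posz 0 => z *: x
  | Posz k.+1 => (k.+1%:R * 2%:R) *: bannih (~~ b, k) x
  | Negz k => bcreate (b, k) x
  end.

HB.lock Definition fmo (C : numClosedFieldType) (b : bool) (n : int)
    (x : @Fock C) : @Fock C := fer b (s := 0) n x.

(** * Modes of c, d, Psi^+ and Psi^-, and their canonical relations *)

Section Modes.
Context {C : numClosedFieldType}.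
Local Notation Fock := (@Fock C).
Local Notation bos := (@bos C).
Local Notation fmo := (@fmo C).
Local Notation vac := (ket C vac0).
Implicit Types (x y : Fock) (z : C) (b : bool) (m n : int).

Lemma bos_linear z b n : linear (bos z b n).
Proof.
move=> a x y; rewrite bos.unlock; by case: n => [[|k]|k] /=; rewrite !linearP.
Qed.
HB.instance Definition _ z b n :=
  GRing.isLinear.Build C Fock Fock *:%R (bos z b n) (bos_linear z b n).

Lemma fmo_linear b n : linear (fmo b n).
Proof. by move=> a x y; rewrite fmo.unlock; case: n => k /=; rewrite linearP. Qed.
HB.instance Definition _ b n :=
  GRing.isLinear.Build C Fock Fock *:%R (fmo b n) (fmo_linear b n).

Lemma bannihZ i (a : C) x : bannih i (a *: x) = a *: bannih i x.
Proof. exact: linearZ. Qed.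

Lemma bcreateZ i (a : C) x : bcreate i (a *: x) = a *: bcreate i x.
Proof. exact: linearZ. Qed.

Lemma fannihZ i (a : C) x : fannih i (a *: x) = a *: fannih i x.
Proof. exact: linearZ. Qed.

Lemma fcreateZ i (a : C) x : fcreate i (a *: x) = a *: fcreate i x.
Proof. exact: linearZ. Qed.

(** Zero modes are scalars, so the eigenvalues z and z' are free: the relation covers c against d,
    as well as modes taken on different F_(p,s). *)
Lemma bosC z z' b b' m n x : bos z b m (bos z' b' n x) =
  bos z' b' n (bos z b m x) +
  (((b != b') && (m + n == 0))%:R * (m%:~R * 2%:R)) *: x.
Proof.
have swap (a a' : C) u : a *: (a' *: u) = a' *: (a *: u).
  by rewrite scalerA mulrC -scalerA.
have z0 u v (P Q : bool) (a : C) : u = v -> Q = false \/ a = 0 ->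
    u = v + ((P && Q)%:R * a) *: x.
  by move=> -> [->|->]; rewrite ?andbF ?mul0r ?mulr0 scale0r addr0.
rewrite bos.unlock; case: m n => [[|m]|m] [[|n]|n] /=.
- by apply: z0; [exact: swap | right; rewrite mul0r].
- by apply: z0; [rewrite bannihZ swap | left].
- by apply: z0; [rewrite bcreateZ | left].
- by apply: z0; [rewrite bannihZ swap | left].
- by apply: z0; [rewrite !bannihZ bannihC swap | left].
- rewrite bannih_create scalerDr scalerA bcreateZ; congr (_ + _ *: _).
  rewrite mulrC; congr (_ * _); congr (_%:R); congr nat_of_bool.
  by rewrite xpair_eqE; case: b; case: b' => //=; lia.
- by apply: z0; [rewrite bcreateZ | left].
- rewrite bannih_create scalerDr scalerA -addrA -scalerDl bcreateZ.
  rewrite -[LHS]addr0 -{1}(scale0r x); congr (_ + _ *: _); apply: esym.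
  rewrite xpair_eqE NegzE rmorphN /=.
  have -> : (~~ b' == b) = (b != b') by case: b b' => [] [].
  have -> : (- m.+1%:Z + n.+1 == 0) = (n == m) by lia.
  case: (n =P m) => [->|_]; last by rewrite andbF mulr0 mul0r addr0.
  by rewrite andbT -[m.+1%:~R]/(m.+1%:R); ring.
- by apply: z0; [rewrite bcreateC | left].
Qed.

Lemma fmoC b b' m n x : fmo b m (fmo b' n x) = - fmo b' n (fmo b m x) +
  ((b != b') && (m + n + 1 == 0))%:R *: x.
Proof.
have z0 u v (P Q : bool) : u = v -> Q = false -> u = v + (P && Q)%:R *: x.
  by move=> -> ->; rewrite andbF scale0r addr0.
rewrite fmo.unlock; case: m n => [m|m] [n|n] /=.
- by apply: z0; [exact: fannihC | lia].
- rewrite fannih_create; congr (_ + _%:R *: _); congr nat_of_bool.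
  by rewrite xpair_eqE; case: b; case: b' => //=; lia.
- rewrite fannih_create opprD opprK -addrA -scaleNr -scalerDl.
  rewrite -[LHS]addr0 -{1}(scale0r x); congr (_ + _ *: _); apply: esym.
  rewrite addrC; apply/eqP; rewrite subr_eq0 xpair_eqE; apply/eqP.
  by congr (_%:R); congr nat_of_bool; case: b; case: b' => //=; lia.
- by apply: z0; [exact: fcreateC | lia].
Qed.

Lemma bos_fmo z b b' m n x : bos z b m (fmo b' n x) = fmo b' n (bos z b m x).
Proof.
rewrite bos.unlock fmo.unlock; case: m n => [[|m]|m] [n|n] /=.
- by rewrite fannihZ.
- by rewrite fcreateZ.
- by rewrite fannihZ bannih_fannih.
- by rewrite fcreateZ bannih_fcreate.
- by rewrite bcreate_fannih.
- by rewrite bcreate_fcreate.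
Qed.

Lemma modes_finite x : exists N : nat, forall n : int, N%:Z < n ->
  (forall z b, bos z b n x = 0) /\ (forall b, fmo b n x = 0).
Proof.
have [N hN] := annih_finite x; exists N.+1 => -[[|n]|n] // h.
split=> [z b|b]; rewrite ?bos.unlock ?fmo.unlock /=.
  by have [|->] := hN (~~ b, n); rewrite ?scaler0 //=; lia.
by have [|_ ->] := hN (~~ b, n.+1); rewrite //=; lia.
Qed.

Lemma modes_ind (P : Fock -> Prop) (z : bool -> C) :
  (forall a x y, P x -> P y -> P (a *: x + y)) -> P vac ->
  (forall b n x, n < 0 -> P x -> P (bos (z b) b n x)) ->
  (forall b n x, n < 0 -> P x -> P (fmo b n x)) -> forall x, P x.
Proof.
move=> Pl P0 Pb Pf; apply: vac_ind => // -[b k] x hx.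
  by have := Pb b (Negz k) x isT hx; rewrite bos.unlock.
by have := Pf b (Negz k) x isT hx; rewrite fmo.unlock.
Qed.

Lemma bos_vac z b n : 0 < n -> bos z b n vac = 0.
Proof.
by rewrite bos.unlock; case: n => [[|n]|n] //= _; rewrite bannihE fsfun0E scale0r scaler0.
Qed.

Lemma bos0 z b x : bos z b 0 x = z *: x.
Proof. by rewrite bos.unlock. Qed.

Lemma fmo_vac b n : 0 <= n -> fmo b n vac = 0.
Proof. by rewrite fmo.unlock; case: n => [n|n] //= _; rewrite fannihE. Qed.

Lemma modes_vac x : (forall b n, 0 < n -> bos 0 b n x = 0) ->
  (forall b n, 0 <= n -> fmo b n x = 0) -> x = x@_vac0 *: vac.
Proof.
move=> hb hf; apply: annihilated_vac => -[b k].
  have := hb (~~ b) k.+1 isT; rewrite bos.unlock negbK => /eqP.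
  by rewrite scaler_eq0 -natrM pnatr_eq0 /= => /eqP.
by have := hf (~~ b) k isT; rewrite fmo.unlock /= negbK.
Qed.

Lemma vac_bos z b n x : n < 0 -> (bos z b n x)@_vac0 = 0.
Proof.
rewrite bos.unlock; case: n => // k _; elim/(@state_ind C): x => [a x y hx hy|s].
  by rewrite linearP mcoeffD mcoeffZ hx hy mulr0 addr0.
rewrite bcreateE mcoeff_state; case: eqP => // /(congr1 (fun t : state => t.1 (b, k))).
by rewrite /= fsfun_with fsfun0E.
Qed.

Lemma vac_fmo b n x : n < 0 -> (fmo b n x)@_vac0 = 0.
Proof.
rewrite fmo.unlock; case: n => // k _ /=; elim/(@state_ind C): x => [a x y hx hy|s].
  by rewrite linearP mcoeffD mcoeffZ hx hy mulr0 addr0.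
rewrite fcreateE; case: ifP => h; first by rewrite mcoeff0.
rewrite mcoeffZ mcoeff_state; case: eqP => [|_]; last by rewrite mulr0.
move=> /(congr1 (fun t : state => (b, k) \in t.2)).
by rewrite /= !inE eqxx.
Qed.

End Modes.

(** * Normally ordered products *)

(* Identities of vectors in the Fock space are checked coefficientwise; the
   linear combinations are reified because rewriting with [mcoeffD] is slow. *)
Inductive lincomb (C : numClosedFieldType) : Type :=
| LCatom of @Fock C | LCzero | LCadd of lincomb C & lincomb C
| LCopp of lincomb C | LCscale of C & lincomb C.

Fixpoint lc_vec (C : numClosedFieldType) (e : lincomb C) : @Fock C :=
  match e with
  | LCatom x => x | LCzero => 0 | LCadd a b => lc_vec a + lc_vec b
  | LCopp a => - lc_vec a | LCscale k a => k *: lc_vec a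
  end.

Fixpoint lc_coeff (C : numClosedFieldType) t (e : lincomb C) : C :=
  match e with
  | LCatom x => x@_t | LCzero => 0 | LCadd a b => lc_coeff t a + lc_coeff t b
  | LCopp a => - lc_coeff t a | LCscale k a => k * lc_coeff t a
  end.

Lemma lincomb_eq (C : numClosedFieldType) (e f : lincomb C) :
  (forall t, lc_coeff t e = lc_coeff t f) -> lc_vec e = lc_vec f.
Proof.
have E t g : (lc_vec g)@_t = lc_coeff t g.
  elim: g => [x||a ha b hb|a ha|k a ha] //=.
  - exact: mcoeff0.
  - by rewrite -ha -hb; exact: mcoeffD.
  - by rewrite -ha; exact: mcoeffN.
  - by rewrite -ha; exact: mcoeffZ.
by move=> h; apply/malgP => t; rewrite !E.
Qed.

Ltac lc_reify C x :=
  match x with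
  | ?a + ?b => let e := lc_reify C a in let f := lc_reify C b in
               constr:(@LCadd C e f)
  | - ?a => let e := lc_reify C a in constr:(@LCopp C e)
  | ?k *: ?a => let e := lc_reify C a in constr:(@LCscale C k e)
  | 0 => constr:(@LCzero C)
  | _ => constr:(@LCatom C x)
  end.

Ltac mcoeffs :=
  match goal with C : numClosedFieldType |- ?x = ?y =>
    let e := lc_reify C x in let f := lc_reify C y in
    refine (@lincomb_eq C e f _)
  end;
  let t := fresh "t" in intro t; cbn [lc_coeff];
  repeat match goal with |- context [mcoeff t ?u] => move: (mcoeff t u) => ? end.

Definition locally_finite (C : numClosedFieldType) (A : int -> @Fock C -> @Fock C) :=
  forall x, exists N : nat, forall n : int, N%:Z < n -> A n x = 0.

(* [w] accounts for a derivative of the first field; [e] is -1 for two fermions. *)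
HB.lock Definition nprod (C : numClosedFieldType) (w : int -> C)
    (A B : int -> @Fock C -> @Fock C) (e : C) (n : int) (x : @Fock C) : @Fock C :=
  \sum_(k \in [set: int])
    w k *: (if k < 0 then A k (B (n - k) x) else e *: B (n - k) (A k x)).

Section NormalProducts.
Context {C : numClosedFieldType}.
Local Notation Fock := (@Fock C).
Variables (w : int -> C) (A B : int -> Fock -> Fock) (e : C).
Hypotheses (linA : forall k, linear (A k)) (linB : forall k, linear (B k)).
Hypotheses (finA : locally_finite A) (finB : locally_finite B).
Implicit Types (x : Fock) (n k : int).

Let A0 k : A k 0 = 0.
Proof. exact: (linear_fun0 (linA k)). Qed.
Let B0 k : B k 0 = 0.
Proof. exact: (linear_fun0 (linB k)). Qed.
Let AD k x y : A k (x + y) = A k x + A k y.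
Proof. exact: (linear_funD (linA k)). Qed.
Let BD k x y : B k (x + y) = B k x + B k y.
Proof. exact: (linear_funD (linB k)). Qed.
Let AZ k a x : A k (a *: x) = a *: A k x.
Proof. exact: (linear_funZ (linA k)). Qed.
Let BZ k a x : B k (a *: x) = a *: B k x.
Proof. exact: (linear_funZ (linB k)). Qed.

Lemma nprod_finsuppd n x : finsuppd (fun k => w k *:
  (if k < 0 then A k (B (n - k) x) else e *: B (n - k) (A k x))).
Proof.
have [N hN] := finA x; have [M hM] := finB x.
apply: (@finsuppd_int _ _ (N + M + absz n)) => k hk; case: ifP => k0.
  by rewrite hM ?A0 ?scaler0 //; lia.
by rewrite hN ?B0 ?scaler0 //; lia.
Qed.

Lemma nprod_linear n : linear (nprod w A B e n).
Proof.
move=> a x y; rewrite nprod.unlock.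
have h := nprod_finsuppd n.
rewrite (sum_map _ _ (h x)) ?scaler0 //; last by move=> u v; rewrite scalerDr.
rewrite -sum_add //; last by apply: finsuppd_map; rewrite ?scaler0.
apply: eq_sumT => k; case: ifP => _.
  by rewrite linB linA; mcoeffs; ring.
by rewrite linA linB; mcoeffs; ring.
Qed.

(** Z passes A and B with signs sA and sB, and is contracted with a single mode of each, so the
    infinite sum leaves one term per factor. The conditions on e say that the contraction terms
    agree in the two orderings, so that the split at k = 0 is not seen. *)
Lemma nprod_comm (Z : Fock -> Fock) (sA sB a b : C) (kA kB : int) n x :
  linear Z -> (forall k x, A k (Z x) = sA *: Z (A k x) + ((k == kA)%:R * a) *: x) ->
  (forall k x, B k (Z x) = sB *: Z (B k x) + ((k == kB)%:R * b) *: x) ->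
  e * a = sB * a -> e * sA * b = b ->
  nprod w A B e n (Z x) = (sA * sB) *: Z (nprod w A B e n x) +
    (w kA * sB * a) *: B (n - kA) x + (w (n - kB) * b) *: A (n - kB) x.
Proof.
move=> linZ hA hB ea eb; rewrite nprod.unlock.
have Z0 : Z 0 = 0 by apply: (linear_fun0 linZ).
have ZD : {morph Z : x y / x + y} by apply: (linear_funD linZ).
have ZZ c u : Z (c *: u) = c *: Z u by apply: (linear_funZ linZ).
have h := nprod_finsuppd n x.
rewrite (sum_map _ _ h) //.
have hZ := finsuppd_map Z0 h.
rewrite (@sum_map _ _ _ _ (fun u => (sA * sB) *: u)) ?scaler0 //; last first.
  by move=> u v; rewrite scalerDr.
have {}hZ := @finsuppd_map _ _ _ _ (fun u => (sA * sB) *: u) (scaler0 _ _) hZ.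
pose gA k := ((k == kA)%:R * (w k * sB * a)) *: B (n - k) x.
pose gB k := ((n - k == kB)%:R * (w k * b)) *: A k x.
have -> : (w kA * sB * a) *: B (n - kA) x = \sum_(k \in [set: int]) gA k.
  rewrite (sum_single (a := kA)) /gA ?eqxx ?mul1r // => k /negbTE ->.
  by rewrite mul0r scale0r.
have -> : (w (n - kB) * b) *: A (n - kB) x = \sum_(k \in [set: int]) gB k.
  rewrite (sum_single (a := n - kB)) /gB ?subKr ?eqxx ?mul1r // => k hk.
  by rewrite (_ : (_ == _) = false) ?mul0r ?scale0r //; lia.
have fA : finsuppd gA.
  by exists [:: kA] => k; rewrite inE /gA => /negbTE ->; rewrite mul0r scale0r.
have fB : finsuppd gB.
  exists [:: n - kB] => k; rewrite inE /gB => hk.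
  by rewrite (_ : (_ == _) = false) ?mul0r ?scale0r //; lia.
rewrite -!sum_add //; last exact: finsuppd_add.
apply: eq_sumT => k; rewrite /gA /gB ZZ; case: ifP => _.
  rewrite hB AD !AZ hA; mcoeffs.
  by ring.
rewrite hA BD !BZ hB ZZ; mcoeffs.
rewrite -[in RHS]eb mulrA -[w k * sB * a]mulrA -ea.
by ring.
Qed.

End NormalProducts.

(** * The N = 1 super-Virasoro algebra on the Fock space *)

(** [tcl] is the coefficient in dbar = d - tcl c. The two values that follow are the pairings of c
    and d with the weight of v_(p,s); as <c, c> = 0, only the second depends on s. *)
Definition tcl (C : numClosedFieldType) (cL : C) : C := (cL - 3%:R) / 12%:R.
Definition czero (C : numClosedFieldType) (p : C) : C := - (p + 1).
Definition dzero (C : numClosedFieldType) (cL p s : C) : C :=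
  (p + 1) * tcl cL + 2%:R * s.

HB.lock Definition Gmode (C : numClosedFieldType) (cL p s : C) (n : int)
    (x : @Fock C) : @Fock C :=
  sqrtC 2%:R *: (
    2%:R^-1 *: nprod (fun=> 1) (bos (czero p) false) (@fmo C false) 1 n x
    + 2%:R^-1 *: nprod (fun=> 1) (bos (dzero cL p s) true) (@fmo C true) 1 n x
    + (tcl cL * (- n%:~R - 1)) *: fmo true n x + (n%:~R + 1) *: fmo false n x).

HB.lock Definition Lmode (C : numClosedFieldType) (cL p s : C) (n : int)
    (x : @Fock C) : @Fock C :=
  2%:R^-1 *: nprod (fun=> 1) (bos (czero p) false) (bos (dzero cL p s) true) 1 n x
  + (tcl cL / 2%:R * (- n%:~R - 1)) *: bos (czero p) false n x
  + ((n%:~R + 1) / 2%:R) *: bos (dzero cL p s) true n x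
  + 2%:R^-1 *: nprod (fun k => - k%:~R - 1) (@fmo C false) (@fmo C true) (-1) (n - 1) x
  + 2%:R^-1 *: nprod (fun k => - k%:~R - 1) (@fmo C true) (@fmo C false) (-1) (n - 1) x.

(** * Normally ordered products and their commutators with single modes *)

Section CurrentOperators.
Context {C : numClosedFieldType}.
Variables cL p s : C.
Local Notation Fock := (@Fock C).
Local Notation zc := (czero p).
Local Notation zd := (dzero cL p s).
Local Notation c := (@bos C zc false).
Local Notation d := (@bos C zd true).
Local Notation psi := (@fmo C).
Local Notation Gmode := (Gmode cL p s).
Local Notation Lmode := (Lmode cL p s).

Lemma osc_bos b n x : osc cL p b (s := s) n x = bos (if b then zd else zc) b n x.
Proof.
rewrite bos.unlock; case: n => [[|k]|k] //=; last first.
  by rewrite /cdform /cvec /dvec /= mul1r mul0r addr0 mulr1.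
congr (_ *: _); rewrite /cdform /cvec /dvec /weight /dbar /= /dzero /czero /tcl.
rewrite /cvec /dvec /=.
by case: b; rewrite /GRing.scale /=; field.
Qed.

Lemma fer_fmo b n (x : Fsp s) : fer b n x = fmo b n x.
Proof. by rewrite fmo.unlock. Qed.

Lemma Lop_Lmode n x : Lop cL p (s := s) n x = Lmode n x.
Proof.
rewrite /Lop Lmode.unlock !osc_bos.
have -> : \sum_(k \in [set: int]) nord_cd cL p (s := s) k (n - k) x =
  nprod (fun=> 1) c d 1 n x.
  by rewrite nprod.unlock; apply: eq_sumT => k; rewrite /nord_cd !osc_bos !scale1r.
have E b : \sum_(k \in [set: int])
    (- k - 1)%:~R *: nord_fer b (s := s) k (n - k - 1) x =
  nprod (fun k => - k%:~R - 1) (psi b) (psi (~~ b)) (-1) (n - 1) x.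
  rewrite nprod.unlock.
  apply: eq_sumT => k; rewrite /nord_fer !fer_fmo rmorphB rmorphN /=.
  by rewrite (_ : n - k - 1 = n - 1 - k) 1?scaleN1r //; lia.
rewrite [X in _ + _ *: X = _](E true) [X in _ + _ *: X + _ = _](E false) /tcl /=.
have -> : (- n - 1)%:~R = - n%:~R - 1 :> C by rewrite rmorphB rmorphN.
by mcoeffs; field.
Qed.

(** Bosonic modes commute with fermionic ones, so writing the products in [Gop] as normally ordered
    ones changes nothing and makes [nprod_comm] available for G. *)
Lemma Gop_Gmode n x : Gop cL p (s := s) n x = Gmode n x.
Proof.
rewrite /Gop Gmode.unlock !fer_fmo.
have E b : \sum_(k \in [set: int]) osc cL p b (s := s) k (fer b (s := s) (n - k) x) =
  nprod (fun=> 1) (@bos C (if b then zd else zc) b) (psi b) 1 n x.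
  rewrite nprod.unlock.
  apply: eq_sumT => k; rewrite osc_bos fer_fmo !scale1r.
  by rewrite bos_fmo if_same.
rewrite [X in _ *: X + _](E false) [X in _ + _ *: X + _ - _](E true) /tcl /=.
have -> : (- n - 1)%:~R = - n%:~R - 1 :> C by rewrite rmorphB rmorphN.
by congr (_ *: _); mcoeffs; field.
Qed.

Lemma bos_finite z b : locally_finite (@bos C z b).
Proof. by move=> x; have [N hN] := modes_finite x; exists N => n /hN[->]. Qed.

Lemma fmo_finite b : locally_finite (@fmo C b).
Proof. by move=> x; have [N hN] := modes_finite x; exists N => n /hN[_ ->]. Qed.

Hint Resolve bos_linear fmo_linear bos_finite fmo_finite : core.

Lemma Gmode_linear n : linear (Gmode n).
Proof.
move=> a x y; rewrite Gmode.unlock.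
have -> := @nprod_linear _ (fun=> 1) c (psi false) 1 _ _ _ _ n a x y => //.
have -> := @nprod_linear _ (fun=> 1) d (psi true) 1 _ _ _ _ n a x y => //.
by rewrite !fmo_linear; mcoeffs; ring.
Qed.
HB.instance Definition _ n :=
  GRing.isLinear.Build C Fock Fock *:%R (Gmode n) (Gmode_linear n).

Lemma Lmode_linear n : linear (Lmode n).
Proof.
move=> a x y; rewrite Lmode.unlock.
have -> := @nprod_linear _ (fun=> 1) c d 1 _ _ _ _ n a x y => //.
have E b : nprod (fun k => - k%:~R - 1) (psi b) (psi (~~ b)) (-1) (n - 1) (a *: x + y) =
  a *: nprod (fun k => - k%:~R - 1) (psi b) (psi (~~ b)) (-1) (n - 1) x +
  nprod (fun k => - k%:~R - 1) (psi b) (psi (~~ b)) (-1) (n - 1) y.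
  by apply: nprod_linear.
by rewrite (E false) (E true) !bos_linear /=; mcoeffs; ring.
Qed.
HB.instance Definition _ n :=
  GRing.isLinear.Build C Fock Fock *:%R (Lmode n) (Lmode_linear n).

Lemma bosZ z b n a x : @bos C z b n (a *: x) = a *: bos z b n x.
Proof. exact: linearZ. Qed.
Lemma fmoZ b n a x : psi b n (a *: x) = a *: psi b n x.
Proof. exact: linearZ. Qed.

(** This and the next lemmas put the canonical relations in the shape of the hypotheses of
    [nprod_comm]: a sign, and a contraction supported at one mode. *)
Lemma bos_bos z z' b b' k l x : @bos C z b k (bos z' b' l x) =
  1 *: bos z' b' l (bos z b k x) +
  ((k == - l)%:R * ((b != b')%:R * (- l%:~R * 2%:R))) *: x.
Proof.
rewrite bosC [1 *: _]scale1r; congr (_ + _ *: _); rewrite -mulnb natrM.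
have -> : (k == - l) = (k + l == 0) by lia.
case: (k + l =P 0) => [h|_]; last by rewrite mulr0 !mul0r.
have -> : k = - l by lia.
by rewrite rmorphN /=; ring.
Qed.

Lemma bos_bos_same z z' b k l x : @bos C z b k (bos z' b l x) =
  1 *: bos z' b l (bos z b k x) + ((k == 0)%:R * 0) *: x.
Proof. by rewrite bos_bos eqxx mul0r !mulr0. Qed.

Lemma bos_bos_diff z z' b b' k l x : b != b' -> @bos C z b k (bos z' b' l x) =
  1 *: bos z' b' l (bos z b k x) + ((k == - l)%:R * (- l%:~R * 2%:R)) *: x.
Proof. by move=> h; rewrite bos_bos h mul1r. Qed.

Lemma bos_fmo0 z b b' k l x : @bos C z b k (psi b' l x) =
  1 *: psi b' l (bos z b k x) + ((k == 0)%:R * 0) *: x.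
Proof. by rewrite bos_fmo scale1r mulr0 scale0r addr0. Qed.

Lemma fmo_bos0 z b b' k l x : psi b' k (@bos C z b l x) =
  1 *: bos z b l (psi b' k x) + ((k == 0)%:R * 0) *: x.
Proof. by rewrite bos_fmo scale1r mulr0 scale0r addr0. Qed.

Lemma fmo_fmo b b' k l x : psi b k (psi b' l x) =
  -1 *: psi b' l (psi b k x) + ((k == - l - 1)%:R * (b != b')%:R) *: x.
Proof.
have -> : (k == - l - 1) = (k + l + 1 == 0) by lia.
by rewrite fmoC [-1 *: _]scaleN1r mulrC -natrM mulnb.
Qed.

Lemma fmo_fmo_same b k l x : psi b k (psi b l x) =
  -1 *: psi b l (psi b k x) + ((k == 0)%:R * 0) *: x.
Proof. by rewrite fmo_fmo eqxx !mulr0. Qed.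

Lemma fmo_fmo_diff b b' k l x : b != b' -> psi b k (psi b' l x) =
  -1 *: psi b' l (psi b k x) + ((k == - l - 1)%:R * 1) *: x.
Proof. by move=> h; rewrite fmo_fmo h. Qed.

Local Notation CD := (nprod (fun=> 1) c d 1).
Local Notation CP := (nprod (fun=> 1) c (psi false) 1).
Local Notation DM := (nprod (fun=> 1) d (psi true) 1).
Local Notation FF b := (nprod (fun k => - k%:~R - 1) (psi b) (psi (~~ b)) (-1)).

Ltac nprod_commute lin hA hB :=
  rewrite (nprod_comm _ _ _ _ _ _ _ lin hA hB); rewrite ?opprK //; try ring.

Lemma CD_c n l x : CD n (c l x) = c l (CD n x) + (- l%:~R * 2%:R) *: c (n + l) x.
Proof.
nprod_commute (@bos_linear C zc false l)
  (fun k x => @bos_bos_same zc zc false k l x)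
  (fun k x => @bos_bos_diff zd zc true false k l x isT).
by mcoeffs; ring.
Qed.

Lemma CD_d n l x : CD n (d l x) = d l (CD n x) + (- l%:~R * 2%:R) *: d (n + l) x.
Proof.
nprod_commute (@bos_linear C zd true l)
  (fun k x => @bos_bos_diff zc zd false true k l x isT)
  (fun k x => @bos_bos_same zd zd true k l x).
by mcoeffs; ring.
Qed.

Lemma CD_psi b n l x : CD n (psi b l x) = psi b l (CD n x).
Proof.
nprod_commute (@fmo_linear C b l)
  (fun k x => @bos_fmo0 zc false b k l x) (fun k x => @bos_fmo0 zd true b k l x).
by mcoeffs; ring.
Qed.

Lemma FF_bos z b b' n l x : FF b n (@bos C z b' l x) = bos z b' l (FF b n x).
Proof.
nprod_commute (@bos_linear C z b' l)
  (fun k x => @fmo_bos0 z b' b k l x) (fun k x => @fmo_bos0 z b' (~~ b) k l x).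
by mcoeffs; ring.
Qed.

(** The contraction removes the undifferentiated factor, so the weight is the one of the remaining
    mode n + l + 1. In [FF_diff] it removes the differentiated factor, whose weight only involves
    l. *)
Lemma FF_same b n l x : FF b n (psi b l x) = psi b l (FF b n x) -
  (l%:~R + n%:~R + 2%:R) *: psi b (n + l + 1) x.
Proof.
have h : ~~ b != b by case: b.
nprod_commute (@fmo_linear C b l)
  (fun k x => @fmo_fmo_same b k l x) (fun k x => @fmo_fmo_diff (~~ b) b k l x h).
have -> : n - (- l - 1) = n + l + 1 by lia.
by rewrite !rmorphD /=; mcoeffs; ring.
Qed.

Lemma FF_diff b n l x : FF b n (psi (~~ b) l x) = psi (~~ b) l (FF b n x) -
  l%:~R *: psi (~~ b) (n + l + 1) x.
Proof.
have h : b != ~~ b by case: b.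
nprod_commute (@fmo_linear C (~~ b) l)
  (fun k x => @fmo_fmo_diff b (~~ b) k l x h) (fun k x => @fmo_fmo_same (~~ b) k l x).
have -> : n - (- l - 1) = n + l + 1 by lia.
by rewrite !(rmorphB, rmorphN) /=; mcoeffs; ring.
Qed.

Lemma CP_c n l x : CP n (c l x) = c l (CP n x).
Proof.
nprod_commute (@bos_linear C zc false l)
  (fun k x => @bos_bos_same zc zc false k l x)
  (fun k x => @fmo_bos0 zc false false k l x).
by mcoeffs; ring.
Qed.

Lemma CP_d n l x : CP n (d l x) = d l (CP n x) +
  (- l%:~R * 2%:R) *: psi false (n + l) x.
Proof.
nprod_commute (@bos_linear C zd true l)
  (fun k x => @bos_bos_diff zc zd false true k l x isT)
  (fun k x => @fmo_bos0 zd true false k l x).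
by mcoeffs; ring.
Qed.

Lemma CP_false n l x : CP n (psi false l x) = - psi false l (CP n x).
Proof.
nprod_commute (@fmo_linear C false l)
  (fun k x => @bos_fmo0 zc false false k l x)
  (fun k x => @fmo_fmo_same false k l x).
by mcoeffs; ring.
Qed.

Lemma CP_true n l x : CP n (psi true l x) = - psi true l (CP n x) + c (n + l + 1) x.
Proof.
nprod_commute (@fmo_linear C true l)
  (fun k x => @bos_fmo0 zc false true k l x)
  (fun k x => @fmo_fmo_diff false true k l x isT).
have -> : n - (- l - 1) = n + l + 1 by lia.
by mcoeffs; ring.
Qed.

Lemma DM_c n l x : DM n (c l x) = c l (DM n x) +
  (- l%:~R * 2%:R) *: psi true (n + l) x.
Proof.
nprod_commute (@bos_linear C zc false l)
  (fun k x => @bos_bos_diff zd zc true false k l x isT)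
  (fun k x => @fmo_bos0 zc false true k l x).
by mcoeffs; ring.
Qed.

Lemma DM_d n l x : DM n (d l x) = d l (DM n x).
Proof.
nprod_commute (@bos_linear C zd true l)
  (fun k x => @bos_bos_same zd zd true k l x)
  (fun k x => @fmo_bos0 zd true true k l x).
by mcoeffs; ring.
Qed.

Lemma DM_true n l x : DM n (psi true l x) = - psi true l (DM n x).
Proof.
nprod_commute (@fmo_linear C true l)
  (fun k x => @bos_fmo0 zd true true k l x)
  (fun k x => @fmo_fmo_same true k l x).
by mcoeffs; ring.
Qed.

Lemma DM_false n l x : DM n (psi false l x) = - psi false l (DM n x) + d (n + l + 1) x.
Proof.
nprod_commute (@fmo_linear C false l)
  (fun k x => @bos_fmo0 zd true false k l x)
  (fun k x => @fmo_fmo_diff true false k l x isT).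
have -> : n - (- l - 1) = n + l + 1 by lia.
by mcoeffs; ring.
Qed.

End CurrentOperators.

(** * Commutators of L and G with the modes *)

Section CurrentRelations.
Context {C : numClosedFieldType}.
Variables cL p s : C.
Local Notation Fock := (@Fock C).
Local Notation t := (tcl cL).
Local Notation c := (@bos C (czero p) false).
Local Notation d := (@bos C (dzero cL p s) true).
Local Notation psi := (@fmo C).
Local Notation L := (Lmode cL p s).
Local Notation G := (Gmode cL p s).
Local Notation sq2 := (sqrtC 2%:R : C).
Implicit Types (x y : Fock) (m n k l : int).

Lemma bosD z b n x y : @bos C z b n (x + y) = bos z b n x + bos z b n y.
Proof. exact: linearD. Qed.
Lemma fmoD b n x y : psi b n (x + y) = psi b n x + psi b n y.
Proof. exact: linearD. Qed.
Lemma bosC_same z z' b m n x : @bos C z b m (bos z' b n x) = bos z' b n (bos z b m x).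
Proof. by rewrite bosC eqxx mul0r scale0r addr0. Qed.

(** The scalar term comes from the summand - d(-2) / 2 of omega, through [d(m), c(k)]. In [Lmode_d]
    it comes from the c(-2) summand. *)
Lemma Lmode_c m k x : L m (c k x) = c k (L m x) - k%:~R *: c (m + k) x
  + ((m + k == 0)%:R * (m%:~R ^+ 2 + m%:~R)) *: x.
Proof.
rewrite Lmode.unlock CD_c (FF_bos _ false) (FF_bos _ true) (bosC_same _ _ _ m k).
rewrite (bosC _ _ _ _ m k) /= !(bosD, bosZ).
by mcoeffs; field.
Qed.

Lemma Lmode_d m k x : L m (d k x) = d k (L m x) - k%:~R *: d (m + k) x
  - ((m + k == 0)%:R * (t * (m%:~R ^+ 2 + m%:~R))) *: x.
Proof.
rewrite Lmode.unlock CD_d (FF_bos _ false) (FF_bos _ true) (bosC_same _ _ _ m k).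
rewrite (bosC _ _ _ _ m k) /= !(bosD, bosZ).
by mcoeffs; field.
Qed.

Lemma Lmode_psi b m k x : L m (psi b k x) = psi b k (L m x) -
  (k%:~R + (m%:~R + 1) / 2%:R) *: psi b (m + k) x.
Proof.
rewrite Lmode.unlock CD_psi !bos_fmo !(fmoD, fmoZ).
have -> : m + k = m - 1 + k + 1 by lia.
have m1 : (m - 1)%:~R = m%:~R - 1 :> C by rewrite rmorphB.
case: b.
  rewrite (FF_diff false) (FF_same true) m1 /=.
  by mcoeffs; field.
rewrite (FF_diff true) (FF_same false) m1 /=.
by mcoeffs; field.
Qed.

Lemma Gmode_c n k x : G n (c k x) = c k (G n x) - (sq2 * k%:~R) *: psi true (n + k) x.
Proof.
rewrite Gmode.unlock CP_c DM_c -!bos_fmo !(bosD, bosZ).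
by mcoeffs; field.
Qed.

Lemma Gmode_d n k x : G n (d k x) = d k (G n x) - (sq2 * k%:~R) *: psi false (n + k) x.
Proof.
rewrite Gmode.unlock CP_d DM_d -!bos_fmo !(bosD, bosZ).
by mcoeffs; field.
Qed.

Lemma Gmode_psip n k x : G n (psi false k x) = - psi false k (G n x) +
  sq2 *: (2%:R^-1 *: d (n + k + 1) x -
     ((n + k + 1 == 0)%:R * (t * (n%:~R + 1))) *: x).
Proof.
rewrite Gmode.unlock CP_false DM_false (fmoC true) (fmoC false false) /= !(fmoD, fmoZ).
by mcoeffs; field.
Qed.

Lemma Gmode_psim n k x : G n (psi true k x) = - psi true k (G n x) +
  sq2 *: (2%:R^-1 *: c (n + k + 1) x +
     ((n + k + 1 == 0)%:R * (n%:~R + 1)) *: x).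
Proof.
rewrite Gmode.unlock CP_true DM_true (fmoC true true) (fmoC false) /= !(fmoD, fmoZ).
by mcoeffs; field.
Qed.

End CurrentRelations.

(** * Parity, Schur's lemma and the action on the vacuum *)

Section VacuumAndSchur.
Context {C : numClosedFieldType}.
Variables cL p s : C.
Local Notation Fock := (@Fock C).
Local Notation vac := (ket C vac0).
Local Notation t := (tcl cL).
Local Notation zc := (czero p).
Local Notation zd := (dzero cL p s).
Local Notation c := (@bos C zc false).
Local Notation d := (@bos C zd true).
Local Notation psi := (@fmo C).
Local Notation L := (Lmode cL p s).
Local Notation G := (Gmode cL p s).
Local Notation CD := (nprod (fun=> 1) c d 1).
Local Notation FF b b' := (nprod (fun k => - k%:~R - 1) (psi b) (psi b') (-1)).
Implicit Types (x y : Fock) (m n k l : int).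

Hint Resolve bos_linear fmo_linear bos_finite fmo_finite : core.

Lemma bos_nz z z' b n x : n != 0 -> @bos C z b n x = bos z' b n x.
Proof. by rewrite bos.unlock; case: n => [[|n]|n]. Qed.

Section Parity.

(** Fermion parity (-1)^F. An operator anticommuting with it has zero vacuum expectation value,
    which is what Schur's lemma asks of the odd operator [L, G]. *)
Definition parity : Fock -> Fock :=
  flin (fun u : state => (-1) ^+ #|` u.2| *: ket C u).
Lemma parity_linear : linear parity.
Proof. exact: flin_linear. Qed.
HB.instance Definition _ := GRing.isLinear.Build C Fock Fock *:%R
  parity parity_linear.

Lemma parityU u : parity (ket C u) = (-1) ^+ #|` u.2| *: ket C u.
Proof. exact: flinU. Qed.

Lemma parity_bos z b n x : bos z b n (parity x) = parity (bos z b n x).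
Proof.
elim/(@state_ind C): x => [a x y hx hy|u]; first by rewrite !linearP /= hx hy.
rewrite parityU bos.unlock; case: n => [[|n]|n].
- by rewrite [RHS]linearZ /= parityU.
- by rewrite bannihZ bannihE [RHS]linearZ /= [in RHS]linearZ /= parityU !scalerA;
    congr (_ *: _); ring.
by rewrite bcreateZ bcreateE parityU.
Qed.

Lemma parity_fmo b n x : psi b n (parity x) = - parity (psi b n x).
Proof.
elim/(@state_ind C): x => [a x y hx hy|u]; first by rewrite !linearP /= hx hy.
rewrite parityU fmo.unlock; case: n => n /=.
  rewrite fannihZ fannihE; case: ifP => h; last by rewrite !(linear0, oppr0, scaler0).
  rewrite [in RHS]linearZ /= parityU /= !scalerA -scaleNr; congr (_ *: _).
  by rewrite (cardfsD1 (~~ b, n)) h exprS; ring.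
rewrite fcreateZ fcreateE; case: ifP => h; first by rewrite !(linear0, oppr0, scaler0).
rewrite [in RHS]linearZ /= parityU /= !scalerA -scaleNr; congr (_ *: _).
by rewrite cardfsU1 h exprS; ring.
Qed.

Lemma parity_vac : parity vac = vac.
Proof. by rewrite parityU (cardfs0 _ : #|` vac0.2| = 0%N) scale1r. Qed.

Lemma vev_parity x : (parity x)@_vac0 = x@_vac0.
Proof.
elim/(@state_ind C): x => [a x y hx hy|u].
  by rewrite linearP /= !mcoeffD !mcoeffZ hx hy.
rewrite parityU mcoeffZ !mcoeff_state; case: eqP => [->|]; last by rewrite mulr0.
by rewrite (cardfs0 _ : #|` vac0.2| = 0%N) expr0 mul1r.
Qed.

Lemma nprod_parity w A B e n x (sA sB : C) :
  (forall k, linear (A k)) -> (forall k, linear (B k)) ->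
  locally_finite A -> locally_finite B ->
  (forall k x, A k (parity x) = sA *: parity (A k x)) ->
  (forall k x, B k (parity x) = sB *: parity (B k x)) ->
  nprod w A B e n (parity x) = (sA * sB) *: parity (nprod w A B e n x).
Proof.
move=> lA lB fA fB hA hB.
have h0 (u : Fock) k : 0 = ((k == 0)%:R * 0) *: u by rewrite mulr0 scale0r.
have {}hA k y : A k (parity y) = sA *: parity (A k y) + ((k == 0)%:R * 0) *: y.
  by rewrite -h0 addr0.
have {}hB k y : B k (parity y) = sB *: parity (B k y) + ((k == 0)%:R * 0) *: y.
  by rewrite -h0 addr0.
rewrite (nprod_comm w lA lB fA fB n x parity_linear hA hB); [|ring..].
by mcoeffs; ring.
Qed.

Lemma parity_bos1 z b k x : bos z b k (parity x) = 1 *: parity (bos z b k x).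
Proof. by rewrite parity_bos scale1r. Qed.
Lemma parity_fmo1 b k x : psi b k (parity x) = -1 *: parity (psi b k x).
Proof. by rewrite parity_fmo scaleN1r. Qed.

Lemma parityD x y : parity (x + y) = parity x + parity y.
Proof. exact: linearD. Qed.
Lemma parityZ a x : parity (a *: x) = a *: parity x.
Proof. exact: linearZ. Qed.

Lemma parity_L n x : L n (parity x) = parity (L n x).
Proof.
rewrite Lmode.unlock !parity_bos.
rewrite (@nprod_parity _ c d 1 n x 1 1) //; try exact: parity_bos1.
rewrite (@nprod_parity _ (psi false) (psi true) (-1) _ x (-1) (-1)) //;
  try exact: parity_fmo1.
rewrite (@nprod_parity _ (psi true) (psi false) (-1) _ x (-1) (-1)) //;
  try exact: parity_fmo1.
by rewrite !(parityD, parityZ); mcoeffs; ring.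
Qed.

Lemma parity_G n x : G n (parity x) = - parity (G n x).
Proof.
rewrite Gmode.unlock !parity_fmo.
rewrite (@nprod_parity _ c (psi false) 1 n x 1 (-1)) //;
  try exact: parity_bos1; try exact: parity_fmo1.
rewrite (@nprod_parity _ d (psi true) 1 n x 1 (-1)) //;
  try exact: parity_bos1; try exact: parity_fmo1.
by rewrite !(parityD, parityZ); mcoeffs; ring.
Qed.

End Parity.

Section Schur.
Variables (z : bool -> C) (X : Fock -> Fock) (e : C).
Hypothesis linX : linear X.
Hypothesis Xbos : forall b n x, X (bos (z b) b n x) = bos (z b) b n (X x).
Hypothesis e0 : e != 0.
Hypothesis Xfmo : forall b n x, X (psi b n x) = e *: psi b n (X x).

Let X0 : X 0 = 0.
Proof. exact: (linear_fun0 linX). Qed.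

Lemma schur_vac : X vac = (X vac)@_vac0 *: vac.
Proof.
apply: modes_vac => b n hn.
  by rewrite (@bos_nz _ (z b)) ?gt_eqF // -Xbos bos_vac // X0.
by apply: (scalerI e0); rewrite scaler0 -Xfmo fmo_vac // X0.
Qed.

(** X can be moved past the annihilation modes, so X v is a multiple of v; once that multiple is 0,
    the creation modes propagate it to all vectors. The factor e is -1 for an odd X. *)
Lemma schur_zero : (X vac)@_vac0 = 0 -> forall x, X x = 0.
Proof.
move=> h; apply: (modes_ind (z := z)).
- by move=> a x y hx hy; rewrite linX hx hy scaler0 addr0.
- by rewrite schur_vac h scale0r.
- by move=> b n x _ hx; rewrite Xbos hx linear0.
- by move=> b n x _ hx; rewrite Xfmo hx linear0 scaler0.
Qed.

End Schur.

Lemma nprod_vac w A B e n : (forall k, k < 0 -> A k (B (n - k) vac) = 0) ->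
  (forall k, 0 <= k -> B (n - k) (A k vac) = 0) -> nprod w A B e n vac = 0.
Proof.
move=> h1 h2; rewrite nprod.unlock; apply: fsbig1 => k _.
by case: ltP => hk; rewrite ?h1 ?h2 ?scaler0.
Qed.

Lemma bos_fmo_vac z b b' k n : 0 <= n -> psi b' (n - k) (bos z b k vac) = 0 :> Fock.
Proof.
move=> hn; case: (ltP 0 k) => hk; first by rewrite bos_vac ?linear0.
by rewrite -bos_fmo fmo_vac ?linear0 //; lia.
Qed.

Lemma G_vac n : 0 <= n -> G n vac = 0.
Proof.
move=> hn; rewrite Gmode.unlock !fmo_vac // !nprod_vac ?scaler0 ?addr0 ?scaler0 //=;
  by move=> k hk; rewrite ?bos_fmo ?bos_fmo_vac.
Qed.

Lemma FF_vac b b' n : -1 <= n -> FF b b' n vac = 0.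
Proof.
move=> hn; apply: nprod_vac => k hk; last by rewrite (fmo_vac b) ?linear0.
by rewrite fmo_vac ?linear0 //; lia.
Qed.

Lemma L_vac n : 0 < n -> L n vac = 0.
Proof.
move=> hn; have FF0 : -1 <= n - 1 by lia.
have CD0 : CD n vac = 0.
  apply: nprod_vac => k; first by move=> hk; rewrite bos_vac ?linear0 //; lia.
  rewrite le_eqVlt => /predU1P[<-|hk]; last by rewrite (bos_vac _ false) ?linear0.
  by rewrite bos0 linearZ /= bos_vac ?scaler0 //; lia.
by rewrite Lmode.unlock !bos_vac // !FF_vac // CD0 !scaler0 !addr0.
Qed.

Definition hwt : C := (zc * zd - t * zc + zd) / 2%:R.

Lemma L0_vac : L 0 vac = hwt *: vac.
Proof.
rewrite Lmode.unlock !FF_vac // nprod.unlock (sum_single (a := 0)); last first.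
  move=> k k0; rewrite scale1r sub0r; case: ltP => hk.
    by rewrite bos_vac ?linear0 //; lia.
  by rewrite scale1r (bos_vac _ false) ?linear0 //; lia.
rewrite ltxx !scale1r subrr !bos0 /hwt; mcoeffs.
by field.
Qed.

Lemma hwtE : hwt = hpr cL p s.
Proof. by rewrite /hwt /hpr /czero /dzero /tcl; field. Qed.

End VacuumAndSchur.

Lemma sq2E (C : numClosedFieldType) : sqrtC 2%:R * sqrtC 2%:R = 2%:R :> C.
Proof. by rewrite -expr2 sqrtCK. Qed.

(* If P is even and quadratic, then P q is P 0 + q^2 (P 1 - P 0). *)
Lemma sq2_root (C : numClosedFieldType) (P : C -> C) :
  (forall q, P q = (q * q - 2%:R) * (P 1 - P 0)) -> P (sqrtC 2%:R) = 0.
Proof. by move=> ->; rewrite sq2E subrr mul0r. Qed.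

Ltac sq2_field := apply/eqP; rewrite -subr_eq0; apply/eqP;
  match goal with C : numClosedFieldType |- ?e = 0 =>
    let f := eval pattern (sqrtC (2%:R : C)) in e in
    match f with ?P _ => apply: (@sq2_root C P) => ? /=; field end
  end.

(** * The brackets of L and G among themselves *)

Section SuperVirasoro.
Context {C : numClosedFieldType}.
Variables cL p s : C.
Local Notation Fock := (@Fock C).
Local Notation vac := (ket C vac0).
Local Notation t := (tcl cL).
Local Notation zc := (czero p).
Local Notation zd := (dzero cL p s).
Local Notation c := (@bos C zc false).
Local Notation d := (@bos C zd true).
Local Notation psi := (@fmo C).
Local Notation L := (Lmode cL p s).
Local Notation G := (Gmode cL p s).
Local Notation sq2 := (sqrtC 2%:R : C).
Local Notation CP := (nprod (fun=> 1) c (psi false) 1).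
Local Notation DM := (nprod (fun=> 1) d (psi true) 1).
Implicit Types (x y : Fock) (m n k l : int).

Hint Resolve bos_linear fmo_linear bos_finite fmo_finite : core.

Lemma LmodeD n x y : L n (x + y) = L n x + L n y.
Proof. exact: linearD. Qed.
Lemma LmodeN n x : L n (- x) = - L n x.
Proof. exact: linearN. Qed.
Lemma LmodeZ n a x : L n (a *: x) = a *: L n x.
Proof. exact: linearZ. Qed.
Lemma GmodeD n x y : G n (x + y) = G n x + G n y.
Proof. exact: linearD. Qed.
Lemma GmodeN n x : G n (- x) = - G n x.
Proof. exact: linearN. Qed.
Lemma GmodeZ n a x : G n (a *: x) = a *: G n x.
Proof. exact: linearZ. Qed.
Lemma bosN z b n x : @bos C z b n (- x) = - bos z b n x.
Proof. exact: linearN. Qed.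
Lemma fmoN b n x : psi b n (- x) = - psi b n x.
Proof. exact: linearN. Qed.

Lemma parityN x : parity (- x) = - parity x.
Proof. exact: linearN. Qed.

Definition modeE := (LmodeD, LmodeN, LmodeZ, GmodeD, GmodeN, GmodeZ,
  @bosD C, bosN, @bosZ C, @fmoD C, fmoN, @fmoZ C).

Let zeros b := if b then zd else zc.

Lemma L_G_comm m n x :
  L m (G n x) = G n (L m x) + (m%:~R / 2%:R - n%:~R - 1 / 2%:R) *: G (m + n) x.
Proof.
pose X x := L m (G n x) - G n (L m x) -
  (m%:~R / 2%:R - n%:~R - 1 / 2%:R) *: G (m + n) x.
suff h : X x = 0 by rewrite -[LHS]subr0 -h /X; mcoeffs; ring.
apply: (@schur_zero _ zeros _ (-1)); rewrite ?oppr_eq0 ?oner_eq0 //.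
- by move=> a u v; rewrite /X !modeE; mcoeffs; ring.
- move=> b k u.
  have e1 : n + (m + k) = m + (n + k) by lia.
  have e2 : m + n + k = m + (n + k) by lia.
  rewrite /zeros /X; case: b.
    rewrite !(Lmode_d, Gmode_d, modeE, Lmode_psi) e1 e2.
    by mcoeffs; rewrite !rmorphD /=; field.
  rewrite !(Lmode_c, Gmode_c, modeE, Lmode_psi) e1 e2.
  by mcoeffs; rewrite !rmorphD /=; field.
- move=> b k u.
  have e1 : n + (m + k) + 1 = m + n + k + 1 by lia.
  have e2 : m + (n + k + 1) = m + n + k + 1 by lia.
  have hk : m + n + k + 1 = 0 -> k%:~R = - (m%:~R + n%:~R + 1) :> C.
    by move=> h; rewrite (_ : k = - (m + n + 1)) ?(rmorphN, rmorphD) //; lia.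
  rewrite /X; case: b.
    rewrite !(Lmode_psi, Gmode_psim, modeE, Lmode_c) e1 e2.
    by mcoeffs; rewrite !rmorphD /=; case: (m + n + k + 1 =P 0) => [/hk ->|_] /=; field.
  rewrite !(Lmode_psi, Gmode_psip, modeE, Lmode_d) e1 e2.
  by mcoeffs; rewrite !rmorphD /=; case: (m + n + k + 1 =P 0) => [/hk ->|_] /=; field.
(* X changes parity, so its vacuum expectation value equals its own negative. *)
have v0 (Y : Fock -> Fock) : (forall u, Y (parity u) = - parity (Y u)) ->
    (Y vac)@_vac0 = 0.
  move=> hY; have : (Y vac)@_vac0 = - (Y vac)@_vac0.
    by rewrite -{1}parity_vac hY mcoeffN vev_parity.
  by move=> /eqP; rewrite -subr_eq0 opprK -mulr2n mulrn_eq0 /= => /eqP.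
apply: v0 => u; rewrite /X !(parity_L, parity_G) LmodeN parity_L.
by rewrite !(parityD, parityN, parityZ); mcoeffs; ring.
Qed.

(** When G(N + 1/2) meets a product h(k) Psi(n - k + 1/2) v with N + n + 1 = 0, the boson h(k)
    contributes - k exactly for - N <= k < 0. The sum of these numbers is the source of m^2 + m in
    the central term of {G, G}. *)
Definition range_term (N : nat) (k : int) : C :=
  if (- N.+1%:Z < k) && (k < 0) then - k%:~R else 0.

Lemma sum_range_term (N : nat) :
  \sum_(k \in [set: int]) range_term N k = N%:R * N.+1%:R / 2%:R.
Proof.
elim: N => [|N IH].
  by rewrite mul0r mul0r; apply: fsbig1 => k _; rewrite /range_term; case: ifP => // h; lia.
pose f k : C := if k == - N.+1%:Z then N.+1%:R else 0.
have E k : range_term N.+1 k = range_term N k + f k.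
  rewrite /f /range_term; case: (k =P - N.+1%:Z) => [->|h].
    have -> : (- N.+2%:Z < - N.+1%:Z) && (- N.+1%:Z < 0) by lia.
    by rewrite ltxx add0r rmorphN opprK.
  have -> : (- N.+2%:Z < k) = (- N.+1%:Z < k) by lia.
  by rewrite addr0.
rewrite (eq_sumT E) sum_add; last 2 first.
- apply: (@finsuppd_int _ _ N.+1) => k hk; rewrite /range_term.
  by case: ifP => // h; lia.
- by exists [:: - N.+1%:Z] => k; rewrite inE /f => /negbTE ->.
rewrite IH (sum_single (a := - N.+1%:Z)) /f ?eqxx => [|k /negbTE -> //].
by rewrite -[N.+2%:R]natr1 -[N.+1%:R]natr1; field.
Qed.

Lemma mcoeff_sum (T : choiceType) (f : T -> Fock) u : finsuppd f ->
  (\sum_(k \in [set: T]) f k)@_u = \sum_(k \in [set: T]) (f k)@_u.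
Proof.
by move=> hf; apply: (@sum_map _ _ _ f (fun x => x@_u)) => //;
  [exact: mcoeff0 | move=> x y; exact: mcoeffD].
Qed.

Lemma nprod_vev w A B e n x : (forall k x, k < 0 -> (A k x)@_vac0 = 0) ->
  (forall k, linear (A k)) -> (forall k, linear (B k)) ->
  locally_finite A -> locally_finite B ->
  (forall k, 0 <= k -> (B (n - k) (A k x))@_vac0 = 0) ->
  (nprod w A B e n x)@_vac0 = 0.
Proof.
move=> hA lA lB fA fB hB; rewrite nprod.unlock (mcoeff_sum _ (nprod_finsuppd w e lA lB fA fB n x)).
apply: fsbig1 => k _; rewrite mcoeffZ; case: ltP => hk; first by rewrite hA ?mulr0.
by rewrite mcoeffZ hB ?mulr0.
Qed.

Lemma G_vev n x : n < 0 -> (G n x)@_vac0 = 0.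
Proof.
move=> hn; rewrite Gmode.unlock !(mcoeffZ, mcoeffD) !vac_fmo // !nprod_vev //; try ring.
- by move=> k u; apply: vac_bos.
- by move=> k hk; apply: vac_fmo; lia.
- by move=> k u; apply: vac_bos.
- by move=> k hk; apply: vac_fmo; lia.
Qed.

Lemma L_vev n x : n < 0 -> (L n x)@_vac0 = 0.
Proof.
move=> hn; rewrite Lmode.unlock !(mcoeffZ, mcoeffD) !vac_bos // !nprod_vev //; try ring.
all: move=> k hk; first [exact: vac_bos | exact: vac_fmo
  | apply: vac_bos; lia | apply: vac_fmo; lia].
Qed.

Lemma vev_vac : vac@_vac0 = 1.
Proof. by rewrite mcoeff_state eqxx. Qed.

Lemma fmo2_vev b b' k l : b != b' -> l < 0 ->
  (psi b k (psi b' l vac))@_vac0 = (k + l + 1 == 0)%:R.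
Proof.
move=> hb hl; rewrite fmoC hb /=; case: (ltP k 0) => hk.
  rewrite mcoeffD mcoeffN vac_fmo // oppr0 add0r mcoeffZ mcoeff_state eqxx.
  by rewrite mulr1.
by rewrite (fmo_vac _ hk) linear0 oppr0 add0r mcoeffZ mcoeff_state eqxx mulr1.
Qed.

Lemma bos_vev z b k : (bos z b k vac)@_vac0 = (k == 0)%:R * z :> C.
Proof.
have [->|k0] := eqVneq k 0; first by rewrite bos0 mcoeffZ mcoeff_state eqxx mulr1 mul1r.
rewrite mul0r; have [hk|hk] := ltP k 0; first exact: vac_bos.
by rewrite bos_vac ?mcoeff0 // lt_neqAle eq_sym k0.
Qed.

Definition fmo_vev b m : C :=
  if b then 2%:R^-1 * zc + (m%:~R + 1) else 2%:R^-1 * zd - t * (m%:~R + 1).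

Lemma G_fmo_vev b m n : n < 0 ->
  (G m (psi b n vac))@_vac0 = (m + n + 1 == 0)%:R * (sq2 * fmo_vev b m).
Proof.
move=> hn; rewrite /fmo_vev; case: b; rewrite ?Gmode_psim ?Gmode_psip;
  rewrite !(mcoeffD, mcoeffN, mcoeffZ) bos_vev vev_vac vac_fmo //; ring.
Qed.

Lemma Gmode_bos b n k x : G n (bos (zeros b) b k x) =
  bos (zeros b) b k (G n x) - (sq2 * k%:~R) *: psi (~~ b) (n + k) x.
Proof. by case: b; rewrite /zeros ?Gmode_d ?Gmode_c. Qed.

Lemma G_nprod_vev b (N : nat) n : n < 0 ->
  (G N (nprod (fun=> 1) (bos (zeros b) b) (psi b) 1 n vac))@_vac0 =
  (N%:Z + n + 1 == 0)%:R *
    (sq2 * (N%:R * N.+1%:R / 2%:R + zeros b * fmo_vev b N)).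
Proof.
move=> hn; rewrite nprod.unlock.
have fin := @nprod_finsuppd _ (fun=> 1) (bos (zeros b) b) (psi b) 1
  _ _ _ _ n vac.
rewrite (sum_map (D := G N) (linear0 _) (GmodeD N)); last exact: fin.
rewrite mcoeff_sum; last by apply: finsuppd_map; [exact: linear0 | exact: fin].
pose D := (N%:Z + n + 1 == 0)%:R * sq2.
(* f is the contribution of the modes k < 0, through [G, h(k)], and g that of the zero mode; for k >
   0 the boson kills the vacuum. *)
pose f k := D * range_term N k.
pose g k : C := if k == 0 then D * (zeros b * fmo_vev b N) else 0.
rewrite (eq_sumT (g := fun k => f k + g k)); last first.
  move=> k; rewrite scale1r /f /g /range_term; case: ltP => hk /=.
    rewrite lt_eqF // addr0 andbT Gmode_bos mcoeffD mcoeffN mcoeffZ vac_bos //.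
    rewrite sub0r; case: (ltP (n - k) 0) => hnk; last first.
      rewrite fmo_vac // linear0 mcoeff0 mulr0 oppr0 /D.
      case: ifP => h; last by rewrite mulr0.
      by rewrite (_ : (_ == 0) = false) ?mul0r //; lia.
    rewrite fmo2_vev //; last by case: (b).
    rewrite (_ : N%:Z + k + (n - k) + 1 = N%:Z + n + 1); last by lia.
    rewrite /D; case: (N%:Z + n + 1 =P 0) => [h|_]; last by rewrite !mul0r mulr0 oppr0.
    by rewrite (_ : - N.+1%:Z < k) ?mul1r ?mulr1 //; [ring | lia].
  rewrite andbF mulr0 add0r scale1r; case: (k =P 0) => [->|h].
    rewrite bos0 subr0 linearZ /= linearZ /= mcoeffZ G_fmo_vev // /D.
    by ring.
  by rewrite bos_vac ?linear0 ?mcoeff0 //; lia.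
have hf : finsuppd f.
  apply: (@finsuppd_int _ _ N.+1) => k hk; rewrite /f /range_term.
  by case: ifP => [h|_]; [lia | rewrite mulr0].
rewrite sum_add //; last by exists [:: 0] => k; rewrite inE /g => /negbTE ->.
rewrite (sum_single (f := g) (a := 0)) /g => [|k /negbTE -> //]; rewrite eqxx.
rewrite -(sum_map (D := fun a : C => D * a)) ?mulr0 //; last 2 first.
- by move=> u v; rewrite mulrDr.
- apply: (@finsuppd_int _ _ N.+1) => k hk; rewrite /range_term.
  by case: ifP => // h; lia.
by rewrite sum_range_term /D; ring.
Qed.

Lemma G_G_vev m n : 0 <= m -> n < 0 -> (G m (G n vac))@_vac0 =
  (m + n + 1 == 0)%:R * (2%:R * hwt cL p s + (m%:~R ^+ 2 + m%:~R) / 3%:R * cL).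
Proof.
case: m => // N _ hn.
have -> : G n vac = sq2 *: (2%:R^-1 *: CP n vac + 2%:R^-1 *: DM n vac +
    (t * (- n%:~R - 1)) *: psi true n vac + (n%:~R + 1) *: psi false n vac).
  by rewrite Gmode.unlock.
rewrite !modeE.
rewrite !(mcoeffZ, mcoeffD) !G_fmo_vev //.
rewrite (@G_nprod_vev false) // (@G_nprod_vev true) // /zeros /fmo_vev /hwt /tcl.
case: (N%:Z + n + 1 =P 0) => [h|_]; last by rewrite !mul0r; ring.
have -> : n%:~R = - (N%:R + 1) :> C.
  by rewrite (_ : n = - (N%:Z + 1)) ?(rmorphN, rmorphD) //; lia.
rewrite -[N.+1%:R]natr1 -[N%:~R]/(N%:R) !mul1r.
by sq2_field.
Qed.

Lemma G_G_comm m n x : G m (G n x) = - G n (G m x) + 2%:R *: L (m + n + 1) x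
  + ((m + n + 1 == 0)%:R * ((m%:~R ^+ 2 + m%:~R) / 3%:R * cL)) *: x.
Proof.
pose D := (m + n + 1 == 0)%:R * ((m%:~R ^+ 2 + m%:~R) / 3%:R * cL).
pose X x := G m (G n x) + G n (G m x) - 2%:R *: L (m + n + 1) x - D *: x.
suff h : X x = 0 by rewrite -[LHS]subr0 -h /X /D; mcoeffs; ring.
apply: (@schur_zero _ zeros _ 1); rewrite ?oner_eq0 //.
- by move=> a u v; rewrite /X !modeE; mcoeffs; ring.
- move=> b k u.
  have e1 : n + (m + k) + 1 = m + n + 1 + k by lia.
  have e2 : m + (n + k) + 1 = m + n + 1 + k by lia.
  have hk : m + n + 1 + k = 0 -> k%:~R = - (m%:~R + n%:~R + 1) :> C.
    by move=> h; rewrite (_ : k = - (m + n + 1)) ?(rmorphN, rmorphD) //; lia.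
  rewrite /zeros /X; case: b.
    rewrite !(Lmode_d, Gmode_d, modeE, Gmode_psip) e1 e2.
    mcoeffs; rewrite !rmorphD /=.
    by case: (m + n + 1 + k =P 0) => [/hk ->|_] /=; sq2_field.
  rewrite !(Lmode_c, Gmode_c, modeE, Gmode_psim) e1 e2.
  mcoeffs; rewrite !rmorphD /=.
  by case: (m + n + 1 + k =P 0) => [/hk ->|_] /=; sq2_field.
- move=> b k u.
  have e1 : m + (n + k + 1) = m + n + 1 + k by lia.
  have e2 : n + (m + k + 1) = m + n + 1 + k by lia.
  have e3 : m + (n + k) + 1 = m + n + 1 + k by lia.
  rewrite /X; case: b.
    rewrite !(Lmode_psi, Gmode_c, modeE, Gmode_psim) e1 e2.
    by mcoeffs; rewrite !rmorphD /=; sq2_field.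
  rewrite !(Lmode_psi, Gmode_d, modeE, Gmode_psip) e1 e2.
  by mcoeffs; rewrite !rmorphD /=; sq2_field.
have vX : (X vac)@_vac0 = (G m (G n vac))@_vac0 + (G n (G m vac))@_vac0 -
    2%:R * (L (m + n + 1) vac)@_vac0 - D.
  rewrite /X !(mcoeffD, mcoeffN, mcoeffZ) vev_vac; ring.
have vL k : (L k vac)@_vac0 = (k == 0)%:R * hwt cL p s.
  case: (ltgtP k 0) => hk; first by rewrite L_vev // mul0r.
    by rewrite L_vac // mcoeff0 mul0r.
  by rewrite hk L0_vac mcoeffZ vev_vac mulr1 mul1r.
(* At most one of the two products contributes: G(k + 1/2) kills the vacuum for k >= 0 and has no
   vacuum component in its image for k < 0. The case m < 0 <= n uses that m^2 + m is invariant under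
   m -> - m - 1. *)
rewrite vX vL /D; case: (ltP m 0) => hm; case: (ltP n 0) => hn.
- by rewrite !G_vev // (_ : (_ == 0) = false) /=; [ring | lia].
- rewrite G_vac // linear0 mcoeff0 G_G_vev //.
  have -> : n + m + 1 = m + n + 1 by lia.
  case: (m + n + 1 =P 0) => [h|_] /=; last by ring.
  have -> : n%:~R = - (m%:~R + 1) :> C.
    by rewrite (_ : n = - (m + 1)) ?(rmorphN, rmorphD) //; lia.
  by field.
- rewrite (G_vac _ _ _ hm) linear0 mcoeff0 G_G_vev //.
  by case: (m + n + 1 =P 0) => [h|_] /=; field.
rewrite !G_vac // !linear0 mcoeff0 (_ : (_ == 0) = false) /=; [ring | lia].
Qed.

(** L(n) is half of {G(1/2), G(n - 1/2)}, so [L, G] and {G, G} already determine this bracket. *)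
Lemma L_L_comm m n x : L m (L n x) = L n (L m x) + (m%:~R - n%:~R) *: L (m + n) x
  + ((m + n == 0)%:R * ((m%:~R ^+ 3 - m%:~R) / 12%:R * cL)) *: x.
Proof.
have E k y : L k y = 2%:R^-1 *: (G 0 (G (k - 1) y) + G (k - 1) (G 0 y)).
  rewrite (G_G_comm 0 (k - 1)) (_ : 0 + (k - 1) + 1 = k); last by lia.
  by mcoeffs; field.
rewrite (E n x) (E n (L m x)) !(L_G_comm, modeE).
have -> : m + (n - 1) = m + n - 1 by lia.
rewrite addr0 (G_G_comm m (n - 1) x) (G_G_comm 0 (m + n - 1) x).
have -> : m + (n - 1) + 1 = m + n by lia.
have -> : 0 + (m + n - 1) + 1 = m + n by lia.
rewrite !rmorphB /=.
by mcoeffs; field.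
Qed.

End SuperVirasoro.

(** * The SH-module structure and the highest weight vector *)

Section FockModule.
Context {C : numClosedFieldType}.
Variables cL p cLa s : C.
Local Notation Fock := (@Fock C).
Local Notation zc := (czero p).
Local Notation c := (@bos C zc false).
Local Notation psi := (@fmo C).
Local Notation L := (Lmode cL p s).
Local Notation G := (Gmode cL p s).
Local Notation sq2 := (sqrtC 2%:R : C).

Definition SHact (g : SHgen) : Fock -> Fock :=
  match g with
  | SL n => L n
  | Sal n => fun x => - cLa *: c n x
  | SG n => G n
  | SPsi n => fun x => - (sq2 * cLa) *: psi true n x
  | SCL => fun x => cL *: x
  | SCal => fun _ => 0
  | SCLal => fun x => cLa *: x
  end.

Lemma FockActE : FockAct cL p cLa (s := s) = SHact.
Proof.
apply/funext => g; apply/funext => x; case: g => //= n.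
- exact: Lop_Lmode.
- by rewrite osc_bos.
- exact: Gop_Gmode.
- by rewrite fer_fmo.
Qed.

Lemma SHact_linear g : linear (SHact g).
Proof.
move=> a x y; case: g => [n|n|n|n|||] /=; rewrite ?modeE.
all: by mcoeffs; ring.
Qed.

Lemma SHact_module : is_SHmodule SHact.
Proof.
split; rewrite /commut /acommut.
- exact: SHact_linear.
- by case=> [n|n|n|n|||] u /=; rewrite ?modeE; mcoeffs; ring.
- by case=> [n|n|n|n|||] u /=; rewrite ?(scaler0, linear0, subrr).
- by case=> [n|n|n|n|||] u /=; rewrite ?modeE; mcoeffs; ring.
- by move=> m n u /=; rewrite !modeE bosC_same scaler0; mcoeffs; ring.
- move=> m n u /=; rewrite !modeE Lmode_c rmorphD rmorphXn /=.
  by mcoeffs; ring.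
- move=> m n u /=; rewrite L_L_comm !rmorphB rmorphXn /=.
  by mcoeffs; ring.
- move=> m n u /=; rewrite !modeE (fmoC true true m n) /=.
  by rewrite scaler0; mcoeffs; ring.
- by move=> m n u /=; rewrite !modeE bos_fmo; mcoeffs; ring.
- move=> m n u /=; rewrite G_G_comm rmorphD rmorphXn /=.
  by mcoeffs; ring.
- by move=> m n u /=; rewrite L_G_comm; mcoeffs; ring.
- by move=> m n u /=; rewrite !modeE Gmode_c (addrC n m); mcoeffs; ring.
- move=> m n u /=; rewrite !modeE Lmode_psi (addrC n m) !rmorphD rmorphM /=.
  by mcoeffs; field.
- move=> m n u /=; rewrite !modeE Gmode_psim rmorphM /=.
  have -> : n + m + 1 = m + n + 1 by lia.
  mcoeffs; case: (m + n + 1 =P 0) => [h|_] /=; last by sq2_field.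
  have -> : n%:~R = - (m%:~R + 1) :> C.
    by rewrite (_ : n = - (m + 1)) ?(rmorphN, rmorphD) //; lia.
  by sq2_field.
Qed.

Lemma SHact_vac : is_hw_vector cL cLa p s SHact (ket C vac0).
Proof.
split.
- case=> [n|n|n|n|||] //= hn.
  + exact: L_vac.
  + by rewrite bos_vac ?scaler0.
  + exact: G_vac.
  + by rewrite fmo_vac ?scaler0.
- by rewrite /= L0_vac hwtE.
- by rewrite /= bos0 /czero scalerA; congr (_ *: _); ring.
- by [].
- by [].
- by [].
Qed.

End FockModule.

(** * Vertex operators *)

Section ExpCoef.
Context {C : numClosedFieldType}.
Local Notation Fock := (@Fock C).
Variable A : nat -> Fock -> Fock.
Hypothesis linA : forall n, linear (A n).
Hypothesis comA : forall m n v, A m (A n v) = A n (A m v).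
Implicit Types (v : Fock) (j n N : nat) (k : int).

Let A0 n : A n 0 = 0.
Proof. exact: (linear_fun0 (linA n)). Qed.
Let AD n : {morph A n : x y / x + y}.
Proof. exact: (linear_funD (linA n)). Qed.
Let AZ n a x : A n (a *: x) = a *: A n x.
Proof. exact: (linear_funZ (linA n)). Qed.
Let Asum n (I : Type) (r : seq I) (P : pred I) (F : I -> Fock) :
  A n (\sum_(i <- r | P i) F i) = \sum_(i <- r | P i) A n (F i).
Proof. exact: (big_morph _ (AD n) (A0 n)). Qed.

(* Coefficient of z^k in the j-th power of \sum_(0 < a < N) A a z^a. *)
Fixpoint pow_coef N j k v : Fock :=
  if j is i.+1 then
    \sum_(a < N | (0 < a)%N) A a (pow_coef N i (k - (a : nat)%:Z) v)
  else if k == 0 then v else 0.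

Lemma pow_coef_succ N j k v : pow_coef N j.+1 k v =
  \sum_(a < N | (0 < a)%N) A a (pow_coef N j (k - (a : nat)%:Z) v).
Proof. by []. Qed.

(** Each factor has order at least 1 in z, so the j-th power starts in degree j. Hence the cut-offs
    on j and on the indices of the modes may be enlarged at will. *)
Lemma pow_coef_small N j k v : k < j%:Z -> pow_coef N j k v = 0.
Proof.
elim: j k => [|j IH] k h /=; first by case: eqP => // e; lia.
by apply: big1 => a a0; rewrite IH ?A0 //; lia.
Qed.

Lemma pow_coefS N j k v : k < N%:Z -> pow_coef N.+1 j k v = pow_coef N j k v.
Proof.
elim: j k => [|j IH] k h //=.
rewrite big_mkcond big_ord_recr /= -big_mkcond /= [X in _ + X](_ : _ = 0).
  by rewrite addr0; apply: eq_bigr => a a0; rewrite IH //; lia.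
by case: ifP => // N0; rewrite pow_coef_small ?A0 //; lia.
Qed.

Lemma pow_coef_bound N M j k v : k < N%:Z -> (N <= M)%N ->
  pow_coef M j k v = pow_coef N j k v.
Proof.
move=> h /subnKC <-; elim: (M - N)%N => [|i IH]; first by rewrite addn0.
by rewrite addnS pow_coefS ?IH //; lia.
Qed.

(** Coefficient form of z d/dz A(z)^(j+1) = (j + 1) (z A'(z)) A(z)^j, valid because the modes of A
    commute. *)
Lemma pow_coef_rec N j k v : k%:~R *: pow_coef N j.+1 k v =
  j.+1%:R *: \sum_(a < N | (0 < a)%N)
    (a : nat)%:R *: A a (pow_coef N j (k - (a : nat)%:Z) v).
Proof.
elim: j k => [|j IH] k.
  rewrite scale1r /= scaler_sumr; apply: eq_bigr => a a0.
  case: eqP => h; last by rewrite A0 !scaler0.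
  by rewrite (_ : k = (a : nat)%:Z) //; lia.
rewrite [in LHS]pow_coef_succ scaler_sumr.
pose S := \sum_(a < N | (0 < a)%N)
  (a : nat)%:R *: A a (pow_coef N j.+1 (k - (a : nat)%:Z) v).
(* Splitting k = a + (k - a) in every summand yields S from a and, by induction and commutativity, j
   + 1 copies of S from k - a. *)
transitivity (S + j.+1%:R *: S); last first.
  by rewrite -[in RHS](add1n j.+1) natrD scalerDl scale1r.
have -> : j.+1%:R *: S = \sum_(a < N | (0 < a)%N)
    A a ((k - (a : nat)%:Z)%:~R *: pow_coef N j.+1 (k - (a : nat)%:Z) v).
  pose F (a b : 'I_N) := (j.+1%:R * (a : nat)%:R) *:
    A a (A b (pow_coef N j (k - (a : nat)%:Z - (b : nat)%:Z) v)).
  transitivity (\sum_(a < N | (0 < a)%N) \sum_(b < N | (0 < b)%N) F a b).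
    rewrite /S scaler_sumr; apply: eq_bigr => a _.
    by rewrite pow_coef_succ Asum scalerA scaler_sumr.
  rewrite exchange_big /=; apply: eq_bigr => b _.
  rewrite IH AZ Asum scaler_sumr; apply: eq_bigr => a _.
  rewrite /F AZ comA scalerA (_ : k - (b : nat)%:Z - (a : nat)%:Z =
    k - (a : nat)%:Z - (b : nat)%:Z) //.
  by lia.
rewrite /S -big_split /=; apply: eq_bigr => a a0.
rewrite AZ -scalerDl; congr (_ *: _).
by rewrite rmorphB /= addrC subrK.
Qed.

Lemma sum_tuple_pow_coef N j (k : nat) v :
  \sum_(t : j.-tuple 'I_N | all (fun i : 'I_N => 0 < i)%N t
      && (\sum_(i <- t) (i : nat) == k)%N)
    foldr (fun i : 'I_N => A i) v t = pow_coef N j k%:Z v.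
Proof.
elim: j k => [|j IH] k /=.
  case: (k =P 0%N) => [->|k0].
    rewrite (big_pred1 [tuple]) // => t.
    by have -> : t = [tuple] by [exact: tuple0]; rewrite /= big_nil [RHS]eqxx.
  rewrite big_pred0 => [|t]; first by case: eqP => // h; lia.
  by have -> : t = [tuple] by [exact: tuple0]; rewrite /= big_nil; lia.
rewrite (reindex (fun p : 'I_N * j.-tuple 'I_N => [tuple of p.1 :: p.2])); last first.
  exists (fun t => (thead t, [tuple of behead t])) => [[a t] _|t _] /=.
    by congr pair; apply: val_inj.
  by rewrite [in RHS](tuple_eta t).
pose P (a : 'I_N) (t : j.-tuple 'I_N) := [&& (0 < a)%N, all (fun i : 'I_N => 0 < i)%N t
      & (a + \sum_(i <- t) (i : nat) == k)%N].
rewrite (eq_bigl (fun p : 'I_N * j.-tuple 'I_N => (0 < p.1)%N && P p.1 p.2)); last first.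
  by move=> [a t]; rewrite /P /= big_cons; case: (0 < a)%N.
rewrite -(pair_big_dep (fun a : 'I_N => (0 < a)%N) P
  (fun a t => A a (foldr (fun i : 'I_N => A i) v t))) /=.
apply: eq_bigr => a a0; rewrite -Asum; congr (A a _).
have [ak|ka] := leqP a k.
  rewrite (_ : k%:Z - (a : nat)%:Z = (k - a)%:Z); last by lia.
  rewrite -IH; apply: eq_bigl => t; rewrite /P a0 /=; congr andb.
  by lia.
rewrite pow_coef_small ?big_pred0 //; last by lia.
by move=> t; rewrite /P; apply/negbTE; rewrite !negb_and; apply/orP; right; apply/orP; right; lia.
Qed.

Lemma exp_coefE N M (k : nat) v : (k < N)%N -> (k < M)%N ->
  exp_coef A k v = \sum_(j < M) (j`!%:R)^-1 *: pow_coef N j k%:Z v.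
Proof.
move=> kN kM; rewrite -(big_mkord xpredT (fun j => (j`!%:R)^-1 *: pow_coef N j k v)).
rewrite (big_cat_nat (leq0n _) kM) //= [X in _ + X]big_nat_cond [X in _ + X]big1 ?addr0; last first.
  by move=> j /andP[/andP[kj _] _]; rewrite pow_coef_small ?scaler0 //; lia.
rewrite big_mkord /exp_coef; apply: eq_bigr => j _; congr (_ *: _).
by rewrite sum_tuple_pow_coef (@pow_coef_bound k.+1 N) //; lia.
Qed.

Lemma exp_coef0 v : exp_coef A 0 v = v.
Proof. by rewrite (@exp_coefE 1 1) // big_ord1 /= invr1 scale1r. Qed.

(** This is z d/dz exp A(z) = (z A'(z)) exp A(z). For k > 0 it determines the coefficient from those
    of lower degree, which gives access to exponentials by induction on k without returning to the
    powers. *)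
Lemma exp_coef_rec (k : nat) v : k%:R *: exp_coef A k v =
  \sum_(a < k.+1 | (0 < a)%N) (a : nat)%:R *: A a (exp_coef A (k - a) v).
Proof.
rewrite (@exp_coefE k.+1 k.+2) // big_ord_recl scalerDr.
have -> : k%:R *: ((0`!)%:R^-1 *: pow_coef k.+1 0 k v) = 0 :> Fock.
  by case: k => [|k]; rewrite ?scale0r //= !scaler0.
rewrite add0r.
pose F (a j : 'I_k.+1) := ((a : nat)%:R * ((j : nat)`!%:R)^-1) *:
  A a (pow_coef k.+1 j (k%:Z - (a : nat)%:Z) v).
transitivity (\sum_(j < k.+1) \sum_(a < k.+1 | (0 < a)%N) F a j).
  rewrite scaler_sumr; apply: eq_bigr => j _.
  rewrite scalerA mulrC -scalerA -[k%:R]/(k%:Z%:~R) pow_coef_rec !scalerA.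
  rewrite scaler_sumr; apply: eq_bigr => a _; rewrite /F scalerA.
  congr (_ *: _); rewrite lift0 factS natrM.
  by field; rewrite pnatr_eq0 -lt0n fact_gt0 /= addrC natr1 pnatr_eq0.
rewrite exchange_big /=; apply: eq_bigr => a a0.
rewrite (@exp_coefE k.+1 k.+1) ?Asum; try lia.
rewrite scaler_sumr; apply: eq_bigr => j _; rewrite /F AZ scalerA.
have := ltn_ord a; move=> ak.
by rewrite (_ : k%:Z - (a : nat)%:Z = (k - a)%:Z) //; lia.
Qed.

Definition exp_coefz (k : int) (v : Fock) : Fock :=
  if k is Posz n then exp_coef A n v else 0.

Lemma exp_coefz_neg k v : k < 0 -> exp_coefz k v = 0.
Proof. by case: k. Qed.

Lemma exp_coefz_rec N k v : k < N%:Z -> k%:~R *: exp_coefz k v =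
  \sum_(a < N | (0 < a)%N) (a : nat)%:R *: A a (exp_coefz (k - (a : nat)%:Z) v).
Proof.
move=> kN; have [k0|k0] := ltP k 0.
  rewrite exp_coefz_neg // scaler0 big1 // => a a0.
  by rewrite exp_coefz_neg ?A0 ?scaler0 //; lia.
case: k k0 kN => // k _ kN; rewrite [LHS]exp_coef_rec.
rewrite (big_ord_widen_cond N (fun a => 0 < a)%N
  (fun a => a%:R *: A a (exp_coef A (k - a) v))) ?ltz_nat //.
rewrite big_mkcondr /=; apply: eq_bigr => a a0; case: ltnP => ak.
  by rewrite (_ : k%:Z - (a : nat)%:Z = (k - a)%:Z) //; lia.
by rewrite exp_coefz_neg ?A0 ?scaler0 //; lia.
Qed.

Lemma exp_coefz_ind (P : int -> Prop) : (forall k, k < 0 -> P k) -> P 0 ->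
  (forall k, 0 < k -> (forall l, l < k -> P l) -> P k) -> forall k, P k.
Proof.
move=> Pneg P0 PS; have H n : forall k, k < n%:Z -> P k.
  elim: n => [|n IH] k hk; first exact: Pneg.
  have [k0|k0|->//] := ltgtP k 0; first exact: Pneg.
  by apply: PS => // l lk; apply: IH; lia.
by move=> k; apply: (H (absz k).+1); lia.
Qed.

Lemma scale_int_inj k (v w : Fock) : k != 0 -> k%:~R *: v = k%:~R *: w -> v = w.
Proof. by move=> k0; apply: scalerI; rewrite intr_eq0. Qed.

Lemma exp_coefz_linear k : linear (exp_coefz k).
Proof.
move=> x v w; elim/exp_coefz_ind: k => [k k0||k k0 IH].
- by rewrite !exp_coefz_neg // scaler0 addr0.
- by rewrite /= !exp_coef0.
apply: (@scale_int_inj k); first by lia.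
rewrite scalerDr scalerA mulrC -scalerA !(@exp_coefz_rec (absz k).+1); try lia.
rewrite scaler_sumr -big_split /=; apply: eq_bigr => a a0.
by rewrite IH ?AD ?AZ; [mcoeffs; ring | lia].
Qed.

(** Since [D, A(z)] = mu z^b is a scalar, moving D past exp A(z) produces mu z^b exp A(z). *)
Lemma exp_coefz_shift (D : Fock -> Fock) (mu : C) (b : nat) : linear D ->
  (0 < b)%N -> (forall n v, D (A n v) = A n (D v) + ((n == b)%:R * mu) *: v) ->
  forall k v, D (exp_coefz k v) = exp_coefz k (D v) + mu *: exp_coefz (k - b%:Z) v.
Proof.
move=> linD b0 hD k v.
have D0 : D 0 = 0 by apply: (linear_fun0 linD).
have DD : {morph D : x y / x + y} by apply: (linear_funD linD).
have DZ a x : D (a *: x) = a *: D x by apply: (linear_funZ linD).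
elim/exp_coefz_ind: k => [k k0||k k0 IH].
- by rewrite !exp_coefz_neg ?D0 ?scaler0 ?addr0 //; lia.
- by rewrite [exp_coefz (0 - _) _]exp_coefz_neg /= ?exp_coef0 ?scaler0 ?addr0 //; lia.
apply: (@scale_int_inj k); first by lia.
pose N := (absz k + b).+1; have bN : (b < N)%N by lia.
rewrite -DZ scalerDr !(@exp_coefz_rec N) //; try lia.
rewrite (big_morph D DD D0).
pose F (a : 'I_N) := ((a : nat)%:R * mu) *: A a (exp_coefz (k - b%:Z - (a : nat)%:Z) v).
have E1 : mu *: ((k - b%:Z)%:~R *: exp_coefz (k - b%:Z) v) = \sum_(a < N | (0 < a)%N) F a.
  rewrite (@exp_coefz_rec N); last by lia.
  by rewrite scaler_sumr; apply: eq_bigr => a _; rewrite /F scalerA mulrC.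
have E2 : (b%:R * mu) *: exp_coefz (k - b%:Z) v =
    \sum_(a < N | (0 < a)%N) ((a : nat)%:R * ((a : nat) == b)%:R * mu) *: exp_coefz (k - (a : nat)%:Z) v.
  rewrite (bigD1 (Ordinal bN)) //= eqxx mulr1 big1 ?addr0 // => a /andP[_ ab].
  by rewrite (_ : (a == b :> nat) = false) ?mulr0 ?mul0r ?scale0r //; apply: negbTE.
(* With k = (k - b) + b, the first part is the recursion in degree k - b and the second matches the
   commutators [D, A b]. *)
have -> : k%:~R *: (mu *: exp_coefz (k - b%:Z) v) =
    mu *: ((k - b%:Z)%:~R *: exp_coefz (k - b%:Z) v) + (b%:R * mu) *: exp_coefz (k - b%:Z) v.
  by rewrite rmorphB /= -[b%:~R]/(b%:R); mcoeffs; ring.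
rewrite E1 E2 -!big_split /=; apply: eq_bigr => a a0.
rewrite DZ hD IH; last by lia.
rewrite /F (_ : k - b%:Z - (a : nat)%:Z = k - (a : nat)%:Z - b%:Z); last by lia.
by rewrite AD AZ; mcoeffs; ring.
Qed.

Lemma exp_coefz_comm (D : Fock -> Fock) : linear D ->
  (forall n v, D (A n v) = A n (D v)) ->
  forall k v, D (exp_coefz k v) = exp_coefz k (D v).
Proof.
move=> linD hD k v; rewrite (@exp_coefz_shift D 0 1) // => [|n u].
  by rewrite scale0r addr0.
by rewrite mulr0 scale0r addr0.
Qed.

End ExpCoef.

(** The factor 1 / n is 0 for n = 0, so the zero mode is absent and its eigenvalue can be fixed as
    0, here and in [anmode]. *)
Definition crmode (C : numClosedFieldType) (lam : C) (n : nat) (x : @Fock C) :=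
  (lam / n%:R) *: bos 0 false (- n%:Z) x.
Definition anmode (C : numClosedFieldType) (lam : C) (n : nat) (x : @Fock C) :=
  - (lam / n%:R) *: bos 0 false n%:Z x.

HB.lock Definition expcr (C : numClosedFieldType) (lam : C) (k : int) (x : @Fock C) :=
  exp_coefz (crmode lam) k x.
HB.lock Definition expan (C : numClosedFieldType) (lam : C) (k : int) (x : @Fock C) :=
  exp_coefz (anmode lam) k x.

(* Coefficient of z^M in z^(- lam c(0)) Y(e^(lam c), z). *)
HB.lock Definition vertex (C : numClosedFieldType) (lam : C) (M : int) (x : @Fock C)
  : @Fock C := \sum_(j \in [set: int]) expcr lam (M + j) (expan lam j x).

Lemma sum_pos_ord (V : zmodType) (N : nat) (F : int -> V) :
  (forall a, N%:Z <= a -> F a = 0) ->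
  \sum_(a \in [set: int]) (if 0 < a then F a else 0) =
  \sum_(a < N | (0 < a)%N) F (a : nat)%:Z.
Proof.
pose f K (a : int) := if (0 < a) && (a < K%:Z) then F a else 0.
have fin K : finsuppd (f K).
  by apply: (@finsuppd_int _ _ K) => k hk; rewrite /f; case: ifP => // h; lia.
move=> hF; transitivity (\sum_(a \in [set: int]) f N a).
  apply: eq_sumT => a; rewrite /f; case: ltP => //= a0; case: ltP => // h.
  by rewrite hF.
move: {hF} N => N; elim: N => [|N IH].
  by rewrite big_ord0; apply: fsbig1 => a _; rewrite /f; case: ifP => // h; lia.
rewrite [RHS]big_mkcond big_ord_recr /= -[X in _ = X + _]big_mkcond /= -IH.
pose g a := if a == N%:Z then f N.+1 a else 0.
rewrite (eq_sumT (g := fun a => f N a + g a)); last first.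
  move=> a; rewrite /g /f; case: (a =P N%:Z) => [->|h].
    by rewrite ltxx andbF add0r.
  by rewrite addr0 (_ : (a < N.+1%:Z) = (a < N%:Z)) //; lia.
rewrite sum_add //; last by exists [:: N%:Z] => a; rewrite inE /g => /negbTE ->.
rewrite (sum_single (f := g) (a := N%:Z)) /g => [|a /negbTE -> //].
by rewrite eqxx /f (_ : (N%:Z < N.+1%:Z) = true) ?andbT //; lia.
Qed.

Lemma sum_neg_pos (V : zmodType) (F : int -> V) :
  \sum_(a \in [set: int]) (if a < 0 then F a else 0) =
  \sum_(a \in [set: int]) (if 0 < a then F (- a) else 0).
Proof.
rewrite (sum_reflect 0); apply: eq_sumT => a.
by rewrite sub0r oppr_lt0.
Qed.

Section VertexOperators.
Context {C : numClosedFieldType}.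
Local Notation Fock := (@Fock C).
Implicit Types (lam : C) (x : Fock) (k M a : int) (n : nat).
Local Notation c := (@bos C 0 false).

Lemma crmode_linear lam n : linear (@crmode C lam n).
Proof. by move=> a x y; rewrite /crmode linearP /=; mcoeffs; ring. Qed.
Lemma anmode_linear lam n : linear (@anmode C lam n).
Proof. by move=> a x y; rewrite /anmode linearP /=; mcoeffs; ring. Qed.
Lemma crmodeC lam m n x : crmode lam m (crmode lam n x) = crmode lam n (crmode lam m x).
Proof. by rewrite /crmode !bosZ bosC_same; mcoeffs; ring. Qed.
Lemma anmodeC lam m n x : anmode lam m (anmode lam n x) = anmode lam n (anmode lam m x).
Proof. by rewrite /anmode !bosZ bosC_same; mcoeffs; ring. Qed.
Lemma crmode0 lam x : crmode lam 0 x = 0.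
Proof. by rewrite /crmode mulr0n invr0 mulr0 scale0r. Qed.
Lemma anmode0 lam x : anmode lam 0 x = 0.
Proof. by rewrite /anmode mulr0n invr0 mulr0 oppr0 scale0r. Qed.
Hint Resolve crmode_linear anmode_linear crmodeC anmodeC : core.

Lemma expcr_linear lam k : linear (@expcr C lam k).
Proof. by rewrite expcr.unlock; exact: exp_coefz_linear. Qed.
HB.instance Definition _ lam k :=
  GRing.isLinear.Build C Fock Fock *:%R (expcr lam k) (expcr_linear lam k).
Lemma expan_linear lam k : linear (@expan C lam k).
Proof. by rewrite expan.unlock; exact: exp_coefz_linear. Qed.
HB.instance Definition _ lam k :=
  GRing.isLinear.Build C Fock Fock *:%R (expan lam k) (expan_linear lam k).

Lemma expcr_neg lam k x : k < 0 -> expcr lam k x = 0.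
Proof. by rewrite expcr.unlock; exact: exp_coefz_neg. Qed.
Lemma expan_neg lam k x : k < 0 -> expan lam k x = 0.
Proof. by rewrite expan.unlock; exact: exp_coefz_neg. Qed.
Lemma expcr0 lam x : expcr lam 0 x = x.
Proof. by rewrite expcr.unlock /= exp_coef0. Qed.
Lemma expan0 lam x : expan lam 0 x = x.
Proof. by rewrite expan.unlock /= exp_coef0. Qed.

Lemma expcr_rec lam k x : k%:~R *: expcr lam k x =
  lam *: \sum_(a \in [set: int]) (if a < 0 then c a (expcr lam (k + a) x) else 0).
Proof.
rewrite sum_neg_pos (@sum_pos_ord _ (absz k).+1); last first.
  by move=> a ha; rewrite expcr_neg ?linear0 //; lia.
rewrite expcr.unlock (exp_coefz_rec (crmode_linear lam) (crmodeC lam) (N := (absz k).+1)); last by lia.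
rewrite scaler_sumr; apply: eq_bigr => a a0; rewrite /crmode scalerA.
by congr (_ *: _); field; rewrite pnatr_eq0 -lt0n.
Qed.

Lemma expan_rec lam k x : k%:~R *: expan lam k x =
  - lam *: \sum_(a \in [set: int]) (if 0 < a then c a (expan lam (k - a) x) else 0).
Proof.
rewrite (@sum_pos_ord _ (absz k).+1); last first.
  by move=> a ha; rewrite expan_neg ?linear0 //; lia.
rewrite expan.unlock (exp_coefz_rec (anmode_linear lam) (anmodeC lam) (N := (absz k).+1)); last by lia.
rewrite scaler_sumr; apply: eq_bigr => a a0; rewrite /anmode scalerA.
by congr (_ *: _); field; rewrite pnatr_eq0 -lt0n.
Qed.

Section Commute.
Variable D : Fock -> Fock.
Hypothesis linD : linear D.
Hypothesis hD : forall k x, k != 0 -> D (c k x) = c k (D x).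

Let DZ lam x : D (lam *: x) = lam *: D x.
Proof.
have D0 : D 0 = 0 by apply: (linear_fun0 linD).
by have := linD lam x 0; rewrite D0 !addr0.
Qed.

Let D0 : D 0 = 0.
Proof. exact: (linear_fun0 linD). Qed.

Lemma expcr_comm lam k x : D (expcr lam k x) = expcr lam k (D x).
Proof.
rewrite expcr.unlock; apply: exp_coefz_comm => // -[|n] v.
  by rewrite !crmode0 D0.
by rewrite /crmode DZ hD.
Qed.

Lemma expan_comm lam k x : D (expan lam k x) = expan lam k (D x).
Proof.
rewrite expan.unlock; apply: exp_coefz_comm => // -[|n] v.
  by rewrite !anmode0 D0.
by rewrite /anmode DZ hD.
Qed.
End Commute.

Lemma bosd_expcr z lam a k x : 0 < a ->
  bos z true a (expcr lam k x) = expcr lam k (bos z true a x) +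
  (2%:R * lam) *: expcr lam (k - a) x.
Proof.
case: a => // -[|a] // _; rewrite expcr.unlock.
apply: exp_coefz_shift => //; first exact: bos_linear.
move=> n v; rewrite /crmode bosZ bosC /= scalerDr; congr (_ + _).
rewrite scalerA; congr (_ *: _); rewrite (_ : (_ == 0) = (n == a.+1)); last by lia.
case: (n =P a.+1) => [->|_]; last by rewrite !mul0r mulr0.
by rewrite -[a.+1%:~R]/(a.+1%:R) /=; field; rewrite addrC natr1 pnatr_eq0.
Qed.

Lemma bosd_expan z lam a k x : a < 0 ->
  bos z true a (expan lam k x) = expan lam k (bos z true a x) +
  (2%:R * lam) *: expan lam (k + a) x.
Proof.
move=> a0; pose b := absz a; rewrite (_ : a = - b%:Z); last by lia.
rewrite expan.unlock.
apply: exp_coefz_shift => //; [exact: bos_linear | by lia |].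
move=> n v; rewrite /anmode bosZ bosC /= scalerDr; congr (_ + _).
rewrite scalerA; congr (_ *: _); rewrite (_ : (_ == 0) = (n == b)); last by lia.
case: (n =P b) => [->|_]; last by rewrite !mul0r mulr0.
have b0 : b%:R != 0 :> C by rewrite pnatr_eq0; lia.
by rewrite rmorphN /= -[b%:~R]/(b%:R) /=; field.
Qed.

Lemma bosd_expcr_neg z lam a k x : a <= 0 ->
  bos z true a (expcr lam k x) = expcr lam k (bos z true a x).
Proof.
move=> a0; rewrite expcr.unlock; apply: exp_coefz_comm => //; first exact: bos_linear.
move=> [|n] v; first by rewrite !crmode0 linear0.
rewrite /crmode bosZ bosC /= (_ : (_ == 0) = false); last by lia.
by rewrite mul0r scale0r addr0.
Qed.

Lemma bosd_expan_pos z lam a k x : 0 <= a ->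
  bos z true a (expan lam k x) = expan lam k (bos z true a x).
Proof.
move=> a0; rewrite expan.unlock; apply: exp_coefz_comm => //; first exact: bos_linear.
move=> [|n] v; first by rewrite !anmode0 linear0.
rewrite /anmode bosZ bosC /= (_ : (_ == 0) = false); last by lia.
by rewrite mul0r scale0r addr0.
Qed.

(** On the vacuum only degree 0 survives. Among the creation modes only d(k) fails to commute with
    the exponential, and it raises the bound by - k. *)
Lemma expan_finite lam x : exists N : nat, forall k, N%:Z < k -> expan lam k x = 0.
Proof.
move: x; apply: (modes_ind (z := fun=> 0)) => [a x y [N hN] [M hM]||
  b k x k0 [N hN]|b k x k0 [N hN]].
- exists (maxn N M) => k hk.
  by rewrite linearP /= hN ?hM ?scaler0 ?addr0 //; lia.
- exists 0%N => k; elim/exp_coefz_ind: k => [k k0 k1|//|k k0 IH _]; first by lia.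
  apply: (@scale_int_inj _ k); first by lia.
  rewrite expan_rec scaler0 fsbig1 ?scaler0 // => a _; case: ltP => // a0.
  have [ka|ka|ka] := ltgtP k a.
  + by rewrite expan_neg ?linear0 //; lia.
  + by rewrite IH ?linear0 //; lia.
  by rewrite ka subrr expan0 bos_vac.
- case: b => /=; last first.
    exists N => l hl; rewrite -expan_comm ?hN ?linear0 //; first exact: bos_linear.
    by move=> m v _; rewrite bosC_same.
  exists (N + absz k)%N => l hl.
  have := bosd_expan 0 lam l x k0.
  by rewrite (hN l) ?(hN (l + k)) ?linear0 ?scaler0 ?addr0 //; lia.
- exists N => l hl; rewrite -expan_comm ?hN ?linear0 //; first exact: fmo_linear.
  by move=> m v _; rewrite bos_fmo.
Qed.

End VertexOperators.

(** * Commutators and recursion for the vertex operators *)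

Section VertexRelations.
Context {C : numClosedFieldType}.
Local Notation Fock := (@Fock C).
Local Notation vac := (ket C vac0).
Implicit Types (lam : C) (x : Fock) (k M a : int) (n : nat).
Local Notation c := (@bos C 0 false).

Lemma vertex_finsuppd lam M x :
  finsuppd (fun j => expcr lam (M + j) (expan lam j x)).
Proof.
have [N hN] := expan_finite lam x; apply: (@finsuppd_int _ _ N) => k hk.
have [k0|k0] := ltP k 0; first by rewrite expan_neg ?linear0.
by rewrite hN ?linear0 //; lia.
Qed.

Lemma vertex_linear lam M : linear (@vertex C lam M).
Proof.
move=> a x y; rewrite vertex.unlock.
rewrite (sum_scale a (vertex_finsuppd lam M x)).
rewrite -sum_add; last exact: vertex_finsuppd.
  by apply: eq_sumT => j; rewrite !linearP.
exact: (finsuppd_scale a (vertex_finsuppd lam M x)).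
Qed.
HB.instance Definition _ lam M :=
  GRing.isLinear.Build C Fock Fock *:%R (vertex lam M) (vertex_linear lam M).

Lemma vertexD lam M x y : vertex lam M (x + y) = vertex lam M x + vertex lam M y.
Proof. exact: linearD. Qed.
Lemma vertexZ lam M (a : C) x : vertex lam M (a *: x) = a *: vertex lam M x.
Proof. exact: linearZ. Qed.
Lemma vertex_finite lam x : exists N : nat, forall M, M < - N%:Z -> vertex lam M x = 0.
Proof.
have [N hN] := expan_finite lam x; exists N => M hM.
rewrite vertex.unlock; apply: fsbig1 => j _.
have [j0|j0] := ltP N%:Z j; first by rewrite hN ?linear0.
by rewrite expcr_neg //; lia.
Qed.

Section Commute.
Variable D : Fock -> Fock.
Hypothesis linD : linear D.
Hypothesis hD : forall k x, k != 0 -> D (c k x) = c k (D x).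

Lemma vertex_comm lam M x : D (vertex lam M x) = vertex lam M (D x).
Proof.
have D0 : D 0 = 0 by apply: (linear_fun0 linD).
have DD : {morph D : x y / x + y} by apply: (linear_funD linD).
rewrite vertex.unlock (sum_map D0 DD (vertex_finsuppd lam M x)).
by apply: eq_sumT => j; rewrite !(expcr_comm linD hD, expan_comm linD hD).
Qed.
End Commute.

Lemma bosc_vertex z k lam M x : bos z false k (vertex lam M x) = vertex lam M (bos z false k x).
Proof. by apply: (vertex_comm (bos_linear _ _ _)) => m u _; rewrite bosC_same. Qed.
Lemma fmo_vertex b k lam M x : fmo b k (vertex lam M x) = vertex lam M (fmo b k x).
Proof. by apply: (vertex_comm (fmo_linear _ _)) => m u _; rewrite bos_fmo. Qed.
Lemma vertexC lam lam' M M' x :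
  vertex lam M (vertex lam' M' x) = vertex lam' M' (vertex lam M x).
Proof. by apply: (vertex_comm (vertex_linear _ _)) => m u _; rewrite bosc_vertex. Qed.

(** For a > 0 the extra term comes from the creating exponential, for a < 0 from the annihilating
    one; in the latter case the summation index has to be shifted by a. *)
Lemma bosd_vertex z lam a M x : a != 0 ->
  bos z true a (vertex lam M x) = vertex lam M (bos z true a x) +
  (2%:R * lam) *: vertex lam (M - a) x.
Proof.
move=> a0; rewrite vertex.unlock.
rewrite (sum_map (D := bos z true a) (linear0 _) (bosD _ _ _) (vertex_finsuppd lam M x)).
have fin K y := finsuppd_scale (2%:R * lam) (vertex_finsuppd lam K y).
rewrite (sum_scale (2%:R * lam) (vertex_finsuppd lam (M - a) x)).
have [ha|ha] := ltP 0 a.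
  rewrite -sum_add; [|exact: vertex_finsuppd|exact: fin].
  apply: eq_sumT => j; rewrite bosd_expcr // bosd_expan_pos ?ltW //.
  by rewrite (_ : M + j - a = M - a + j) //; lia.
rewrite [X in _ = _ + X](sum_shift a).
have fin' : finsuppd (fun k => (2%:R * lam) *: expcr lam (M - a + (k + a)) (expan lam (k + a) x)).
  have [N hN] := expan_finite lam x; apply: (@finsuppd_int _ _ (N + absz a)) => k hk.
  have [k0|k0] := ltP (k + a) 0; first by rewrite expan_neg ?linear0 ?scaler0.
  by rewrite hN ?linear0 ?scaler0 //; lia.
rewrite -sum_add //; last exact: vertex_finsuppd.
apply: eq_sumT => j; rewrite bosd_expcr_neg // bosd_expan; last by lia.
rewrite linearD linearZ /= (_ : M - a + (j + a) = M + j) //.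
by lia.
Qed.

Lemma vertex_vac lam M : vertex lam M vac = expcr lam M vac.
Proof.
have h k : k != 0 -> expan lam k vac = 0.
  elim/exp_coefz_ind: k => [k k0 _|//|k k0 IH _]; first exact: expan_neg.
  apply: (@scale_int_inj _ k); first by lia.
  rewrite expan_rec scaler0 fsbig1 ?scaler0 // => a _; case: ltP => // a0.
  have [ka|ka|ka] := ltgtP k a.
  - by rewrite expan_neg ?linear0 //; lia.
  - by rewrite IH ?linear0 //; lia.
  by rewrite ka subrr expan0 bos_vac.
rewrite vertex.unlock (sum_single (a := 0)) ?addr0 ?expan0 // => k k0.
by rewrite h ?linear0.
Qed.

(** Coefficient form of z d/dz Y = lam z c(z) Y with the zero mode of c left out. As the modes of c
    commute with Y, no normal ordering appears. *)
Lemma vertex_rec lam M x : M%:~R *: vertex lam M x =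
  lam *: \sum_(a \in [set: int]) (if a == 0 then 0 else c a (vertex lam (M + a) x)).
Proof.
have [N hN] := expan_finite lam x; have [N' hN'] := modes_finite x.
have killed k y : (forall z b, bos z b k x = 0) -> c k (expan lam y x) = 0.
  move=> hk; rewrite (expan_comm (bos_linear _ _ _)) ?hk ?linear0 // => m u _.
  by rewrite bosC_same.
pose F1 j a := if a < 0 then c a (expcr lam (M + j + a) (expan lam j x)) else 0.
pose F2 j a := if 0 < a then c a (expcr lam (M + j) (expan lam (j - a) x)) else 0.
have fin1 : finsuppd (fun q : int * int => F1 q.1 q.2).
  apply: (@finsuppd_int2 _ _ (N + absz M)) => j a h; rewrite /F1; case: ltP => // a0.
  have [j0|j0] := ltP j 0; first by rewrite expan_neg ?linear0.
  have [j1|j1] := ltP N%:Z j; first by rewrite hN ?linear0.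
  by rewrite expcr_neg ?linear0 //; lia.
have fin2 : finsuppd (fun q : int * int => F2 q.1 q.2).
  apply: (@finsuppd_int2 _ _ (N + N')) => j a h; rewrite /F2; case: ltP => // a0.
  have [j0|j0] := ltP (j - a) 0; first by rewrite expan_neg ?linear0.
  have [j1|j1] := ltP N%:Z (j - a); first by rewrite hN ?linear0.
  rewrite (expcr_comm (bos_linear _ _ _)); last by move=> m u _; rewrite bosC_same.
  by rewrite killed ?linear0 // => z b; have [|->] := hN' a; first lia.
pose Z1 (u : Fock) := M%:~R *: u.
have step j : M%:~R *: expcr lam (M + j) (expan lam j x) =
    lam *: (\sum_(a \in [set: int]) F1 j a + \sum_(a \in [set: int]) F2 j a).
  (* With M = (M + j) - j, the derivative falls on one exponential at a time: F1 collects the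
     negative modes of c, F2 the positive ones. *)
  have -> : M%:~R *: expcr lam (M + j) (expan lam j x) =
      (M + j)%:~R *: expcr lam (M + j) (expan lam j x) -
      expcr lam (M + j) (j%:~R *: expan lam j x).
    by rewrite linearZ /= rmorphD /=; mcoeffs; ring.
  rewrite expcr_rec expan_rec linearZ /= scalerDr scaleNr opprK; congr (_ + _ *: _).
  rewrite (sum_map (D := expcr lam (M + j)) (linear0 _) (linearD _)); last first.
    apply: (@finsuppd_int _ _ (absz j)) => a ha; case: ltP => // a0.
    by rewrite expan_neg ?linear0 //; lia.
  apply: eq_sumT => a; rewrite /F2; case: ltP => _; last by rewrite linear0.
  rewrite -(expcr_comm (bos_linear _ _ _)) // => m u _.
  by rewrite bosC_same.
rewrite vertex.unlock (sum_scale (M%:~R) (vertex_finsuppd lam M x)) (eq_sumT step).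
have f1 := finsuppd_sum fin1; have f2 := finsuppd_sum fin2.
rewrite -(sum_scale lam);
  last exact: finsuppd_add.
congr (_ *: _); rewrite sum_add // (sum_exchange fin1) (sum_exchange fin2).
have g1 := @finsuppd_sum _ _ _ (fun a j => F1 j a) (finsuppd_swap fin1).
have g2 := @finsuppd_sum _ _ _ (fun a j => F2 j a) (finsuppd_swap fin2).
rewrite -sum_add //; apply: eq_sumT => a.
have [a0|a0|->] := ltgtP a 0.
- rewrite /F1 /F2 a0 (_ : (0 < a) = false) ?[\sum_(j \in _) 0]fsbig1 ?addr0 //; last by lia.
  rewrite (sum_map (D := c a) (linear0 _) (bosD _ _ _) (vertex_finsuppd lam (M + a) x)).
  by apply: eq_sumT => j; rewrite (_ : M + a + j = M + j + a) //; lia.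
- rewrite /F1 /F2 a0 (_ : (a < 0) = false) ?[\sum_(j \in _) 0]fsbig1 ?add0r //; last by lia.
  rewrite (sum_map (D := c a) (linear0 _) (bosD _ _ _) (vertex_finsuppd lam (M + a) x)).
  rewrite (sum_shift a).
  apply: eq_sumT => j; rewrite (_ : M + (j + a) = M + a + j) ?addrK //; lia.
rewrite /F1 /F2 ltxx !fsbig1 ?addr0 //.
Qed.

End VertexRelations.

Lemma finsuppd_curry (T T' : choiceType) (V : zmodType) (f : T -> T' -> V) i :
  finsuppd (fun q : T * T' => f q.1 q.2) -> finsuppd (f i).
Proof.
move=> [l hl]; exists [seq q.2 | q <- l] => j h; apply: (hl (i, j)).
by apply: contra h => h; apply/mapP; exists (i, j).
Qed.

Lemma sum_antisym (C : numClosedFieldType) (f : int -> int -> @Fock C) :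
  finsuppd (fun q : int * int => f q.1 q.2) -> (forall k l, f k l = - f l k) ->
  \sum_(k \in [set: int]) \sum_(l \in [set: int]) f k l = 0.
Proof.
move=> fin anti; set S := (X in X = 0).
have : S = - S.
  rewrite {1}/S (sum_exchange fin) /S.
  rewrite [RHS](sum_map (D := fun u : @Fock C => - u) (oppr0 _) (@opprD _));
    last exact: finsuppd_sum.
  apply: eq_sumT => k.
  rewrite (sum_map (D := fun u : @Fock C => - u) (oppr0 _) (@opprD _));
    last exact: (finsuppd_curry k fin).
  by apply: eq_sumT => l; rewrite anti.
move=> /eqP; rewrite -subr_eq0 opprK -mulr2n -scaler_nat scaler_eq0 pnatr_eq0 /=.
by move=> /eqP.
Qed.

(** * Products of vertex operators *)

Section VertexProduct.
Context {C : numClosedFieldType}.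
Local Notation Fock := (@Fock C).
Local Notation vac := (ket C vac0).
Implicit Types (lam mu : C) (x : Fock) (k M a : int) (n : nat).
Local Notation c := (@bos C 0 false).

Lemma expcr_mul_finsuppd lam mu M x :
  finsuppd (fun i => expcr lam i (expcr mu (M - i) x)).
Proof.
apply: (@finsuppd_int _ _ (absz M)) => i hi.
have [i0|i0] := ltP i 0; first by rewrite expcr_neg.
by rewrite (@expcr_neg _ mu) ?linear0 //; lia.
Qed.

Lemma c_expcr a lam k x : c a (expcr lam k x) = expcr lam k (c a x).
Proof.
by apply: (expcr_comm (bos_linear _ _ _)) => m u _; rewrite bosC_same.
Qed.

(** Both sides satisfy the recursion [expcr_rec] for lam + mu: with M = i + (M - i) the derivative
    falls on one factor at a time. *)
Lemma expcr_mul lam mu M x :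
  \sum_(i \in [set: int]) expcr lam i (expcr mu (M - i) x) = expcr (lam + mu) M x.
Proof.
elim/exp_coefz_ind: M => [M M0||M M0 IH].
- rewrite expcr_neg // fsbig1 // => i _.
  have [i0|i0] := ltP i 0; first by rewrite expcr_neg.
  by rewrite (@expcr_neg _ mu) ?linear0 //; lia.
- rewrite (sum_single (a := 0)) ?subr0 ?expcr0 // => i i0.
  have [h|h] := ltP i 0; first by rewrite expcr_neg.
  by rewrite (@expcr_neg _ mu) ?linear0 //; lia.
apply: (@scale_int_inj _ M); first by lia.
rewrite (sum_scale (M%:~R) (expcr_mul_finsuppd lam mu M x)).
pose F1 i a := if a < 0 then lam *: c a (expcr lam (i + a) (expcr mu (M - i) x)) else 0.
pose F2 i a := if a < 0 then mu *: c a (expcr lam i (expcr mu (M - i + a) x)) else 0.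
have fin1 : finsuppd (fun q : int * int => F1 q.1 q.2).
  apply: (@finsuppd_int2 _ _ (absz M)) => i a h; rewrite /F1; case: ltP => // a0.
  have [i0|i0] := ltP (i + a) 0; first by rewrite expcr_neg ?linear0 ?scaler0.
  by rewrite (@expcr_neg _ mu) ?linear0 ?scaler0 //; lia.
have fin2 : finsuppd (fun q : int * int => F2 q.1 q.2).
  apply: (@finsuppd_int2 _ _ (absz M)) => i a h; rewrite /F2; case: ltP => // a0.
  have [i0|i0] := ltP i 0; first by rewrite expcr_neg ?linear0 ?scaler0.
  by rewrite (@expcr_neg _ mu) ?linear0 ?scaler0 //; lia.
have step i : M%:~R *: expcr lam i (expcr mu (M - i) x) =
    \sum_(a \in [set: int]) F1 i a + \sum_(a \in [set: int]) F2 i a.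
  have -> : M%:~R *: expcr lam i (expcr mu (M - i) x) =
      i%:~R *: expcr lam i (expcr mu (M - i) x) +
      expcr lam i ((M - i)%:~R *: expcr mu (M - i) x).
    by rewrite linearZ /= rmorphB /=; mcoeffs; ring.
  rewrite !expcr_rec; congr (_ + _).
    rewrite (sum_scale lam).
      by apply: eq_sumT => a; rewrite /F1; case: ifP; rewrite ?scaler0.
    apply: (@finsuppd_int _ _ (absz i)) => a ha; case: ltP => // a0.
    by rewrite expcr_neg ?linear0 //; lia.
  rewrite linearZ /=.
  have fin : finsuppd (fun a => if a < 0 then c a (expcr mu (M - i + a) x) else 0).
    apply: (@finsuppd_int _ _ (absz (M - i))) => a ha; case: ltP => // a0.
    by rewrite expcr_neg ?linear0 //; lia.
  rewrite (sum_map (D := expcr lam i) (linear0 _) (linearD _) fin).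
  rewrite (sum_scale mu); last first.
    exact: (finsuppd_map (D := expcr lam i) (linear0 _) fin).
  apply: eq_sumT => a; rewrite /F2; case: ifP => _; last by rewrite linear0 scaler0.
  by rewrite -c_expcr.
rewrite (eq_sumT step) sum_add; [|exact: finsuppd_sum..].
rewrite [X in X + _](sum_exchange fin1) [X in _ + X](sum_exchange fin2).
rewrite -sum_add; [|exact: (finsuppd_sum (finsuppd_swap fin1))
                   |exact: (finsuppd_sum (finsuppd_swap fin2))].
rewrite expcr_rec (sum_scale (lam + mu)); last first.
  apply: (@finsuppd_int _ _ (absz M)) => a ha; case: ltP => // a0.
  by rewrite expcr_neg ?linear0 //; lia.
apply: eq_sumT => a; rewrite /F1 /F2; case: ltP => a0; last first.
  by rewrite !fsbig1 ?addr0 ?scaler0.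
rewrite scalerDl -IH; last by lia.
congr (_ + _).
  rewrite (sum_shift (- a)).
  rewrite (sum_map (D := fun u => lam *: c a u) _ _ (expcr_mul_finsuppd lam mu (M + a) x)).
  - apply: eq_sumT => i; rewrite subrK (_ : M - (i - a) = M + a - i) //; lia.
  - by rewrite linear0 scaler0.
  - by move=> u v; rewrite linearD scalerDr.
rewrite (sum_map (D := fun u => mu *: c a u) _ _ (expcr_mul_finsuppd lam mu (M + a) x)).
- apply: eq_sumT => i; rewrite (_ : M - i + a = M + a - i) //; lia.
- by rewrite linear0 scaler0.
- by move=> u v; rewrite linearD scalerDr.
Qed.

Lemma vertex_mul_finsuppd lam mu M x :
  finsuppd (fun i => vertex lam i (vertex mu (M - i) x)).
Proof.
have [N hN] := vertex_finite lam x; have [N' hN'] := vertex_finite mu x.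
apply: (@finsuppd_int _ _ (N + N' + absz M)) => i hi.
have [i0|i0] := ltP i 0; first by rewrite vertexC hN ?linear0 //; lia.
by rewrite hN' ?linear0 //; lia.
Qed.

Lemma vertex_expcr_vac lam mu i k :
  vertex lam i (expcr mu k vac) = expcr lam i (expcr mu k vac).
Proof.
have cV m u : m != 0 -> vertex lam i (c m u) = c m (vertex lam i u).
  by rewrite bosc_vertex.
have cE m u : m != 0 -> expcr lam i (c m u) = c m (expcr lam i u).
  by rewrite c_expcr.
by rewrite (expcr_comm (vertex_linear lam i) cV) vertex_vac
  (expcr_comm (expcr_linear lam i) cE).
Qed.

(** As <c, c> = 0, the vertex operators multiply without a power of a difference of variables, even
    at equal arguments. On the vacuum this is [expcr_mul], and for a creation mode d(k) the shifts
    by 2 lam and 2 mu add up. *)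
Lemma vertex_mul lam mu M x :
  \sum_(i \in [set: int]) vertex lam i (vertex mu (M - i) x) = vertex (lam + mu) M x.
Proof.
move: x M; apply: (modes_ind (z := fun=> 0)) => [b x y hx hy M|M|b k x k0 hx M|b k x k0 hx M].
- rewrite linearP /= -hx -hy.
  rewrite (sum_scale b (vertex_mul_finsuppd lam mu M x)).
  rewrite -sum_add; [|exact: (finsuppd_scale b (vertex_mul_finsuppd lam mu M x))|exact: vertex_mul_finsuppd].
  by apply: eq_sumT => j; rewrite !linearP.
- rewrite vertex_vac -expcr_mul; apply: eq_sumT => i.
  by rewrite vertex_vac vertex_expcr_vac.
- case: b => /=; last first.
    rewrite -bosc_vertex -hx.
    rewrite (sum_map (D := c k) (linear0 _) (linearD _) (vertex_mul_finsuppd lam mu M x)).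
    by apply: eq_sumT => i; rewrite !bosc_vertex.
  have nk : k != 0 by lia.
  have E (l : C) K u : vertex l K (bos 0 true k u) =
      bos 0 true k (vertex l K u) - (2%:R * l) *: vertex l (K - k) u.
    by rewrite bosd_vertex // addrK.
  rewrite E -!hx.
  rewrite (sum_map (D := bos 0 true k) (linear0 _) (linearD _) (vertex_mul_finsuppd lam mu M x)).
  rewrite -scaleNr.
  rewrite (sum_scale (- (2%:R * (lam + mu)))
    (vertex_mul_finsuppd lam mu (M - k) x)).
  have fin1 := finsuppd_map (D := bos 0 true k) (linear0 _) (vertex_mul_finsuppd lam mu M x).
  have fin2 (b : C) := finsuppd_scale b (vertex_mul_finsuppd lam mu (M - k) x).
  have split : \sum_(i \in [set: int]) - (2%:R * (lam + mu)) *: vertex lam i (vertex mu (M - k - i) x) =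
    \sum_(i \in [set: int]) - (2%:R * lam) *: vertex lam (i - k) (vertex mu (M - i) x) +
    \sum_(i \in [set: int]) - (2%:R * mu) *: vertex lam i (vertex mu (M - k - i) x).
    rewrite [X in _ = X + _](sum_shift k) -sum_add.
    - apply: eq_sumT => i; rewrite addrK (_ : M - (i + k) = M - k - i); last by lia.
      by mcoeffs; ring.
    - have [l hl] := fin2 (- (2%:R * lam)); exists l => i /hl.
      by rewrite addrK (_ : M - (i + k) = M - k - i) //; lia.
    - exact: fin2.
  have fin3 : finsuppd (fun i => - (2%:R * lam) *: vertex lam (i - k) (vertex mu (M - i) x)).
    have [l hl] := fin2 (- (2%:R * lam)); exists [seq i + k | i <- l] => i hi.
    rewrite (_ : M - i = M - k - (i - k)); last by lia.
    apply: hl; apply: contra hi => hi; apply/mapP; exists (i - k) => //.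
    by rewrite subrK.
  rewrite split -!sum_add //; [|exact: finsuppd_add].
  apply: eq_sumT => i; rewrite !E linearB linearZ /= E.
  rewrite (_ : M - i - k = M - k - i); last by lia.
  by mcoeffs; ring.
rewrite -fmo_vertex -hx.
rewrite (sum_map (D := fmo b k) (linear0 _) (linearD _) (vertex_mul_finsuppd lam mu M x)).
by apply: eq_sumT => i; rewrite !fmo_vertex.
Qed.

End VertexProduct.

(** * Screening operators *)

(* For p + 1 = 2 h: coefficient of z^m in Y(e^(c/2), z) and in Y(e^c, z). *)
Definition ehalf (C : numClosedFieldType) (h : nat) (m : int) : @Fock C -> @Fock C :=
  vertex (1 / 2%:R) (m + h%:Z).
Definition eone (C : numClosedFieldType) (h : nat) (m : int) : @Fock C -> @Fock C :=
  vertex 1 (m + (2 * h)%N%:Z).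

HB.lock Definition ascr (C : numClosedFieldType) (h : nat) (j : int) (x : @Fock C)
  : @Fock C := \sum_(k \in [set: int]) fmo true k (ehalf h (k - j) x).

HB.lock Definition Sscr (C : numClosedFieldType) (h : nat) (x : @Fock C) : @Fock C :=
  \sum_(i \in [set: int])
    (if 0 < i then (i%:~R)^-1 *: ascr h (- i) (ascr h i x) else 0).

Definition Gscr (C : numClosedFieldType) (h : nat) (x : @Fock C) : @Fock C :=
  eone h (- 1) x - Sscr h x.

Section Screening.
Context {C : numClosedFieldType}.
Variables (cL : C) (h : nat).
Local Notation p := (2%:R * h%:R - 1 : C).
Local Notation Fock := (@Fock C).
Implicit Types (x : Fock) (k m i j : int) (s : C).
Local Notation c := (@bos C (czero p) false).
Local Notation psi := (@fmo C true).
Local Notation half := (1 / 2%:R : C).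
Local Notation e := (@ehalf C h).
Local Notation e1 := (@eone C h).
Local Notation a := (@ascr C h).
Local Notation S := (@Sscr C h).
Local Notation GG := (@Gscr C h).

Lemma fmo_same b m n x : @fmo C b m (fmo b n x) = - fmo b n (fmo b m x).
Proof. by rewrite fmoC eqxx scale0r addr0. Qed.

Lemma ascr_finsuppd j x : finsuppd (fun k => psi k (e (k - j) x)).
Proof.
have [N hN] := vertex_finite half x; have [N' hN'] := modes_finite x.
apply: (@finsuppd_int _ _ (N + N' + h + absz j)) => k hk.
have [k0|k0] := ltP k 0; first by rewrite /ehalf hN ?linear0 //; lia.
by rewrite fmo_vertex; have [|_ ->] := hN' k; [lia | rewrite linear0].
Qed.

Lemma ascr_linear j : linear (a j).
Proof.
move=> b x y; rewrite ascr.unlock.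
rewrite (sum_scale b (ascr_finsuppd j x)).
rewrite -sum_add; [|exact: (finsuppd_scale b (ascr_finsuppd j x))|exact: ascr_finsuppd].
by apply: eq_sumT => k; rewrite /ehalf !linearP.
Qed.
HB.instance Definition _ j :=
  GRing.isLinear.Build C Fock Fock *:%R (a j) (ascr_linear j).

Lemma ascr_finite x : exists N : nat, forall j, N%:Z < j -> a j x = 0.
Proof.
have [N hN] := vertex_finite half x; have [N' hN'] := modes_finite x.
exists (N + N' + h)%N => j hj; rewrite ascr.unlock; apply: fsbig1 => k _.
have [k0|k0] := ltP N'%:Z k; last by rewrite /ehalf hN ?linear0 //; lia.
by rewrite fmo_vertex; have [_ ->] := hN' k k0; rewrite linear0.
Qed.

Section Commute.
Variable D : Fock -> Fock.
Hypothesis linD : linear D.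
Hypothesis hD : forall k x, k != 0 -> D (bos 0 false k x) = bos 0 false k (D x).

Lemma ehalf_comm m x : D (e m x) = e m (D x).
Proof. exact: vertex_comm. Qed.

Lemma eone_comm m x : D (e1 m x) = e1 m (D x).
Proof. exact: vertex_comm. Qed.

Let D0 : D 0 = 0.
Proof. exact: (linear_fun0 linD). Qed.
Let DD : {morph D : x y / x + y}.
Proof. exact: (linear_funD linD). Qed.
Let DZ (b : C) x : D (b *: x) = b *: D x.
Proof. exact: (linear_funZ linD). Qed.

Lemma ascr_comm j x : (forall k x, D (psi k x) = psi k (D x)) -> D (a j x) = a j (D x).
Proof.
move=> hp; rewrite ascr.unlock (sum_map D0 DD (ascr_finsuppd j x)).
by apply: eq_sumT => k; rewrite hp ehalf_comm.
Qed.

Lemma ascr_anticomm j x : (forall k x, D (psi k x) = - psi k (D x)) ->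
  D (a j x) = - a j (D x).
Proof.
move=> hp; rewrite ascr.unlock (sum_map D0 DD (ascr_finsuppd j x)).
rewrite [RHS](sum_map (D := fun u : Fock => - u) (oppr0 _) (@opprD _) (ascr_finsuppd j _)).
by apply: eq_sumT => k; rewrite hp ehalf_comm.
Qed.

Lemma Sscr_finsuppd x : finsuppd (fun i =>
  if 0 < i then (i%:~R)^-1 *: a (- i) (a i x) else 0).
Proof.
have [N hN] := ascr_finite x; apply: (@finsuppd_int _ _ N) => i hi.
by case: ltP => // i0; rewrite hN ?linear0 ?scaler0 //; lia.
Qed.

(** S is quadratic in the a_j, so a sign in passing them cancels. *)
Lemma Sscr_comm x : (forall j x, D (a j x) = a j (D x)) \/
  (forall j x, D (a j x) = - a j (D x)) -> D (S x) = S (D x).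
Proof.
move=> hp; rewrite Sscr.unlock (sum_map D0 DD (Sscr_finsuppd x)).
apply: eq_sumT => k; case: ifP => // _; rewrite DZ.
by case: hp => hp; rewrite !hp ?linearN ?opprK.
Qed.

Lemma Gscr_comm x : (forall j x, D (a j x) = a j (D x)) \/
  (forall j x, D (a j x) = - a j (D x)) -> D (GG x) = GG (D x).
Proof.
by move=> hp; rewrite /Gscr DD -scaleN1r DZ scaleN1r eone_comm Sscr_comm.
Qed.

End Commute.

Lemma Sscr_linear : linear S.
Proof.
move=> b x y; rewrite Sscr.unlock.
rewrite (sum_scale b (Sscr_finsuppd x)).
rewrite -sum_add; [|exact: (finsuppd_scale b (Sscr_finsuppd x))|exact: Sscr_finsuppd].
apply: eq_sumT => k; case: ifP => _; last by rewrite scaler0 addr0.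
by rewrite !linearP /=; mcoeffs; ring.
Qed.
HB.instance Definition _ :=
  GRing.isLinear.Build C Fock Fock *:%R S Sscr_linear.

Lemma Gscr_linear : linear GG.
Proof.
move=> b x y; rewrite /Gscr Sscr_linear /eone linearP /=; mcoeffs; ring.
Qed.
HB.instance Definition _ :=
  GRing.isLinear.Build C Fock Fock *:%R GG Gscr_linear.

Lemma ehalfC m n x : e m (e n x) = e n (e m x).
Proof. exact: vertexC. Qed.
Lemma psi_ehalf k m x : psi k (e m x) = e m (psi k x).
Proof. exact: fmo_vertex. Qed.

Lemma ascr_psi j k x : psi k (a j x) = - a j (psi k x).
Proof.
apply: (ascr_anticomm (fmo_linear _ _)) => [l y _|l y]; first by rewrite bos_fmo.
exact: fmo_same.
Qed.

Lemma ascr_c j k z x : bos z false k (a j x) = a j (bos z false k x).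
Proof.
apply: (ascr_comm (bos_linear _ _ _)) => [l y _|l y]; first exact: bosC_same.
exact: bos_fmo.
Qed.

Lemma ascr_ehalf j m x : e m (a j x) = a j (e m x).
Proof.
apply: (ascr_comm (vertex_linear _ _)) => l y; first by rewrite bosc_vertex.
by rewrite psi_ehalf.
Qed.

Lemma ascrC i j x : a i (a j x) = - a j (a i x).
Proof.
apply: (ascr_anticomm (ascr_linear _)) => l y; first by rewrite ascr_c.
by rewrite ascr_psi opprK.
Qed.

Lemma Gscr_c k z x : bos z false k (GG x) = GG (bos z false k x).
Proof.
apply: (Gscr_comm (bos_linear _ _ _)) => [l y _|]; first by rewrite bosC_same.
by left => j y; rewrite ascr_c.
Qed.

Lemma Gscr_psi k x : psi k (GG x) = GG (psi k x).
Proof.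
apply: (Gscr_comm (fmo_linear _ _)) => [l y _|]; first by rewrite bos_fmo.
by right => j y; rewrite ascr_psi.
Qed.

Lemma Gscr_ehalf m x : e m (GG x) = GG (e m x).
Proof.
apply: (Gscr_comm (vertex_linear _ _)) => [l y _|]; first by rewrite bosc_vertex.
by left => j y; rewrite -ascr_ehalf.
Qed.

Lemma Gscr_ascr i x : a i (GG x) = GG (a i x).
Proof.
apply: (Gscr_comm (ascr_linear _)) => [l y _|]; first by rewrite ascr_c.
by right => j y; rewrite ascrC.
Qed.

Lemma ascr_sq i x : a i (a i x) = 0.
Proof.
have /eqP := ascrC i i x.
rewrite -subr_eq0 opprK -mulr2n -scaler_nat scaler_eq0 pnatr_eq0 /=.
by move=> /eqP.
Qed.

End Screening.

(** * Commutators of G with the screening operators *)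

Section ScreeningRelations.
Context {C : numClosedFieldType}.
Variables (cL : C) (h : nat).
Local Notation p := (2%:R * h%:R - 1 : C).
Local Notation Fock := (@Fock C).
Implicit Types (x : Fock) (k m n i j : int) (s : C).
Local Notation c := (@bos C (czero p) false).
Local Notation psi := (@fmo C true).
Local Notation sq2 := (sqrtC 2%:R : C).
Local Notation half := (1 / 2%:R : C).
Local Notation e := (@ehalf C h).
Local Notation e1 := (@eone C h).
Local Notation a := (@ascr C h).
Local Notation S := (@Sscr C h).
Local Notation GG := (@Gscr C h).
Local Notation G s := (Gmode cL p s).

Lemma c_ehalf_finsuppd m x : finsuppd (fun j => c j (e (m + j) x)).
Proof.
have [N hN] := vertex_finite half x; have [N' hN'] := modes_finite x.
apply: (@finsuppd_int _ _ (N + N' + h + absz m)) => k hk.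
have [k0|k0] := ltP k 0; first by rewrite /ehalf hN ?linear0 //; lia.
rewrite /ehalf bosc_vertex; have [|-> _] := hN' k; [lia | by rewrite linear0].
Qed.

(** The shift by h in [ehalf] is compensated by the zero mode, c(0) / 2 being - h: once that mode is
    put back into the sum, m + h becomes m. *)
Lemma ehalf_rec m x :
  m%:~R *: e m x = half *: \sum_(j \in [set: int]) c j (e (m + j) x).
Proof.
pose f j := if j == 0 then 0 else bos 0 false j (e (m + j) x).
pose g j := if j == 0 then czero p *: e m x else 0.
have E j : c j (e (m + j) x) = f j + g j.
  rewrite /f /g; case: (j =P 0) => [->|/eqP j0]; first by rewrite bos0 addr0 add0r.
  by rewrite addr0 (bos_nz (czero p) 0).
have hf : finsuppd f.
  have [l hl] := c_ehalf_finsuppd m x; exists l => j /hl.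
  by rewrite /f; case: eqP => // /eqP j0; rewrite (bos_nz (czero p) 0).
rewrite (eq_sumT E) sum_add //; last first.
  by exists [:: 0] => j; rewrite inE /g => /negbTE ->.
rewrite (sum_single (f := g) (a := 0)) /g => [|j /negbTE -> //]; rewrite eqxx.
have := vertex_rec half (m + h%:Z) x.
rewrite (eq_sumT (g := f)); last first.
  by move=> j; rewrite /f /ehalf; case: eqP => // _; rewrite addrAC.
rewrite -[vertex _ _ _]/(e m x) rmorphD /= scalerDl scalerDr => <-.
by rewrite /czero -[h%:~R]/(h%:R); mcoeffs; field.
Qed.

Lemma bosd_vertex_zd lam s j M x :
  bos (dzero cL p (s + lam)) true j (vertex lam M x) =
  vertex lam M (bos (dzero cL p s) true j x) + (2%:R * lam) *: vertex lam (M - j) x.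
Proof.
have [->|j0] := eqVneq j 0; last first.
  by rewrite bosd_vertex // (bos_nz (dzero cL p (s + lam)) (dzero cL p s)).
by rewrite !bos0 linearZ /= subr0 /dzero; mcoeffs; ring.
Qed.

Lemma psi_vertex_finsuppd lam M x : finsuppd (fun k => psi k (vertex lam (M + k) x)).
Proof.
have [N hN] := vertex_finite lam x; have [N' hN'] := modes_finite x.
apply: (@finsuppd_int _ _ (N + N' + absz M)) => k hk.
have [k0|k0] := ltP k 0; first by rewrite hN ?linear0 //; lia.
rewrite fmo_vertex; have [|_ ->] := hN' k; [lia | by rewrite linear0].
Qed.

(** Of the terms of tau only d(-1) Psi^- fails to commute with the exponential, and its contraction
    leaves Psi^- times the same exponential. *)
Lemma G_vertex s lam n M x : G (s + lam) n (vertex lam M x) =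
  vertex lam M (G s n x) +
  (sq2 * lam) *: \sum_(k \in [set: int]) psi k (vertex lam (M - n + k) x).
Proof.
have hCP : nprod (fun=> 1) c (@fmo C false) 1 n (vertex lam M x) =
    vertex lam M (nprod (fun=> 1) c (@fmo C false) 1 n x).
  have z0 (u : Fock) k : 0 = ((k == 0)%:R * 0) *: u by rewrite mulr0 scale0r.
  rewrite (nprod_comm (Z := vertex lam M) (sA := 1) (sB := 1) (a := 0) (b := 0)
    (kA := 0) (kB := 0) (fun=> 1) (bos_linear _ _) (fmo_linear _)
    (bos_finite _ _) (fmo_finite _) n x (vertex_linear _ _)); [|..].
  - by mcoeffs; ring.
  - by move=> k y; rewrite -z0 addr0 scale1r bosc_vertex.
  - by move=> k y; rewrite -z0 addr0 scale1r fmo_vertex.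
  - by rewrite ?mulr0.
  - by rewrite ?mulr0.
have hDM : nprod (fun=> 1) (bos (dzero cL p (s + lam)) true) psi 1 n (vertex lam M x) =
    vertex lam M (nprod (fun=> 1) (bos (dzero cL p s) true) psi 1 n x) +
    (2%:R * lam) *: \sum_(k \in [set: int]) psi k (vertex lam (M - n + k) x).
  have fin0 := nprod_finsuppd (fun=> 1) 1 (bos_linear (dzero cL p s) true) (fmo_linear true)
    (bos_finite _ _) (fmo_finite _) n x.
  have fin1 := psi_vertex_finsuppd lam (M - n) x.
  rewrite nprod.unlock.
  rewrite (sum_map (D := vertex lam M) (linear0 _) (linearD _) fin0).
  rewrite (sum_scale (2%:R * lam) fin1).
  rewrite [X in _ = _ + X](sum_reflect n) -sum_add; last 2 first.
  - exact: (finsuppd_map (D := vertex lam M) (linear0 _) fin0).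
  - have [l hl] := fin1; exists [seq n - k | k <- l] => k hk.
    rewrite hl ?scaler0 //; apply: contra hk => hk; apply/mapP.
    by exists (n - k); rewrite ?subKr.
  apply: eq_sumT => k; rewrite !scale1r (_ : M - n + (n - k) = M - k); last by lia.
  case: ifP => _.
    by rewrite !fmo_vertex bosd_vertex_zd.
  by rewrite bosd_vertex_zd fmoD fmoZ fmo_vertex.
rewrite !Gmode.unlock hCP hDM !fmo_vertex !(vertexZ, vertexD).
by mcoeffs; field.
Qed.

Lemma G_ehalf s n m x : G (s + half) n (e m x) = e m (G s n x) + (sq2 / 2%:R) *: a (n - m) x.
Proof.
rewrite /ehalf G_vertex ascr.unlock; congr (_ + _ *: _); first by rewrite mul1r.
by apply: eq_sumT => k; rewrite /ehalf (_ : m + h%:Z - n + k = k - (n - m) + h%:Z) //; lia.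
Qed.

Lemma G_eone s n m x : G (s + 1) n (e1 m x) = e1 m (G s n x) +
  sq2 *: \sum_(k \in [set: int]) psi k (e1 (m - n + k) x).
Proof.
rewrite /eone G_vertex mulr1; congr (_ + _ *: _).
by apply: eq_sumT => k; rewrite (_ : m + (2 * h)%N%:Z - n + k = m - n + k + (2 * h)%N%:Z) //; lia.
Qed.

Let psi2 n x k l := psi k (psi l (e (l - (n - k)) x)).

Lemma psi_ascr_finsuppd n x : finsuppd (fun q : int * int => psi2 n x q.1 q.2).
Proof.
rewrite /psi2.
have [N hN] := vertex_finite half x; have [N' hN'] := modes_finite x.
apply: (@finsuppd_int2 _ (fun k l => psi k (psi l (e (l - (n - k)) x))) (N + 2 * N' + h + absz n)) => k l hkl.
have killed k' : N'%:Z < k' -> psi k' x = 0 by move=> /hN'[_ ->].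
have [k0|k0] := ltP N'%:Z k.
  by rewrite fmo_same psi_ehalf killed // /ehalf !(linear0, oppr0).
have [l0|l0] := ltP N'%:Z l; first by rewrite psi_ehalf killed // /ehalf !linear0.
by rewrite /ehalf hN ?linear0 //; lia.
Qed.

(* The summands psi_k psi_l E are antisymmetric in k and l. *)
Lemma psi_ascr_sum n x : \sum_(k \in [set: int]) psi k (a (n - k) x) = 0.
Proof.
rewrite -[RHS](@sum_antisym _ (psi2 n x) (psi_ascr_finsuppd n x)); last first.
  by move=> k l /=; rewrite /psi2 fmo_same (_ : l - (n - k) = k - (n - l)) //; lia.
apply: eq_sumT => k; rewrite ascr.unlock.
by rewrite (sum_map (D := psi k) (linear0 _) (linearD _) (ascr_finsuppd h (n - k) x)).
Qed.

(** In generating form, {G(n + 1/2), a(z)} is sqrt 2 times the derivative of z^(n+1) Y(e^(c/2), z).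
    This explains the factor - j, and why the residue Q = a_0 anticommutes with G. *)
Lemma G_ascr s n j x : G (s + half) n (a j x) = - a j (G s n x) -
  (sq2 * j%:~R) *: e (- n - 1 - j) x.
Proof.
rewrite ascr.unlock.
rewrite (sum_map (D := G (s + half) n) (linear0 _) (linearD _) (ascr_finsuppd h j x)).
pose F1 k := - psi k (e (k - j) (G s n x)).
pose F2 k := - (sq2 / 2%:R) *: psi k (a (n + j - k) x).
pose F3 k := (sq2 / 2%:R) *: c (n + k + 1) (e (k - j) x).
pose F4 k := if k == - n - 1 then (sq2 * (n%:~R + 1)) *: e (- n - 1 - j) x else 0.
(* F2 comes from [G, E] and sums to 0 by [psi_ascr_sum]. F3 and F4 come from {G, Psi^-}, and
   [ehalf_rec] evaluates the sum of F3. *)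
have step k : G (s + half) n (psi k (e (k - j) x)) = F1 k + F2 k + (F3 k + F4 k).
  rewrite Gmode_psim G_ehalf fmoD fmoZ (_ : n - (k - j) = n + j - k); last by lia.
  rewrite /F1 /F2 /F3 /F4 (_ : (n + k + 1 == 0) = (k == - n - 1)); last by lia.
  by case: (k =P - n - 1) => [->|_] /=; mcoeffs; field.
have f1 : finsuppd F1.
  exact: (finsuppd_map (D := fun u : Fock => - u) (oppr0 _) (ascr_finsuppd h j (G s n x))).
have g2 : finsuppd (fun k => psi k (a (n + j - k) x)).
  have [l hl] := @finsuppd_sum _ _ _ (psi2 (n + j) x) (psi_ascr_finsuppd (n + j) x); exists l => k /hl <-.
  rewrite {1}ascr.unlock.
  by rewrite (sum_map (D := psi k) (linear0 _) (linearD _) (ascr_finsuppd h _ x)).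
have f2 : finsuppd F2.
  exact: (finsuppd_scale (- (sq2 / 2%:R)) g2).
have g3 : finsuppd (fun k => c (n + k + 1) (e (k - j) x)).
  have [l hl] := c_ehalf_finsuppd (- n - 1 - j) x.
  exists [seq i - n - 1 | i <- l] => k hk.
  rewrite (_ : k - j = - n - 1 - j + (n + k + 1)); last by lia.
  apply: hl; apply: contra hk => hk; apply/mapP; exists (n + k + 1) => //.
  by lia.
have f3 : finsuppd F3.
  exact: (finsuppd_scale (sq2 / 2%:R) g3).
have f4 : finsuppd F4.
  by exists [:: - n - 1] => k; rewrite inE /F4 => /negbTE ->.
rewrite (eq_sumT step) !sum_add //; try exact: finsuppd_add.
rewrite -(sum_map (D := fun u : Fock => - u) (oppr0 _) (@opprD _) (ascr_finsuppd h j (G s n x))).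
rewrite -(sum_scale (- (sq2 / 2%:R)) g2).
rewrite psi_ascr_sum scaler0 addr0.
rewrite -(sum_scale (sq2 / 2%:R) g3).
rewrite (sum_single (f := F4) (a := - n - 1)) /F4 => [|k /negbTE -> //]; rewrite eqxx.
congr (_ + _); have hT := ehalf_rec (- n - 1 - j) x.
have ET : \sum_(i \in [set: int]) c i (e (- n - 1 - j + i) x) =
    \sum_(k \in [set: int]) c (n + k + 1) (e (k - j) x).
  rewrite (sum_shift (n + 1)); apply: eq_sumT => k.
  by congr (c _ (e _ _)); lia.
move: hT; rewrite ET; set T := \sum_(k \in _) _ => hT.
have -> : (sq2 / 2%:R) *: T = sq2 *: ((- n - 1 - j)%:~R *: e (- n - 1 - j) x).
  by rewrite hT; mcoeffs; field.
by rewrite !rmorphB rmorphN /=; mcoeffs; ring.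
Qed.

Lemma ea_finsuppd n x : finsuppd (fun i => e (i - n - 1) (a i x)).
Proof.
have [N hN] := vertex_finite half x; have [N' hN'] := ascr_finite h x.
apply: (@finsuppd_int _ _ (N + N' + h + absz n)) => i hi.
have [i0|i0] := ltP i 0; last by rewrite hN' /ehalf ?linear0 //; lia.
by rewrite ascr_ehalf /ehalf hN ?linear0 //; lia.
Qed.

(** Both sides are coefficients of Y(e^(c/2), z) a(z) = Psi^-(z) Y(e^c, z), the two half
    exponentials multiplying to the full one. *)
Lemma sum_ea n x : \sum_(i \in [set: int]) e (i - n - 1) (a i x) =
  \sum_(k \in [set: int]) psi k (e1 (k - n - 1) x).
Proof.
have [N hN] := vertex_finite half x; have [N' hN'] := modes_finite x.
pose F i k := psi k (e (i - n - 1) (e (k - i) x)).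
have fin : finsuppd (fun q : int * int => F q.1 q.2).
  apply: (@finsuppd_int2 _ _ (N + N + N' + h + h + absz n)) => i k hik; rewrite /F.
  have [k0|k0] := ltP N'%:Z k.
    by rewrite !psi_ehalf /ehalf; have [_ ->] := hN' k k0; rewrite !linear0.
  have [i0|i0] := ltP (i - n - 1 + h%:Z) (- N%:Z).
    by rewrite ehalfC {2}/ehalf hN // /ehalf !linear0.
  by rewrite {2}/ehalf hN ?/ehalf ?linear0 //; lia.
transitivity (\sum_(i \in [set: int]) \sum_(k \in [set: int]) F i k).
  apply: eq_sumT => i; rewrite ascr.unlock.
  rewrite (sum_map (D := e (i - n - 1)) (linear0 _) (linearD _) (ascr_finsuppd h i x)).
  by apply: eq_sumT => k; rewrite /F -psi_ehalf.
rewrite (@sum_exchange _ _ _ F fin); apply: eq_sumT => k.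
rewrite /F /eone (_ : 1 = half + half); last by field.
rewrite -vertex_mul (sum_map (D := psi k) (linear0 _) (linearD _)
  (vertex_mul_finsuppd _ _ _ _)).
rewrite [RHS](sum_shift (- n - 1 + h%:Z)).
apply: eq_sumT => i; rewrite /ehalf; congr (psi k (vertex _ _ (vertex _ _ _))); lia.
Qed.

(** [G, S] reproduces [G, e^c_0] except for the term i = 0 of [sum_ea], as S has no summand i = 0.
    In the difference e^c_0 - S only that term survives. *)
Lemma G_Gscr s n x : G (s + 1) n (GG x) = GG (G s n x) + sq2 *: e (- n - 1) (a 0 x).
Proof.
have Ss : G (s + 1) n (S x) = S (G s n x) +
    sq2 *: (\sum_(k \in [set: int]) psi k (e1 (k - n - 1) x) - e (- n - 1) (a 0 x)).
  rewrite Sscr.unlock (sum_map (D := G (s + 1) n) (linear0 _) (linearD _) (Sscr_finsuppd h x)).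
  (* Up to sqrt 2, the i-th summand of S yields F i and F (- i), its factor 1 / i cancelling the
     factor j of [G_ascr]. Together these exhaust the sum of F apart from F 0. *)
  pose F k := e (k - n - 1) (a k x).
  have fF : finsuppd F := ea_finsuppd n x.
  pose F1 k := if 0 < k then F k else 0.
  pose F2 k := if 0 < k then F (- k) else 0.
  pose F0 k := if k == 0 then F 0 else 0.
  have f1 : finsuppd F1.
    by have [l hl] := fF; exists l => k /hl h0; rewrite /F1 h0 if_same.
  have f2 : finsuppd F2.
    have [l hl] := fF; exists [seq - k | k <- l] => k hk; rewrite /F2.
    case: ifP => // _; apply: hl; apply: contra hk => hk; apply/mapP.
    by exists (- k); rewrite ?opprK.
  have f0 : finsuppd F0.
    by exists [:: 0] => k; rewrite inE /F0 => /negbTE ->.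
  have -> : \sum_(k \in [set: int]) psi k (e1 (k - n - 1) x) - e (- n - 1) (a 0 x) =
      \sum_(k \in [set: int]) (F1 k + F2 k).
    rewrite -sum_ea (_ : e (- n - 1) (a 0 x) = F 0); last by rewrite /F sub0r.
    have E k : F k = F1 k + (if k < 0 then F k else 0) + F0 k.
      rewrite /F1 /F0; case: ltgtP => [k0|k0|->]; rewrite ?add0r ?addr0 //.
    have f3 : finsuppd (fun k => if k < 0 then F k else 0).
      by have [l hl] := fF; exists l => k /hl ->; rewrite if_same.
    rewrite (eq_sumT E) sum_add //; last exact: finsuppd_add.
    rewrite (sum_single (f := F0) (a := 0)) /F0 => [|k /negbTE -> //]; rewrite eqxx.
    by rewrite addrK sum_add // sum_neg_pos sum_add.
  rewrite (sum_scale sq2); last first.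
    exact: finsuppd_add.
  rewrite -sum_add; [|exact: Sscr_finsuppd|]; last first.
    exact: (finsuppd_scale sq2 (finsuppd_add f1 f2)).
  apply: eq_sumT => i; rewrite /F1 /F2 /F; case: ltP => i0; last first.
    by rewrite linear0 addr0 add0r scaler0.
  have -> : s + 1 = s + half + half by field.
  have aB j' u v (b : C) : a j' (- u - b *: v) = - a j' u - b *: a j' v.
    by rewrite linearB linearN linearZ.
  rewrite GmodeZ !G_ascr aB -ascr_ehalf.
  have nz : i%:~R != 0 :> C by rewrite intr_eq0; lia.
  rewrite !rmorphN /= opprK (_ : - n - 1 - i = - i - n - 1); last by lia.
  rewrite (_ : - n - 1 + i = i - n - 1); last by lia.
  by mcoeffs; field.
rewrite /Gscr GmodeD GmodeN Ss G_eone.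
rewrite (eq_sumT (g := fun k => psi k (e1 (k - n - 1) x))); last first.
  by move=> k; rewrite (_ : -1 - n + k = k - n - 1) //; lia.
by mcoeffs; ring.
Qed.

End ScreeningRelations.

(** * Identification of the screening operators with their models *)

Section Interpretation.
Context {C : numClosedFieldType}.
Variables (cL : C) (h : nat).
Local Notation p := (2%:R * h%:R - 1 : C).
Local Notation Fock := (@Fock C).
Implicit Types (x : Fock) (k m n i j : int) (s lam : C).

Lemma crmode_osc lam s :
  (fun (n : nat) (u : Fock) => (lam / n%:R) *: osc cL p false (s := s) (- n%:Z) u) = crmode lam.
Proof.
apply/funext => -[|n]; apply/funext => u.
  by rewrite crmode0 mulr0n invr0 mulr0 scale0r.
by rewrite osc_bos /crmode (bos_nz _ 0).
Qed.

Lemma anmode_osc lam s :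
  (fun (n : nat) (u : Fock) => - (lam / n%:R) *: osc cL p false (s := s) n%:Z u) = anmode lam.
Proof.
apply/funext => -[|n]; apply/funext => u.
  by rewrite anmode0 mulr0n invr0 mulr0 oppr0 scale0r.
by rewrite osc_bos /anmode (bos_nz _ 0).
Qed.

(** Under the hypothesis z^(gamma(0)) is z^(- H), so the pairs (i, j) in [Yexp] are those with i = m
    + H + j. They are parametrised by j, and the remaining integers contribute zero terms to
    [vertex]. *)
Lemma Yexp_vertex lam s m x (H : nat) : lam * (p + 1) = H%:R ->
  Yexp cL p lam (s := s) m x = vertex lam (m + H%:Z) x.
Proof.
move=> hH; rewrite /Yexp /shift crmode_osc anmode_osc.
have zero : cdform (lam *: cvec) (weight cL p s) = - H%:R :> C.
  rewrite -hH /cdform /weight /dbar /cvec /dvec /=.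
  by rewrite /GRing.scale /=; field.
set P := [set _ | _]%classic.
have PE (i j : nat) : P (i, j) <-> i%:Z = m + H%:Z + j%:Z.
  rewrite /P /= zero; split=> E.
    apply: (@intr_inj C); rewrite !rmorphD /= -E.
    by rewrite -[i%:~R]/(i%:R) -[j%:~R]/(j%:R) -[H%:~R]/(H%:R); ring.
  have -> : i%:R = (m + H%:Z + j%:Z)%:~R :> C by rewrite -E.
  by rewrite !rmorphD /= -[j%:~R]/(j%:R) -[H%:~R]/(H%:R); ring.
pose P' : set int := [set k | 0 <= k /\ 0 <= m + H%:Z + k]%classic.
pose f (k : int) := (absz (m + H%:Z + k), absz k).
rewrite (reindex_fsbig f P' P); last first.
  split.
  - by move=> k [k0 k1]; apply/PE; lia.
  - move=> k l; rewrite !inE => -[k0 k1] [l0 l1] [_ E]; lia.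
  - move=> [i j] /PE E; exists j%:Z; first by split; lia.
    by rewrite /f /=; congr pair; lia.
pose F k := expcr lam (m + H%:Z + k) (expan lam k x).
rewrite (eq_fsbigr F); last first.
  move=> k; rewrite inE => -[k0 k1]; rewrite /F expcr.unlock expan.unlock /f /=.
  by case: (m + H%:Z + k) k1 => // i _; case: k k0.
rewrite (fsbig_widen P' [set: int]) ?vertex.unlock // => k [_ /= hk].
rewrite /F; have [k0|k0] := ltP k 0; first by rewrite expan_neg ?linear0.
rewrite expcr_neg // ltNge; apply/negP => k1; exact: hk.
Qed.

Lemma amode_ascr s j x : amode cL p (s := s) j x = ascr h j x.
Proof.
rewrite /amode ascr.unlock; apply: eq_sumT => k.
rewrite (@Yexp_vertex _ _ _ _ h) ?fer_fmo //.
by field.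
Qed.

Lemma Qop_ascr s x : Qop cL p (s := s) x = ascr h 0 x.
Proof. exact: amode_ascr. Qed.

Lemma Sop_Sscr s x : Sop cL p (s := s) x = Sscr h x.
Proof.
rewrite /Sop Sscr.unlock.
pose F (k : int) := (k%:~R)^-1 *: ascr h (- k) (ascr h k x) : Fock.
rewrite (eq_fsbigr (fun i : nat => F i%:Z)); last first.
  by move=> i _; rewrite /F !amode_ascr.
rewrite -(fsbig_image [set i : nat | (0 < i)%N]%classic Posz F); last first.
  by move=> i j _ _ [].
have -> : [set Posz x | x in [set i | (0 < i)%N]]%classic = [set k : int | 0 < k]%classic.
  apply/seteqP; split => [k [i i0 <-]|[k|k] k0] //=; by exists k.
rewrite fsbig_mkcond; apply: eq_sumT => k; rewrite /patch.
case: ltP => k0; first by rewrite mem_set.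
by rewrite memNset //= => k1; lia.
Qed.

Lemma scrG_Gscr s x : scrG cL p (s := s) x = Gscr h x.
Proof.
rewrite /scrG /Gscr Sop_Sscr (@Yexp_vertex _ _ _ _ (2 * h)) //.
by rewrite natrM; ring.
Qed.

Lemma scrG_iter_Gscr s (n : nat) x : scrG_iter cL p (s := s) n x = iter n (Gscr h) x.
Proof. by elim: n => //= n IH; rewrite scrG_Gscr IH. Qed.

End Interpretation.

(** * Singular and subsingular vectors *)

Section LeadingTerm.
Context {C : numClosedFieldType}.
Variables (h : nat).
Hypothesis h0 : (0 < h)%N.
Local Notation Fock := (@Fock C).
Local Notation vac := (ket C vac0).
Implicit Types (x : Fock) (k : int) (lam : C).
Local Notation c := (@bos C 0 false).
Local Notation psi := (@fmo C true).
Local Notation a := (@ascr C h).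
Local Notation S := (@Sscr C h).
Local Notation GG := (@Gscr C h).

(** The screening operators are made of modes of c and Psi^-, which commute or anticommute with each
    other, so they preserve this condition; on such vectors the annihilating exponential is the
    identity. *)
Definition killed x := (forall k, 0 < k -> c k x = 0) /\ (forall k, 0 <= k -> psi k x = 0).

(* [lead K] is c(-1)^K Psi^-(-h+1/2) v. *)
Definition lead (K : nat) : state := ([fsfun [fsfun] with (false, 0%N) |-> K], [fset (true, h.-1)]%fset).

Definition lead_shape (s : state) := (forall i, i != (false, 0%N) -> s.1 i = 0%N) /\
  (forall i, i \in s.2 -> i = (true, h.-1)).

(* The vectors that do not contribute to the coefficient of any [lead K],
   nor to that of any power c(-1)^K v. *)
Definition negl x := killed x /\ forall s, lead_shape s -> x@_s = 0.

Lemma killed_lin (b : C) x y : killed x -> killed y -> killed (b *: x + y).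
Proof.
move=> [x1 x2] [y1 y2]; split=> k hk; rewrite linearP /=.
  by rewrite x1 ?y1 ?scaler0 ?addr0.
by rewrite x2 ?y2 ?scaler0 ?addr0.
Qed.

Lemma killed0 : killed 0.
Proof. by split=> k hk; rewrite linear0. Qed.

Lemma negl0 : negl 0.
Proof. by split; [exact: killed0 | move=> s _; rewrite mcoeff0]. Qed.

Lemma negl_lin (b : C) x y : negl x -> negl y -> negl (b *: x + y).
Proof.
move=> [x1 x2] [y1 y2]; split; first exact: killed_lin.
by move=> s hs; rewrite mcoeffD mcoeffZ x2 ?y2 // mulr0 addr0.
Qed.

Lemma neglD x y : negl x -> negl y -> negl (x + y).
Proof. by move=> hx hy; rewrite -(scale1r x); apply: negl_lin. Qed.
Lemma neglZ b x : negl x -> negl (b *: x).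
Proof. by move=> hx; rewrite -[b *: x]addr0; apply: negl_lin => //; apply: negl0. Qed.

Lemma negl_sum (T : choiceType) (f : T -> Fock) : (forall b, negl (f b)) ->
  negl (\sum_(b \in [set: T]) f b).
Proof. by move=> hf; apply: sum_ind => //; [exact: negl0 | exact: neglD]. Qed.

Lemma killed_c k x : killed x -> killed (c k x).
Proof.
move=> [x1 x2]; split=> l hl; first by rewrite bosC_same x1 ?linear0.
by rewrite -bos_fmo x2 ?linear0.
Qed.

Lemma killed_psi k x : killed x -> killed (psi k x).
Proof.
move=> [x1 x2]; split=> l hl; first by rewrite bos_fmo x1 ?linear0.
by rewrite fmo_same x2 // linear0 oppr0.
Qed.

Lemma mcoeff_bcreate i x s : (bcreate i x)@_s =
  if s.1 i is n.+1 then x@_([fsfun s.1 with i |-> n], s.2) else 0.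
Proof.
elim/(@state_ind C): x => [b x y hx hy|t].
  rewrite linearP /= !mcoeffD !mcoeffZ hx hy.
  by case: (s.1 i) => [|n]; rewrite ?mulr0 ?addr0 // mcoeffD mcoeffZ.
rewrite bcreateE mcoeff_state; case: eqP => [<-|hs].
  rewrite /= fsfun_with mcoeff_state fsfun_with2 fsfun_with_id.
  by rewrite -surjective_pairing eqxx.
case E : (s.1 i) => [|n] //; rewrite mcoeff_state; case: eqP => // ts.
case: hs; rewrite ts /= fsfun_with fsfun_with2 -E fsfun_with_id.
by rewrite -surjective_pairing.
Qed.

Lemma mcoeff_fcreate i x s : (fcreate i x)@_s =
  if i \in s.2 then fsign i s.2 * x@_(s.1, (s.2 `\ i)%fset) else 0.
Proof.
elim/(@state_ind C): x => [b x y hx hy|t].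
  rewrite linearP /= !mcoeffD !mcoeffZ hx hy.
  by case: ifP => _; rewrite ?(mcoeffD, mcoeffZ); ring.
rewrite fcreateE; case: ifPn => ti.
  rewrite mcoeff0; case: ifPn => // si; rewrite mcoeff_state.
  case: eqP => [ts|_]; last by rewrite mulr0.
  by move: ti; rewrite ts /= !inE eqxx.
rewrite mcoeffZ !mcoeff_state; case: eqP => [<-|hs].
  rewrite /= !inE eqxx /= fsetU1K // -surjective_pairing eqxx.
  by rewrite fsignU // mode_ltxx mul1r.
rewrite mulr0; case: ifPn => // si; case: eqP => [ts|_]; last by rewrite mulr0.
by case: hs; rewrite ts /= fsetD1K // -surjective_pairing.
Qed.

Lemma negl_c k x : k < 0 -> negl x -> negl (c k x).
Proof.
move=> k0 [hx xs]; split; first exact: killed_c.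
move=> s [s1 s2]; rewrite bos.unlock; case: k k0 => // k _.
rewrite mcoeff_bcreate; case E : (s.1 _) => [|n] //; apply: xs; split=> // i hi /=.
by rewrite fsfun_withE; case: eqP => [ik|_]; [move: E; rewrite -ik s1 | exact: s1].
Qed.

Lemma negl_c_deep k x : k < -1 -> killed x -> negl (c k x).
Proof.
move=> k0 hx; split; first exact: killed_c.
move=> s [s1 s2]; rewrite bos.unlock; case: k k0 => // k k0.
rewrite mcoeff_bcreate s1 // xpair_eqE /=; lia.
Qed.

Lemma negl_psi k x : k < 0 -> negl x -> negl (psi k x).
Proof.
move=> k0 [hx xs]; split; first exact: killed_psi.
move=> s [s1 s2]; rewrite fmo.unlock; case: k k0 => //= k _.
rewrite mcoeff_fcreate; case: ifP => // _; rewrite xs ?mulr0 //.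
by split=> // i; rewrite !inE => /andP[_ /s2].
Qed.

Lemma negl_psi_other k x : k < 0 -> k != - h%:Z -> killed x -> negl (psi k x).
Proof.
move=> k0 kh hx; split; first exact: killed_psi.
move=> s [s1 s2]; rewrite fmo.unlock; case: k k0 kh => //= k _ kh.
rewrite mcoeff_fcreate; case: ifP => // /s2 [kE]; lia.
Qed.

Lemma killed_expan lam k x : killed x -> k != 0 -> expan lam k x = 0.
Proof.
move=> [x1 _]; elim/exp_coefz_ind: k => [k k0 _|//|k k0 IH _]; first exact: expan_neg.
apply: (@scale_int_inj _ k); first by lia.
rewrite expan_rec scaler0 fsbig1 ?scaler0 // => b _; case: ltP => // b0.
have [kb|kb|kb] := ltgtP k b.
- by rewrite expan_neg ?linear0 //; lia.
- by rewrite IH ?linear0 //; lia.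
by rewrite kb subrr expan0 x1.
Qed.

Lemma killed_vertex lam M x : killed x -> vertex lam M x = expcr lam M x.
Proof.
move=> hx; rewrite vertex.unlock (sum_single (a := 0)) ?addr0 ?expan0 // => k k0.
by rewrite killed_expan ?linear0.
Qed.

Lemma killed_expcr lam M x : killed x -> killed (expcr lam M x).
Proof.
move=> [x1 x2]; split=> k hk; first by rewrite c_expcr x1 ?linear0.
rewrite (expcr_comm (fmo_linear _ _)) ?x2 ?linear0 // => m u _.
by rewrite bos_fmo.
Qed.

Lemma negl_expcr lam M x : negl x -> negl (expcr lam M x).
Proof.
move=> hx; elim/exp_coefz_ind: M => [M M0||M M0 IH].
- by rewrite expcr_neg //; apply: negl0.
- by rewrite expcr0.
have -> : expcr lam M x = (M%:~R)^-1 *: (M%:~R *: expcr lam M x).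
  by rewrite scalerA mulVf ?scale1r // intr_eq0; lia.
rewrite expcr_rec; apply: neglZ; apply: neglZ; apply: negl_sum => b.
case: ltP => hb; last exact: negl0.
by apply: negl_c => //; apply: IH; lia.
Qed.

Lemma negl_vertex lam M x : negl x -> negl (vertex lam M x).
Proof. by move=> hx; rewrite killed_vertex; [exact: negl_expcr | case: hx]. Qed.

Lemma negl_ascr j x : negl x -> negl (a j x).
Proof.
move=> hx; rewrite ascr.unlock; apply: negl_sum => k.
have [k0|k0] := ltP k 0; first by apply: negl_psi => //; apply: negl_vertex.
have [[_ H] _] := negl_vertex (1 / 2%:R) (k - j + h%:Z) hx.
by rewrite /ehalf H //; exact: negl0.
Qed.

Lemma negl_Sscr x : (forall j, negl (a j x)) -> negl (S x).
Proof.
move=> hx; rewrite Sscr.unlock; apply: negl_sum => i.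
by case: ifP => _; [apply: neglZ; apply: negl_ascr | exact: negl0].
Qed.

Lemma negl_Gscr x : negl x -> negl (GG x).
Proof.
move=> hx; rewrite /Gscr -scaleN1r; apply: neglD; first exact: negl_vertex.
by apply: neglZ; apply: negl_Sscr => j; apply: negl_ascr.
Qed.

Local Notation y K := (ket C (lead K)).

Lemma killed_lead K : killed (y K).
Proof.
split=> k hk.
  rewrite bos.unlock; case: k hk => // -[|k] // _.
  by rewrite bannihE /= fsfun_withE fsfun0E !scale0r scaler0.
by rewrite fmo.unlock; case: k hk => // k _ /=; rewrite fannihE !inE.
Qed.

Lemma killed_vac : killed vac.
Proof. by split=> k hk; [exact: bos_vac | exact: fmo_vac]. Qed.

Lemma c_lead K : c (-1) (y K) = y K.+1.
Proof.
rewrite bos.unlock; change (bcreate (false, 0%N) (y K) = y K.+1).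
by rewrite bcreateE /= fsfun_with fsfun_with2.
Qed.

Lemma psi_lead k K : negl (psi k (y K)).
Proof.
have [k0|k0] := leP 0 k.
  by have [_ ->] := killed_lead K; [exact: negl0 | ].
have [->|kh] := eqVneq k (- h%:Z); last by apply: negl_psi_other => //; apply: killed_lead.
rewrite fmo.unlock (_ : - h%:Z = Negz h.-1) /=; last by rewrite NegzE prednK.
by rewrite fcreateE /= !inE eqxx; apply: negl0.
Qed.

Lemma ascr_lead j K : negl (a j (y K)).
Proof.
rewrite ascr.unlock; apply: negl_sum => k.
by rewrite psi_ehalf; apply: negl_vertex; apply: psi_lead.
Qed.

(** Only the term c(-1) z of the exponent leads from one leading state to another, and it
    contributes c(-1)^M / M!. *)
Lemma expcr_lead (M K : nat) :
  negl (expcr 1 M%:Z (y K) - (M`!%:R)^-1 *: y (K + M)).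
Proof.
have [n] := ubnP M; elim: n M => // n IH [|M] hM.
  by rewrite expcr0 invr1 scale1r addn0 subrr; apply: negl0.
have -> : expcr 1 M.+1%:Z (y K) - (M.+1`!%:R)^-1 *: y (K + M.+1) =
    (M.+1%:R)^-1 *: (M.+1%:Z%:~R *: expcr 1 M.+1%:Z (y K) - (M`!%:R)^-1 *: y (K + M.+1)).
  rewrite -[M.+1%:~R]/(M.+1%:R) factS natrM.
  have nz : M.+1%:R != 0 :> C by rewrite pnatr_eq0.
  have nz' : M`!%:R != 0 :> C by rewrite pnatr_eq0 -lt0n fact_gt0.
  by move: nz nz'; move: (M.+1%:R : C) (M`!%:R : C) => b b' nz nz'; mcoeffs; field; rewrite nz nz'.
apply: neglZ; rewrite expcr_rec scale1r.
pose f (b : int) := if b < 0 then c b (expcr 1 (M.+1%:Z + b) (y K)) else 0.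
have ff : finsuppd f.
  apply: (@finsuppd_int _ _ M.+1) => b hb; rewrite /f; case: ltP => // b0.
  by rewrite expcr_neg ?linear0 //; lia.
(* g places the subtracted leading term in the summand b = -1, where the induction hypothesis
   applies; modes below -1 give negligible vectors. *)
pose g (b : int) := if b == -1 then - (M`!%:R)^-1 *: y (K + M.+1) else 0.
have -> : - ((M`!%:R)^-1 *: y (K + M.+1)) = \sum_(b \in [set: int]) g b.
  by rewrite (sum_single (a := -1)) /g ?eqxx ?scaleNr // => b /negbTE ->.
rewrite -sum_add //; last by exists [:: -1] => b; rewrite inE /g => /negbTE ->.
apply: negl_sum => b; rewrite /f /g; case: (b =P -1) => [->|b1].
  rewrite ltrN10 (_ : M.+1%:Z + -1 = M%:Z); last by lia.
  rewrite addnS -c_lead -linearZ /= -linearD /=; apply: negl_c => //.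
  by rewrite scaleNr; apply: IH; lia.
rewrite addr0; case: ltP => b0; last exact: negl0.
by apply: negl_c_deep; [lia | apply: killed_expcr; apply: killed_lead].
Qed.

(** e^c_0 contributes the exponential in degree -1 + 2 h = p. S contributes nothing: a_j could reach
    a leading state only through Psi^-(-h + 1/2), which is already occupied. *)
Lemma Gscr_lead K : negl (GG (y K) - ((2 * h).-1`!%:R)^-1 *: y (K + (2 * h).-1)).
Proof.
rewrite /Gscr addrAC; apply: neglD.
  rewrite /eone killed_vertex; last exact: killed_lead.
  rewrite (_ : -1 + (2 * h)%N%:Z = (2 * h).-1%:Z); last by lia.
  exact: expcr_lead.
by rewrite -scaleN1r; apply: neglZ; apply: negl_Sscr => j; apply: ascr_lead.
Qed.

(** For k = - h the exponential has degree 0 and leaves Psi^-(-h + 1/2) v; any other k occupies a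
    different mode of Psi^- or vanishes. *)
Lemma ascr0_vac : negl (a 0 vac - y 0).
Proof.
rewrite ascr.unlock.
pose g k := if k == - h%:Z then - y 0 else 0.
have -> : - y 0 = \sum_(k \in [set: int]) g k.
  by rewrite (sum_single (a := - h%:Z)) /g ?eqxx // => b /negbTE ->.
rewrite -sum_add; [|exact: ascr_finsuppd|]; last first.
  by exists [:: - h%:Z] => b; rewrite inE /g => /negbTE ->.
apply: negl_sum => k; rewrite /g /ehalf killed_vertex ?subr0; last exact: killed_vac.
case: (k =P - h%:Z) => [->|/eqP kh].
  rewrite addNr expcr0 fmo.unlock (_ : - h%:Z = Negz h.-1) /=; last by rewrite NegzE prednK.
  rewrite fcreateE /= /fsign.
  have -> : [fset j in fset0 | mode_lt j (true, h.-1)]%fset = fset0.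
    by apply/fsetP => j; rewrite !inE.
  rewrite cardfs0 expr0 scale1r fsetU0 /lead.
  have -> : [fsfun [fsfun] with (false, 0%N) |-> 0%N] = [fsfun] :> {fsfun bool * nat -> nat with 0%N}.
    by apply/fsfunP => i; rewrite fsfun_withE fsfun0E if_same.
  by rewrite subrr; apply: negl0.
rewrite addr0; have [k0|k0] := ltP k 0.
  by apply: negl_psi_other => //; apply: killed_expcr; apply: killed_vac.
have [_ H] := killed_expcr (1 / 2%:R) (k + h%:Z) killed_vac.
by rewrite H //; exact: negl0.
Qed.

Lemma iter_Gscr_lead (n : nat) : negl (iter n GG (a 0 vac) -
  ((2 * h).-1`!%:R)^-1 ^+ n *: y (n * (2 * h).-1)).
Proof.
elim: n => [|n IH] /=; first by rewrite expr0 scale1r mul0n; exact: ascr0_vac.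
set q := ((2 * h).-1`!%:R)^-1 : C; set w := iter n GG (a 0 vac).
have -> : GG w - q ^+ n.+1 *: y (n.+1 * (2 * h).-1) =
   GG (w - q ^+ n *: y (n * (2 * h).-1)) +
   q ^+ n *: (GG (y (n * (2 * h).-1)) - q *: y (n * (2 * h).-1 + (2 * h).-1)).
  have -> : (n.+1 * (2 * h).-1 = n * (2 * h).-1 + (2 * h).-1)%N by rewrite mulSn addnC.
  have -> : GG (w - q ^+ n *: y (n * (2 * h).-1)) = GG w - q ^+ n *: GG (y (n * (2 * h).-1)).
    by rewrite linearB linearZ.
  by rewrite exprS; mcoeffs; ring.
apply: neglD; first exact: negl_Gscr.
by apply: neglZ; exact: Gscr_lead.
Qed.

Lemma iter_Gscr_neq0 (n : nat) : iter n GG (a 0 vac) <> 0.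
Proof.
move=> w0; have [_ /(_ (lead (n * (2 * h).-1)))] := iter_Gscr_lead n.
rewrite w0 sub0r mcoeffN mcoeffZ mcoeff_state eqxx mulr1 => H.
have /eqP : ((2 * h).-1`!%:R)^-1 ^+ n = 0 :> C.
  rewrite -[LHS]opprK H ?oppr0 //; split=> i /=.
    by move=> i0; rewrite fsfun_withE (negbTE i0) fsfun0E.
  by rewrite inE => /eqP.
by rewrite expf_eq0 invr_eq0 pnatr_eq0 gtn_eqF ?fact_gt0 ?andbF.
Qed.

Lemma killed_iter (n : nat) x : killed x -> killed (iter n GG x).
Proof.
move=> hx; elim: n => //= n [w1 w2]; split=> k hk.
  by rewrite Gscr_c w1 ?linear0.
by rewrite Gscr_psi w2 ?linear0.
Qed.

End LeadingTerm.

(** * Singular vectors in F_(p,r) and singularity modulo ker Q *)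

Section SingularVectors.
Context {C : numClosedFieldType}.
Variables (cL cLa : C) (h : nat).
Hypothesis h0 : (0 < h)%N.
Local Notation p := (2%:R * h%:R - 1 : C).
Local Notation Fock := (@Fock C).
Local Notation vac := (ket C vac0).
Implicit Types (x : Fock) (k n : int) (s r : C) (N : nat).
Local Notation sq2 := (sqrtC 2%:R : C).
Local Notation half := (1 / 2%:R : C).
Local Notation e := (@ehalf C h).
Local Notation a := (@ascr C h).
Local Notation GG := (@Gscr C h).
Local Notation G s := (Gmode cL p s).
Local Notation L s := (Lmode cL p s).

Lemma L_from_G s k x : L s k x = 2%:R^-1 *: (G s 0 (G s (k - 1) x) + G s (k - 1) (G s 0 x)).
Proof.
rewrite (G_G_comm _ _ _ 0 (k - 1)) (_ : 0 + (k - 1) + 1 = k); last by lia.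
by mcoeffs; field.
Qed.

Lemma G_ascr0 s n x : a 0 (G s n x) = - G (s + half) n (a 0 x).
Proof. by rewrite G_ascr mulr0 scale0r subr0 opprK. Qed.

Lemma L_ascr0 s n x : a 0 (L s n x) = L (s + half) n (a 0 x).
Proof.
rewrite !L_from_G linearZ linearD /= !G_ascr0.
have GN s' n' u : G s' n' (- u) = - G s' n' u by rewrite linearN.
by rewrite !GN !opprK.
Qed.

(** For n >= 1, L(n) is half of {G(1/2), G(n - 1/2)}, and both factors lie in SH^+. *)
Lemma SHplus_zero s x : killed x -> (forall n, 0 <= n -> G s n x = 0) ->
  forall g, SHplus g -> SHact cL p cLa s g x = 0.
Proof.
move=> [x1 x2] hG [n|n|n|n|||] //= hn.
- by rewrite L_from_G !hG ?linear0 ?addr0 ?scaler0 //; lia.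
- by rewrite (bos_nz _ 0) ?x1 ?scaler0 //; lia.
- exact: hG.
- by rewrite x2 ?scaler0.
Qed.

Lemma iter_ascr0 N x : a 0 (iter N GG x) = iter N GG (a 0 x).
Proof. by elim: N => //= N IH; rewrite Gscr_ascr IH. Qed.

(** Leibniz rule: each of the N factors contributes sqrt 2 E(-n-1) Q, and these contributions agree
    because E and Q commute with scrG. For N = 0 the coefficient is 0, whatever the truncated
    [N.-1]. *)
Lemma G_iter s n N x :
  G (s + N%:R) n (iter N GG x) = iter N GG (G s n x) +
  (sq2 * N%:R) *: e (- n - 1) (iter N.-1 GG (a 0 x)).
Proof.
elim: N => [|N IH]; first by rewrite addr0 mulr0 scale0r addr0.
rewrite -[N.+1%:R]natr1 [s + _]addrA [iter N.+1 GG x]iterS G_Gscr IH iter_ascr0 /=.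
rewrite linearD linearZ /= -addrA; congr (_ + _).
case: N {IH} => [|N] /=; first by rewrite mulr0 scale0r !add0r mulr1.
by rewrite -Gscr_ehalf; mcoeffs; ring.
Qed.

Lemma G_uvec r n N : 0 <= n -> G r n (iter N GG (a 0 vac)) = 0.
Proof.
(* The vacuum is taken at r - N - 1/2: Q raises the index by 1/2 and every scrG by 1. *)
move=> n0; have -> : r = (r - N%:R - half) + half + N%:R by ring.
rewrite G_iter G_ascr mulr0 scale0r subr0 G_vac // !(linear0, oppr0).
have -> : iter N GG 0 = 0 by elim: (N) => //= M ->; rewrite linear0.
rewrite ascr_sq add0r (_ : iter N.-1 GG 0 = 0) /ehalf ?linear0 ?scaler0 //.
by elim: (N.-1) => //= M ->; rewrite linear0.
Qed.

Lemma killed_ascr0 : killed (a 0 vac).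
Proof.
split=> k hk; first by rewrite ascr_c bos_vac ?linear0.
by rewrite ascr_psi fmo_vac ?(linear0, oppr0).
Qed.

Lemma uvec_singular r N : singular (SHact cL p cLa r) (iter N GG (a 0 vac)).
Proof.
split; first exact: iter_Gscr_neq0.
apply: SHplus_zero; first by apply: killed_iter; apply: killed_ascr0.
by move=> n n0; apply: G_uvec.
Qed.

(** Q commutes with the even generators and anticommutes with the odd ones, passing from s to s +
    1/2. *)
Lemma ker_ascr0_submodule s :
  is_submodule (SHact cL p cLa s) [set x | a 0 x = 0]%classic.
Proof.
split=> [|x y|b x|g x] /=; first exact: linear0.
- by move=> hx hy; rewrite linearD /= hx hy addr0.
- by move=> hx; rewrite linearZ /= hx scaler0.
move=> hx; case: g => [n|n|n|n|||] /=.
- by rewrite L_ascr0 hx linear0.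
- by rewrite linearZ /= -ascr_c hx linear0 scaler0.
- by rewrite G_ascr0 hx ?(linear0, oppr0).
- by rewrite linearZ /= -[a 0 _]opprK -ascr_psi hx !(linear0, oppr0, scaler0).
- by rewrite linearZ /= hx scaler0.
- exact: linear0.
- by rewrite linearZ /= hx scaler0.
Qed.

Lemma wvec_subsingular r N : (0 < N)%N ->
  subsingular (SHact cL p cLa r) (iter N GG vac).
Proof.
move=> N0; have rE : r = (r - N%:R) + N%:R by ring.
split.
  (* For G(h - 1/2) the operator E(-n-1) of [G_iter] is E(-h), whose exponential has degree 0 and is
     the identity on [killed] vectors. *)
  move=> [_ /(_ (SG (h%:Z - 1)))] /=.
  have -> : 0 <= h%:Z - 1 by lia.
  move=> /(_ isT); rewrite rE G_iter G_vac; last by lia.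
  have -> : iter N GG 0 = 0 by elim: (N) => //= M ->; rewrite linear0.
  rewrite add0r (_ : - (h%:Z - 1) - 1 = - h%:Z); last by lia.
  rewrite /ehalf addNr (killed_vertex h0); last by apply: killed_iter; apply: killed_ascr0.
  rewrite expcr0 => /eqP; rewrite scaler_eq0 mulf_eq0 sqrtC_eq0 !pnatr_eq0 /=.
  by rewrite eqn0Ngt N0 /= => /eqP; apply: iter_Gscr_neq0.
exists [set x | a 0 x = 0]%classic; first exact: ker_ascr0_submodule.
(* Q scrG^N v = scrG^N Q v is nonzero, so the vector is outside the kernel. Up to sign, Q maps its
   images under SH^+ to those of a singular vector, which vanish. *)
split=> /=; first by rewrite iter_ascr0; apply: iter_Gscr_neq0.
have [w1 w2] := killed_iter h N (@killed_vac C).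
move=> [n|n|n|n|||] //= hn.
- rewrite L_ascr0 iter_ascr0 L_from_G !G_uvec ?linear0 ?addr0 ?scaler0 //; lia.
- by rewrite (bos_nz _ 0) ?w1 ?scaler0 ?linear0 //; lia.
- by rewrite G_ascr0 iter_ascr0 G_uvec ?oppr0.
- by rewrite w2 // scaler0 linear0.
Qed.

End SingularVectors.

(** * The Verma property *)

Section Generation.
Context {C : numClosedFieldType}.
Variables (cL p cLa s : C).
Hypothesis cLa0 : cLa != 0.
Hypothesis p0 : forall n : nat, p + n.+1%:R != 0.
Local Notation Fock := (@Fock C).
Local Notation vac := (ket C vac0).
Implicit Types (x y : Fock) (k m n : int) (K j : nat).
Local Notation c := (@bos C (czero p) false).
Local Notation d := (@bos C (dzero cL p s) true).
Local Notation psi := (@fmo C).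
Local Notation G := (Gmode cL p s).
Local Notation L := (Lmode cL p s).

(* Filtration by the number of creation modes of d and Psi^+. *)
Inductive filt : nat -> Fock -> Prop :=
| filt_vac K : filt K vac
| filt_lin K (b : C) x y of filt K x & filt K y : filt K (b *: x + y)
| filt_c K n x of n < 0 & filt K x : filt K (c n x)
| filt_psim K n x of n < 0 & filt K x : filt K (psi true n x)
| filt_d K n x of n < 0 & filt K x : filt K.+1 (d n x)
| filt_psip K n x of n < 0 & filt K x : filt K.+1 (psi false n x).

(** The step preceding K, with zero preceding step 0, so that lowering statements make sense at K =
    0. *)
Definition filtp K x := if K is K'.+1 then filt K' x else x = 0.

Lemma filt0 K : filt K 0.
Proof. by rewrite -(addNr vac) -scaleN1r; apply: filt_lin; apply: filt_vac. Qed.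
Lemma filtZ K b x : filt K x -> filt K (b *: x).
Proof. by move=> hx; rewrite -[b *: x]addr0; apply: filt_lin => //; apply: filt0. Qed.
Lemma filtN K x : filt K x -> filt K (- x).
Proof. by move=> hx; rewrite -scaleN1r; apply: filtZ. Qed.

Lemma filtp0 K : filtp K 0.
Proof. by case: K => //= K; apply: filt0. Qed.
Lemma filtp_lin K b x y : filtp K x -> filtp K y -> filtp K (b *: x + y).
Proof. by case: K => [/= -> ->|K]; [rewrite scaler0 addr0 | apply: filt_lin]. Qed.
Lemma filtpN K x : filtp K x -> filtp K (- x).
Proof. by move=> hx; rewrite -[- x]addr0 -scaleN1r; apply: filtp_lin => //; apply: filtp0. Qed.
Lemma filtp_c K n x : n < 0 -> filtp K x -> filtp K (c n x).
Proof. by case: K => [_ /= ->|K]; [rewrite linear0 | apply: filt_c]. Qed.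
Lemma filtp_psim K n x : n < 0 -> filtp K x -> filtp K (psi true n x).
Proof. by case: K => [_ /= ->|K]; [rewrite linear0 | apply: filt_psim]. Qed.
Lemma filtp_d K n x : n < 0 -> filtp K x -> filt K (d n x).
Proof. by case: K => [_ /= ->|K]; [rewrite linear0; apply: filt0 | apply: filt_d]. Qed.
Lemma filtp_psip K n x : n < 0 -> filtp K x -> filt K (psi false n x).
Proof. by case: K => [_ /= ->|K]; [rewrite linear0; apply: filt0 | apply: filt_psip]. Qed.

Lemma filt_mono K x : filt K x -> filt K.+1 x.
Proof.
elim=> {K x} [K|K b x y _ hx _ hy|K n x hn _ hx|K n x hn _ hx|K n x hn _ hx|K n x hn _ hx].
- exact: filt_vac.
- exact: filt_lin.
- exact: filt_c.
- exact: filt_psim.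
- exact: filt_d.
- exact: filt_psip.
Qed.

Lemma filt_all x : exists K, filt K x.
Proof.
move: x; apply: (modes_ind (z := fun b => if b then dzero cL p s else czero p)).
- move=> b x y [K hx] [M hy].
  have up N u i : filt N u -> filt (N + i) u.
    by move=> hu; elim: i => [|i IH]; rewrite ?addn0 // addnS; apply: filt_mono.
  by exists (K + M)%N; apply: filt_lin; [|rewrite addnC]; apply: up.
- by exists 0%N; apply: filt_vac.
- by move=> [] n x hn [K hx]; [exists K.+1; apply: filt_d | exists K; apply: filt_c].
- by move=> [] n x hn [K hx]; [exists K; apply: filt_psim | exists K.+1; apply: filt_psip].
Qed.

(** The modes of c and Psi^- are contracted only with those of d and Psi^+, so a contraction deletes
    one of the counted creation modes. *)
Lemma filt_lower K x : filt K x ->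
  (forall n, 0 < n -> filtp K (c n x)) /\ (forall n, 0 <= n -> filtp K (psi true n x)).
Proof.
elim=> {K x} [K|K b x y _ [x1 x2] _ [y1 y2]|K m x hm _ [x1 x2]|K m x hm _ [x1 x2]
  |K m x hm hx [x1 x2]|K m x hm hx [x1 x2]]; split=> n hn.
- by rewrite bos_vac //; apply: filtp0.
- by rewrite fmo_vac //; apply: filtp0.
- by rewrite linearP /=; apply: filtp_lin; auto.
- by rewrite linearP /=; apply: filtp_lin; auto.
- by rewrite bosC_same; apply: filtp_c; auto.
- by rewrite -bos_fmo; apply: filtp_c; auto.
- by rewrite bos_fmo; apply: filtp_psim; auto.
- by rewrite fmoC eqxx scale0r addr0; apply: filtpN; apply: filtp_psim; auto.
- by rewrite bosC /= addrC; apply: filt_lin => //; apply: filtp_d; auto.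
- by rewrite -bos_fmo /=; apply: filtp_d; auto.
- by rewrite bos_fmo /=; apply: filtp_psip; auto.
- by rewrite fmoC /= addrC; apply: filt_lin => //; apply: filtN; apply: filtp_psip; auto.
Qed.

Lemma filt_annih K x : filt K x ->
  (forall n, 0 < n -> filt K (d n x)) /\ (forall n, 0 <= n -> filt K (psi false n x)).
Proof.
elim=> {K x} [K|K b x y _ [x1 x2] _ [y1 y2]|K m x hm hx [x1 x2]|K m x hm hx [x1 x2]
  |K m x hm hx [x1 x2]|K m x hm hx [x1 x2]]; split=> n hn.
- by rewrite bos_vac //; apply: filt0.
- by rewrite fmo_vac //; apply: filt0.
- by rewrite linearP /=; apply: filt_lin; auto.
- by rewrite linearP /=; apply: filt_lin; auto.
- by rewrite bosC /= addrC; apply: filt_lin => //; apply: filt_c; auto.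
- by rewrite -bos_fmo; apply: filt_c; auto.
- by rewrite bos_fmo; apply: filt_psim; auto.
- by rewrite fmoC /= addrC; apply: filt_lin => //; apply: filtN; apply: filt_psim; auto.
- by rewrite bosC_same; apply: filt_d; auto.
- by rewrite -bos_fmo /=; apply: filt_d; auto.
- by rewrite bos_fmo /=; apply: filt_psip; auto.
- by rewrite fmoC eqxx scale0r addr0; apply: filtN; apply: filt_psip; auto.
Qed.

Section Submodule.
Variable N : set Fock.
Hypothesis subN : is_submodule (SHact cL p cLa s) N.
Hypothesis Nvac : N vac.

Let N0 : N 0 := subm_0 subN.
Let ND x y : N x -> N y -> N (x + y) := @subm_add _ _ _ _ subN x y.
Let NZ b x : N x -> N (b *: x) := @subm_scale _ _ _ _ subN b x.
Let NN x : N x -> N (- x).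
Proof. by rewrite -scaleN1r; apply: NZ. Qed.

Lemma N_c n x : N x -> N (c n x).
Proof.
move=> hx; have := NZ (- cLa)^-1 (subm_act subN (Sal n) hx).
by rewrite /= scalerA mulVf ?oppr_eq0 // scale1r.
Qed.

Lemma N_psim n x : N x -> N (psi true n x).
Proof.
move=> hx; have := NZ (- (sqrtC 2%:R * cLa))^-1 (subm_act subN (SPsi n) hx).
rewrite /= scalerA mulVf ?scale1r // oppr_eq0 mulf_neq0 // sqrtC_eq0 pnatr_eq0 //.
Qed.

Lemma sum_mod (f : int -> Fock) : finsuppd f -> (forall k, k != 0 -> N (f k)) ->
  N (\sum_(k \in [set: int]) f k - f 0).
Proof.
move=> hf hN; pose g k := if k == 0 then - f 0 else 0.
have -> : - f 0 = \sum_(k \in [set: int]) g k.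
  by rewrite (sum_single (a := 0)) /g ?eqxx // => k /negbTE ->.
rewrite -sum_add //; last by exists [:: 0] => k; rewrite inE /g => /negbTE ->.
apply: sum_ind => // k; rewrite /g; case: (k =P 0) => [->|/eqP k0].
  by rewrite subrr.
by rewrite addr0; apply: hN.
Qed.

Section Step.
Variable K : nat.
Hypothesis filtN' : forall y, filt K y -> N y.

(* Modulo N, the vectors G(n) x and L(n) x reduce to multiples of Psi^+(n) x and
   d(n) x, with coefficients nonzero because p is not a negative integer. *)
Lemma N_psip_d j x : filt K x ->
  N (psi false (- j.+1%:Z) x) /\ N (d (- j.+1%:Z) x).
Proof.
have [M] := ubnP j; elim: M j x => // M IH j x hj hx.
have [c_low m_low] := filt_lower hx; have [d_ann p_ann] := filt_annih hx.
set n := - j.+1%:Z.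
have Nx : N x by apply: filtN'.
(* Nonnegative modes stay in the same filtration step by [filt_annih]; the negative modes above n
   come from the induction on j. *)
have IHp k : n < k -> N (psi false k x).
  move=> hk; have [k0|k0] := leP 0 k; first by apply: filtN'; apply: p_ann.
  have [|h _] := IH (absz k).-1 x _ hx; first by rewrite /n in hk; lia.
  by move: h; rewrite (_ : - _ = k) //; lia.
have IHd k : n < k -> N (d k x).
  move=> hk; have [k0|k0|->] := ltgtP k 0; last by rewrite bos0; apply: NZ.
    have [|_ h] := IH (absz k).-1 x _ hx; first by rewrite /n in hk; lia.
    by move: h; rewrite (_ : - _ = k) //; lia.
  by apply: filtN'; apply: d_ann.
have NP : N (psi false n x).
  have hCP : N (nprod (fun=> 1) c (psi false) 1 n x - czero p *: psi false n x).
    have fin := nprod_finsuppd (fun=> 1) 1 (bos_linear (czero p) false) (fmo_linear false)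
      (bos_finite _ _) (fmo_finite _) n x.
    have -> : czero p *: psi false n x = 1 *: (if 0 < 0 :> int then c 0 (psi false (n - 0) x)
        else 1 *: psi false (n - 0) (c 0 x)).
      by rewrite ltxx !scale1r subr0 bos0 linearZ.
    rewrite nprod.unlock; apply: (sum_mod fin) => k k0; rewrite !scale1r.
    case: ltP => hk; first by apply: N_c; apply: IHp; rewrite /n; lia.
    by apply: filtN'; apply: filtp_psip; [rewrite /n; lia | apply: c_low; lia].
  have hDM : N (nprod (fun=> 1) d (psi true) 1 n x).
    rewrite nprod.unlock; apply: sum_ind => // k; rewrite !scale1r.
    case: ltP => hk; last first.
      by apply: N_psim; apply: IHd; rewrite /n; lia.
    have [nk|nk] := leP 0 (n - k).
      by apply: filtN'; apply: filtp_d => //; apply: m_low.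
    by rewrite bos_fmo; apply: N_psim; apply: IHd; rewrite /n in nk *; lia.
  have hG := subm_act subN (SG n) Nx.
  (* Up to sqrt 2, the coefficient of Psi^+(n + 1/2) x in G(n + 1/2) x is [czero p] / 2 + (n + 1) =
     - (p + 2 j + 1) / 2, as n = - j - 1. *)
  have nz : p + (2 * j).+1%:R != 0 by [].
  have q2 : sqrtC 2%:R != 0 :> C by rewrite sqrtC_eq0 pnatr_eq0.
  have hp : N (psi true n x) by apply: N_psim.
  have -> : psi false n x = (- 2%:R / (p + (2 * j).+1%:R)) *:
     ((sqrtC 2%:R)^-1 *: G n x
      - (2%:R^-1 *: (nprod (fun=> 1) c (psi false) 1 n x - czero p *: psi false n x)
      + 2%:R^-1 *: nprod (fun=> 1) d (psi true) 1 n x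
      + (tcl cL * (- n%:~R - 1)) *: psi true n x)).
    rewrite Gmode.unlock /czero /n rmorphN /= -[j.+1%:~R]/(j.+1%:R).
    rewrite -[(2 * j).+1%:R]natr1 natrM -[j.+1%:R]natr1.
    move: nz; rewrite -[(2 * j).+1%:R]natr1 natrM => nz.
    mcoeffs; field; rewrite ?nz ?q2 //.
  by apply: NZ; apply: ND; [apply: NZ | apply: NN; apply: ND; [apply: ND|]; apply: NZ].
split=> //.
(* The fermionic terms of L(n) involve Psi^+(k + 1/2) down to k = n, so Psi^+ has to be settled at
   this level before d. *)
have IHp' k : n <= k -> N (psi false k x).
  by rewrite le_eqVlt => /predU1P[<- //|]; apply: IHp.
have hCD : N (nprod (fun=> 1) c d 1 n x - czero p *: d n x).
  have fin := nprod_finsuppd (fun=> 1) 1 (bos_linear (czero p) false) (bos_linear (dzero cL p s) true)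
    (bos_finite _ _) (bos_finite _ _) n x.
  have -> : czero p *: d n x = 1 *: (if 0 < 0 :> int then c 0 (d (n - 0) x)
      else 1 *: d (n - 0) (c 0 x)).
    by rewrite ltxx !scale1r subr0 bos0 linearZ.
  rewrite nprod.unlock; apply: (sum_mod fin) => k k0; rewrite !scale1r.
  case: ltP => hk; first by apply: N_c; apply: IHd; rewrite /n; lia.
  by apply: filtN'; apply: filtp_d; [rewrite /n; lia | apply: c_low; lia].
have hF1 : N (nprod (fun k => - k%:~R - 1) (psi false) (psi true) (-1) (n - 1) x).
  rewrite nprod.unlock; apply: sum_ind => // k; apply: NZ; case: ltP => hk; last first.
    by apply: NZ; apply: N_psim; apply: filtN'; apply: p_ann.
  have [nk|nk] := leP 0 (n - 1 - k).
    by apply: filtN'; apply: filtp_psip => //; apply: m_low.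
  rewrite fmoC /= (_ : (_ == 0) = false) ?scale0r ?addr0; last by rewrite /n; lia.
  by apply: NN; apply: N_psim; apply: IHp'; rewrite /n in nk *; lia.
have hF2 : N (nprod (fun k => - k%:~R - 1) (psi true) (psi false) (-1) (n - 1) x).
  rewrite nprod.unlock; apply: sum_ind => // k; apply: NZ; case: ltP => hk.
    by apply: N_psim; apply: IHp'; rewrite /n; lia.
  by apply: NZ; apply: filtN'; apply: filtp_psip; [rewrite /n; lia | apply: m_low].
have hL := subm_act subN (SL n) Nx.
have hc : N (c n x) by apply: N_c.
(* The coefficient of d(n) x in L(n) x is [czero p] / 2 + (n + 1) / 2 = - (p + j + 1) / 2. *)
have nz : p + j.+1%:R != 0 by [].
have -> : d n x = (- 2%:R / (p + j.+1%:R)) *: (L n x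
   - (2%:R^-1 *: (nprod (fun=> 1) c d 1 n x - czero p *: d n x)
   + (tcl cL / 2%:R * (- n%:~R - 1)) *: c n x
   + 2%:R^-1 *: nprod (fun k => - k%:~R - 1) (psi false) (psi true) (-1) (n - 1) x
   + 2%:R^-1 *: nprod (fun k => - k%:~R - 1) (psi true) (psi false) (-1) (n - 1) x)).
  rewrite Lmode.unlock /czero /n rmorphN /= -[j.+1%:~R]/(j.+1%:R).
  by mcoeffs; field; rewrite [1 + _]addrC natr1.
apply: NZ; apply: ND => //; apply: NN; apply: ND; last exact: NZ.
by apply: ND; [apply: ND|]; apply: NZ.
Qed.

End Step.

Lemma filt_sub K x : filt K x -> N x.
Proof.
(* H is the induction on the derivation of [filt K x], given the preceding filtration step; the
   outer induction is on K. *)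
move=> hx; have H : forall K, (forall K', K = K'.+1 -> forall y, filt K' y -> N y) ->
    forall x, filt K x -> N x.
  move=> {K x hx} K hK x hx; elim: hx hK => {K x} [K|K b x y _ hx _ hy|K n x hn _ hx
    |K n x hn _ hx|K n x hn hx _|K n x hn hx _] hK //.
  - by apply: ND; [apply: NZ; apply: hx | apply: hy].
  - by apply: N_c; apply: hx.
  - by apply: N_psim; apply: hx.
  - have [_] := N_psip_d (hK K erefl) (absz n).-1 hx.
    by rewrite (_ : - _ = n) //; lia.
  - have [+ _] := N_psip_d (hK K erefl) (absz n).-1 hx.
    by rewrite (_ : - _ = n) //; lia.
elim: K x hx => [|K IH]; apply: H => // K' [<-]; exact: IH.
Qed.

Lemma vac_generates x : N x.
Proof. by have [K /filt_sub] := filt_all x. Qed.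

End Submodule.

End Generation.

(* The first component is the parity. *)
Definition neg_index : Type := (bool * (bool * nat))%type.

Definition neg_gen (j : neg_index) : SHgen :=
  match j with
  | (false, (false, k)) => Sal (Negz k)
  | (false, (true, k)) => SL (Negz k)
  | (true, (false, k)) => SG (Negz k)
  | (true, (true, k)) => SPsi (Negz k)
  end.

Definition gen_odd (g : SHgen) : bool :=
  match g with SG _ | SPsi _ => true | _ => false end.

Definition gen_neg (g : SHgen) : bool :=
  match g with SL n | Sal n | SG n | SPsi n => n < 0 | _ => false end.

Lemma gen_negP g : gen_neg g -> exists j, g = neg_gen j.
Proof.
case: g => [[n|n]|[n|n]|[n|n]|[n|n]|||] //= _.
- by exists (false, (true, n)).
- by exists (false, (false, n)).
- by exists (true, (false, n)).
- by exists (true, (true, n)).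
Qed.

Lemma neg_gen_odd j : gen_odd (neg_gen j) = j.1.
Proof. by case: j => [[] [[] n]]. Qed.

Definition le_index : rel (bool * (bool * nat)) := fun i j => leq (choice.pickle i) (choice.pickle j).
(* Admissible neighbours in a PBW monomial: odd generators are not repeated. *)
Definition ok_index : rel (bool * (bool * nat)) :=
  fun i j => leq (choice.pickle i).+1 (choice.pickle j) || (i == j) && ~~ i.1.

Lemma ok_index_trans : transitive ok_index.
Proof.
move=> j i k; rewrite /ok_index => /orP[ij|/andP[/eqP -> i1]] //.
by move=> /orP[jk|/andP[/eqP <- _]]; rewrite ?(ltn_trans ij jk) ?ij.
Qed.

Lemma ok_index_le : subrel ok_index le_index.
Proof. by move=> i j /orP[/ltnW //|/andP[/eqP -> _]]; rewrite /le_index. Qed.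

(** * PBW straightening in a highest weight module *)

Section Straightening.
Context {C : numClosedFieldType} (V : lmodType C) (act : SHgen -> V -> V).
Hypothesis modV : is_SHmodule act.

Let act_lin g := SH_linear modV g.
Let actD g x y : act g (x + y) = act g x + act g y.
Proof. exact: (linear_funD (act_lin g)). Qed.
Let actZ g a x : act g (a *: x) = a *: act g x.
Proof. exact: (linear_funZ (act_lin g)). Qed.
Let actB g x y : act g (x - y) = act g x - act g y.
Proof. by rewrite -scaleN1r actD actZ scaleN1r. Qed.

Definition bracket_sign (g g' : SHgen) : C := if gen_odd g && gen_odd g' then -1 else 1.

(** The defining relations in the one form that straightening uses: a super-bracket of basis
    elements is a combination of basis elements. P stands for a subspace, and [swap] supplies the
    order of a pair that the relations do not list. *)
Lemma bracket_in (P : V -> Prop) g g' u :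
  (forall x y, P x -> P y -> P (x + y)) -> (forall a x, P x -> P (a *: x)) ->
  (forall z, P (act z u)) ->
  P (act g (act g' u) - bracket_sign g g' *: act g' (act g u)).
Proof.
move=> PD PZ H.
have P0 : P 0 by rewrite -(scale0r (act SCL u)); apply: PZ.
have PN x : P x -> P (- x) by rewrite -scaleN1r; apply: PZ.
pose B g1 g2 := act g1 (act g2 u) - bracket_sign g1 g2 *: act g2 (act g1 u).
have swap g1 g2 : P (B g1 g2) -> P (B g2 g1).
  move=> /(PZ (- bracket_sign g1 g2)); rewrite /B /bracket_sign andbC.
  by case: ifP => _; [rewrite opprK !scaleN1r !opprK scale1r addrC | rewrite scaleN1r !scale1r opprB].
have E x y : P (commut (act x) (act y) u) -> ~~ (gen_odd x && gen_odd y) -> P (B x y).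
  by rewrite /B /bracket_sign => + /negbTE ->; rewrite scale1r.
have O x y : P (acommut (act x) (act y) u) -> gen_odd x && gen_odd y -> P (B x y).
  by rewrite /B /bracket_sign => + ->; rewrite scaleN1r opprK.
have cCL x : P (B SCL x) by apply: E => //; rewrite (SH_CL modV).
have cCal x : P (B SCal x) by apply: E => //; rewrite (SH_Cal modV).
have cCLal x : P (B SCLal x) by apply: E => //; rewrite (SH_CLal modV).
have LL m n : P (B (SL m) (SL n)) by apply: E => //; rewrite (SH_L_L modV); auto.
have La m n : P (B (SL m) (Sal n)) by apply: E => //; rewrite (SH_L_al modV); auto.
have LG m n : P (B (SL m) (SG n)) by apply: E => //; rewrite (SH_L_G modV); auto.
have PsL m n : P (B (SPsi m) (SL n)) by apply: E => //; rewrite (SH_Psi_L modV); auto.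
have aa m n : P (B (Sal m) (Sal n)) by apply: E => //; rewrite (SH_al_al modV); auto.
have aPs m n : P (B (Sal m) (SPsi n)) by apply: E => //; rewrite (SH_al_Psi modV); auto.
have aG m n : P (B (Sal m) (SG n)) by apply: E => //; rewrite (SH_al_G modV); auto.
have GG m n : P (B (SG m) (SG n)) by apply: O => //; rewrite (SH_G_G modV); auto.
have PsPs m n : P (B (SPsi m) (SPsi n)) by apply: O => //; rewrite (SH_Psi_Psi modV); auto.
have PsG m n : P (B (SPsi m) (SG n)) by apply: O => //; rewrite (SH_Psi_G modV); auto.
rewrite -/(B g g').
by case: g; case: g' => *; auto.
Qed.

Variables (cL cLa p r : C) (v : V).
Hypothesis hwv : is_hw_vector cL cLa p r act v.

Definition act_word (t : seq neg_index) : V := foldr (fun j => act (neg_gen j)) v t.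

Inductive wspan (k : nat) : V -> Prop :=
| wspan_word t of sorted ok_index t & (size t <= k)%N : wspan k (act_word t)
| wspan_lin (a : C) x y of wspan k x & wspan k y : wspan k (a *: x + y).

Lemma wspan_vac k : wspan k v.
Proof. exact: (@wspan_word k [::]). Qed.
Lemma wspan0 k : wspan k 0.
Proof. by rewrite -(addNr v) -scaleN1r; apply: wspan_lin; apply: wspan_vac. Qed.
Lemma wspanD k x y : wspan k x -> wspan k y -> wspan k (x + y).
Proof. by move=> hx hy; rewrite -[x]scale1r; apply: wspan_lin. Qed.
Lemma wspanZ k a x : wspan k x -> wspan k (a *: x).
Proof. by move=> hx; rewrite -[a *: x]addr0; apply: wspan_lin => //; apply: wspan0. Qed.
Lemma wspan_mono k l x : (k <= l)%N -> wspan k x -> wspan l x.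
Proof.
move=> kl; elim=> [t ts tk|a y z _ hy _ hz]; last exact: wspan_lin.
by apply: wspan_word => //; apply: leq_trans kl.
Qed.

Lemma wspan_bracket k g g' u : (forall z, wspan k (act z u)) ->
  exists2 w, wspan k w & act g (act g' u) = bracket_sign g g' *: act g' (act g u) + w.
Proof.
move=> hu; exists (act g (act g' u) - bracket_sign g g' *: act g' (act g u)).
  by apply: bracket_in => //; [exact: wspanD | exact: wspanZ].
by rewrite addrC subrK.
Qed.

Lemma hw_scalar g : ~~ gen_neg g -> wspan 0 (act g v).
Proof.
have z x : x = 0 -> wspan 0 x by move=> ->; apply: wspan0.
have pos n : ~~ (n < 0 :> int) -> n = 0 \/ 0 < n by lia.
case: g => [n|n|n|n|||] /=.
- case/pos => [->|n0]; first by rewrite (hw_L0 hwv); apply: wspanZ; apply: wspan_vac.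
  by apply: z; rewrite (hw_plus hwv).
- case/pos => [->|n0]; first by rewrite (hw_al0 hwv); apply: wspanZ; apply: wspan_vac.
  by apply: z; rewrite (hw_plus hwv).
- by rewrite -leNgt => n0; apply: z; rewrite (hw_plus hwv).
- by rewrite -leNgt => n0; apply: z; rewrite (hw_plus hwv).
- by rewrite (hw_CL hwv) => _; apply: wspanZ; apply: wspan_vac.
- by rewrite (hw_Cal hwv) => _; apply: wspan0.
- by rewrite (hw_CLal hwv) => _; apply: wspanZ; apply: wspan_vac.
Qed.

(** Up to shorter words, the product is 0 or a multiple of an ordered word t' of full length. The
    condition on i says that any letter that may precede both j and t may precede t'; it is needed
    to put the first letter of a longer word back in front. *)
Definition inserted k j t := wspan k (act (neg_gen j) (act_word t)) \/
  exists t' (e : C), [/\ size t' = k.+1, sorted ok_index t',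
    forall i, ok_index i j -> path ok_index i t -> path ok_index i t' &
    wspan k (act (neg_gen j) (act_word t) - e *: act_word t')].

(** Simultaneous induction on the length. Exchanging two letters leaves a bracket acting on a
    shorter word, to which the first claim applies; the first claim is in turn the third for
    negative generators and the second for the others. *)
Lemma straighten k :
  [/\ forall g u, wspan k u -> wspan k.+1 (act g u),
      forall g u, ~~ gen_neg g -> wspan k u -> wspan k (act g u)
    & forall j t, sorted ok_index t -> size t = k -> inserted k j t].
Proof.
have [n] := ubnP k; elim: n k => // n IH k kn.
(* Linearity and the induction hypothesis leave only ordered words of length exactly k. *)
have words (g : SHgen) l : (k <= l)%N ->
    (forall t, sorted ok_index t -> size t = k -> wspan l (act g (act_word t))) ->
    (forall k' u, (k' < k)%N -> wspan k' u -> wspan l (act g u)) ->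
    forall u, wspan k u -> wspan l (act g u).
  move=> kl hk hlt u; elim=> [t ts|a x y _ hx _ hy].
    rewrite leq_eqVlt => /predU1P[tk|tk]; first exact: hk.
    by apply: (hlt (size t)) => //; apply: wspan_word.
  by rewrite actD actZ; apply: wspan_lin.
have H2 g u : ~~ gen_neg g -> wspan k u -> wspan k (act g u).
  move=> ng; apply: words => // [[|y t] ts tk|k' w k'k hw].
  - by apply: (wspan_mono (leq0n k)); apply: hw_scalar.
  - case: k kn tk => // k kn [tk].
    have [h1 h2 _] := IH k kn.
    have ut : wspan k (act_word t) by apply: wspan_word; [apply: path_sorted ts|rewrite tk].
    have [w hw ->] := wspan_bracket (k := k.+1) g (neg_gen y) (fun z => h1 z _ ut).
    by apply: wspanD => //; apply: wspanZ; apply: h1; apply: h2.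
  - have [_ h _] := IH k' (leq_trans k'k kn).
    by apply: (wspan_mono (ltnW k'k)); apply: h.
have H3 j t : sorted ok_index t -> size t = k -> inserted k j t.
  case: t => [_ tk|y t ts tk].
    right; exists [:: j], 1; rewrite -tk; split=> //=; last first.
      by rewrite scale1r subrr; apply: wspan0.
    by move=> i ->.
  clear words; case: k kn tk H2 => // k kn [tk] H2.
  have [h1 h2 h3] := IH k kn.
  have tso : sorted ok_index t by apply: path_sorted ts.
  have ut : wspan k (act_word t) by apply: wspan_word => //; rewrite tk.
  case jy: (ok_index j y).
    right; exists [:: j, y & t], 1; split=> //=.
    - by rewrite tk.
    - by rewrite jy.
    - by move=> i -> /= /andP[_ ->]; rewrite jy.
    - by rewrite scale1r subrr; apply: wspan0.
  have [w hw E] := wspan_bracket (k := k.+1) (neg_gen j) (neg_gen y) (fun z => h1 z _ ut).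
  (* If neither order is admissible then j = y is odd, and its square is half of a bracket, hence of
     smaller length. *)
  have [yj|nyj] := boolP (ok_index y j); last first.
    have [jy' odd_j] : j = y /\ gen_odd (neg_gen j).
      move: jy nyj; rewrite /ok_index neg_gen_odd.
      case: ltngtP => // /(pcan_inj choice.pickleK) ->; rewrite !eqxx /= => /negbT.
      by rewrite negbK.
    left; rewrite -jy' in E *; rewrite /=.
    move: E; rewrite /bracket_sign odd_j /= scaleN1r => E.
    rewrite (_ : act _ _ = 2%:R^-1 *: w); first exact: wspanZ.
    have -> : w = 2%:R *: act (neg_gen j) (act (neg_gen j) (act_word t)).
      by rewrite scaler_nat mulr2n {2}E addrA subrr add0r.
    by rewrite scalerA mulVf ?scale1r // pnatr_eq0.
  (* Here y may precede j: after the exchange, j is inserted into the shorter word t and y is put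
     back in front, the sign of the exchange entering the coefficient. *)
  have [hl|[t' [e [st' tso' ht' hw']]]] := h3 j t tso tk.
    by left; rewrite /= E; apply: wspanD => //; apply: wspanZ; apply: h1.
  right; exists (y :: t'), (bracket_sign (neg_gen j) (neg_gen y) * e); split=> //=.
  - by rewrite st'.
  - exact: ht'.
  - by move=> i ij /andP[-> _]; apply: ht'.
  rewrite E addrAC -scalerA -scalerBr -actZ.
  apply: wspanD => //; apply: wspanZ.
  by rewrite -actB; apply: h1.
split=> // g; apply: words => // [t ts tk|k' u k'k hu]; last first.
  have [h _ _] := IH k' (leq_trans k'k kn).
  by apply: (wspan_mono (k := k'.+1)); [apply: ltnW | apply: h].
have [/gen_negP[j ->]|ng] := boolP (gen_neg g); last first.
  apply: (wspan_mono (leqnSn k)); apply: H2 => //.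
  by apply: wspan_word => //; rewrite tk.
have [hl|[t' [e [st' tso' _ hw']]]] := H3 j t ts tk; first exact: wspan_mono hl.
rewrite -[act _ _](subrK (e *: act_word t')); apply: wspanD.
  exact: wspan_mono hw'.
by apply: wspanZ; apply: wspan_word => //; rewrite st'.
Qed.

End Straightening.

(** Basis states are matched with PBW words by replacing c(-k-1), d(-k-1), Psi^+(-k-1/2),
    Psi^-(-k-1/2) with alpha(-k-1), L(-k-1), G(-k-1/2), Psi(-k-1/2), which have the same degrees. *)
Definition state_modes (s : state) : seq (bool * (bool * nat)) :=
  flatten [seq nseq (s.1 i) (false, i) | i <- finsupp s.1] ++ [seq (true, i) | i <- s.2].

Definition word_of (s : state) : seq (bool * (bool * nat)) := sort le_index (state_modes s).

Lemma count_state_modes s j :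
  count_mem j (state_modes s) = if j.1 then (j.2 \in s.2 : nat) else s.1 j.2.
Proof.
have hf (D : seq (bool * nat)) (f : bool * nat -> nat) : uniq D ->
    count_mem j (flatten [seq nseq (f i) (false, i) | i <- D]) =
    if j.1 then 0%N else ((j.2 \in D) * f j.2)%N.
  case: j => b i; elim: D => [|k D IH] /=; first by case: b.
  move=> /andP[kD uD]; rewrite count_cat (IH uD) count_nseq /= inE xpair_eqE.
  rewrite eq_sym; case: b {IH} => //=; rewrite eq_sym.
  case: eqP => [->|] //=.
  by rewrite (negbTE kD) mul1n addn0.
rewrite count_cat hf ?fset_uniq //; case: j {hf} => [[] i] /=.
  rewrite count_map (eq_count (a2 := pred1 i)); last by move=> k; rewrite /= xpair_eqE.
  by rewrite count_uniq_mem ?fset_uniq.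
rewrite count_map (eq_count (a2 := pred0)); last by move=> k; rewrite /= xpair_eqE.
rewrite count_pred0 addn0; case: (boolP (i \in _)) => hi; first by rewrite mul1n.
by rewrite mul0n fsfun_dflt.
Qed.

Definition state_of (t : seq (bool * (bool * nat))) : state :=
  ([fsfun i in [fset j.2 | j in t & ~~ j.1]%fset => count_mem (false, i) t],
   [fset j.2 | j in t & j.1]%fset).

Lemma le_index_total : total le_index.
Proof. by move=> i j; apply: leq_total. Qed.
Lemma le_index_trans : transitive le_index.
Proof. by move=> i j k; apply: leq_trans. Qed.
Lemma le_index_anti : antisymmetric le_index.
Proof. by move=> i j h; apply: (pcan_inj choice.pickleK); apply: anti_leq. Qed.

(** This is the upper bound on the graded pieces: every admissible word comes from a Fock state.
    That [ok_index] is strict on odd letters makes their multiplicity at most 1, as in a set of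
    fermionic modes. *)
Lemma word_ofK t : sorted ok_index t -> word_of (state_of t) = t.
Proof.
move=> ts; apply: (sorted_eq le_index_trans le_index_anti).
- exact: sort_sorted le_index_total _.
- exact: sub_sorted ok_index_le _ ts.
rewrite perm_sort; apply/allP => -[b i] _ /=; apply/eqP.
rewrite count_state_modes /=; case: b.
  have hm : (i \in [fset j.2 | j in t & j.1]%fset) = ((true, i) \in t).
    apply/imfsetP/idP => [[[b k]] /=|h].
      by rewrite inE /= => /andP[h hb] ->; move: h; rewrite hb.
    by exists (true, i); rewrite //= inE /= h.
  rewrite hm; elim: t ts {hm} => //= j t IH ts.
  rewrite -(IH (path_sorted ts)) inE (eq_sym j); case: eqP => [e|//] /=.
  case jt: (_ \in t) => //; have /allP/(_ _ jt) := order_path_min ok_index_trans ts.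
  by rewrite -e /ok_index ltnn /= andbF.
rewrite fsfunE; case: ifP => // /negP h; apply/esym/count_memPn/negP => hi.
by apply: h; apply/imfsetP; exists (false, i); rewrite //= inE /= hi.
Qed.

(* Twice the degree, as in [sdeg]. *)
Definition mdeg (j : bool * (bool * nat)) : nat := if j.1 then (2 * j.2.2).+1 else (2 * j.2.2.+1)%N.

Lemma mdeg_word_of s : (\sum_(j <- word_of s) mdeg j)%N = sdeg s.
Proof.
rewrite (perm_big (state_modes s)); last by rewrite perm_sort.
rewrite big_cat big_flatten !big_map; congr addn.
by apply: eq_bigr => i _; rewrite big_nseq iter_addn_0 mulnC.
Qed.

Section Words.
Context {C : numClosedFieldType} (V : lmodType C) (act : SHgen -> V -> V).
Hypothesis modV : is_SHmodule act.
Variables (cL cLa p r : C) (v : V).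
Hypothesis hwv : is_hw_vector cL cLa p r act v.
Local Notation wspan := (wspan act v).
Local Notation act_word := (act_word act v).

Definition pbw : @Fock C -> V := flin (fun s => act_word (word_of s)).
HB.instance Definition _ := GRing.isLinear.Build C (@Fock C) V *:%R pbw (flin_linear _).

Lemma wspan_pbw k x : wspan k x -> exists u, x = pbw u.
Proof.
elim=> [t ts _|a y z _ [u ->] _ [w ->]]; last by exists (a *: u + w); rewrite linearP.
by exists (ket C (state_of t)); rewrite /pbw flinU word_ofK.
Qed.

Lemma pbw_vac : exists u, v = pbw u.
Proof. exact: (wspan_pbw (wspan_vac act v 0)). Qed.

Lemma act_word_wspan t : exists k, wspan k (act_word t).
Proof.
elim: t => [|j t [k hk]]; first by exists 0%N; apply: wspan_vac.
by exists k.+1; have [h _ _] := straighten modV hwv k; apply: h.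
Qed.

Lemma pbw_act g u : exists u', act g (pbw u) = pbw u'.
Proof.
elim/(@state_ind C): u => [a x y [x' hx] [y' hy]|s].
  by exists (a *: x' + y'); rewrite !linearP /= (SH_linear modV) hx hy.
rewrite /pbw flinU; have [k hk] := act_word_wspan (word_of s).
by have [h _ _] := straighten modV hwv k; apply: (wspan_pbw (h g _ hk)).
Qed.

Lemma L0_act_word t : act (SL 0) (act_word t) =
  (hpr cL p r + (\sum_(j <- t) mdeg j)%N%:R / 2%:R) *: act_word t.
Proof.
have sw x y (u : V) a : act x (act y u) - act y (act x u) = a *: act y u ->
    forall b, act x u = b *: u -> act x (act y u) = (b + a) *: act y u.
  move=> E b hu; rewrite -[LHS](subrK (act y (act x u))) E hu.
  rewrite (linear_funZ (SH_linear modV y)).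
  by rewrite -scalerDl addrC.
elim: t => [|j t IH] /=; first by rewrite big_nil mul0r addr0 (hw_L0 hwv).
rewrite big_cons natrD mulrDl [X in _ + X]addrC addrA.
apply: sw => //; case: j => [[] [[] k]] /=; rewrite /mdeg /=.
- have := SH_Psi_L modV (Negz k) 0 (act_word t); rewrite /commut => h.
  rewrite -opprB h !addr0 -scaleNr; congr (_ *: _).
  by rewrite NegzE !(rmorphD, rmorphM, rmorphN) /= -[k.+1%:~R]/(k.+1%:R); field.
- have := SH_L_G modV 0 (Negz k) (act_word t); rewrite /commut => ->.
  rewrite add0r; congr (_ *: _).
  by rewrite NegzE !(rmorphD, rmorphM, rmorphN) /= -[k.+1%:~R]/(k.+1%:R); field.
- have := SH_L_L modV 0 (Negz k) (act_word t); rewrite /commut => ->.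
  rewrite !add0r oppr0 mulr0z mul0r ?mulr0 scale0r addr0; congr (_ *: _).
  by rewrite NegzE opprK -[k.+1%:~R]/(k.+1%:R); field.
- have := SH_L_al modV 0 (Negz k) (act_word t); rewrite /commut => ->.
  rewrite add0r (_ : (0 : int) ^+ 2 + 0 = 0) // mulr0z mulr0 scale0r subr0; congr (_ *: _).
  by rewrite NegzE mulrNz opprK -[k.+1%:~R]/(k.+1%:R); field.
Qed.

End Words.

Lemma states_finite (n : nat) : exists T : seq state, forall s, (sdeg s <= n)%N -> s \in T.
Proof.
have pos (i : bool * nat) (s : state) : (sdeg (incr i s) <= 0)%N = false.
  by rewrite sdeg_incr; lia.
elim: n => [|n [T hT]].
  exists [:: vac0] => s; case: (stateP s) => [->|i t ->|i t -> hi]; first by rewrite inE.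
    by rewrite pos.
  by rewrite sdeg_fins //; lia.
pose M := [seq (b, k) | b <- [:: false; true], k <- iota 0 n.+1].
have hM (i : bool * nat) : (i.2 <= n)%N -> i \in M.
  by case: i => b k h; rewrite allpairs_f // ?mem_iota //; case: (b).
exists (vac0 :: [seq incr i s | i <- M, s <- T] ++ [seq fins i s | i <- M, s <- T]) => s.
case: (stateP s) => [->|i t ->|i t -> hi]; first by rewrite inE eqxx.
  rewrite sdeg_incr inE mem_cat => h; rewrite [X in _ || (X || _)]allpairs_f ?orbT //.
    by apply: hM; lia.
  by apply: hT; lia.
rewrite sdeg_fins // inE mem_cat => h; rewrite [X in _ || (_ || X)]allpairs_f ?orbT //.
  by apply: hM; lia.
by apply: hT; lia.
Qed.

Section SumModule.
Context {C : numClosedFieldType} (V W : lmodType C).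
Variables (actV : SHgen -> V -> V) (actW : SHgen -> W -> W).

Definition act_sum (g : SHgen) (x : V * W) : V * W := (actV g x.1, actW g x.2).

Lemma act_sum_module : is_SHmodule actV -> is_SHmodule actW -> is_SHmodule act_sum.
Proof.
move=> hV hW.
have sp (x y : V * W) : x.1 = y.1 -> x.2 = y.2 -> x = y by case: x y => [a b] [a' b'] /= -> ->.
split=> [g a x y|g u|g u|g u|m n u|m n u|m n u|m n u|m n u|m n u|m n u|m n u|m n u|m n u];
  apply: sp.
- exact: (SH_linear hV). - exact: (SH_linear hW).
- exact: (SH_CL hV). - exact: (SH_CL hW).
- exact: (SH_Cal hV). - exact: (SH_Cal hW).
- exact: (SH_CLal hV). - exact: (SH_CLal hW).
- exact: (SH_al_al hV). - exact: (SH_al_al hW).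
- exact: (SH_L_al hV). - exact: (SH_L_al hW).
- exact: (SH_L_L hV). - exact: (SH_L_L hW).
- exact: (SH_Psi_Psi hV). - exact: (SH_Psi_Psi hW).
- exact: (SH_al_Psi hV). - exact: (SH_al_Psi hW).
- exact: (SH_G_G hV). - exact: (SH_G_G hW).
- exact: (SH_L_G hV). - exact: (SH_L_G hW).
- exact: (SH_al_G hV). - exact: (SH_al_G hW).
- exact: (SH_Psi_L hV). - exact: (SH_Psi_L hW).
- exact: (SH_Psi_G hV). - exact: (SH_Psi_G hW).
Qed.

Lemma act_sum_hw (cL cLa p r : C) v w :
  is_hw_vector cL cLa p r actV v -> is_hw_vector cL cLa p r actW w ->
  is_hw_vector cL cLa p r act_sum (v, w).
Proof.
move=> hV hW; split=> [g hg|||u|u|u]; rewrite /act_sum /=.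
- by rewrite (hw_plus hV) // (hw_plus hW).
- by rewrite (hw_L0 hV) (hw_L0 hW).
- by rewrite (hw_al0 hV) (hw_al0 hW).
- by rewrite (hw_CL hV) (hw_CL hW); case: u.
- by rewrite (hw_Cal hV) (hw_Cal hW).
- by rewrite (hw_CLal hV) (hw_CLal hW); case: u.
Qed.

Lemma act_word_sum v w t :
  act_word act_sum (v, w) t = (act_word actV v t, act_word actW w t).
Proof. by elim: t => //= j t ->. Qed.

(** The same u is evaluated in both summands, so whatever straightening finds in the sum holds with
    equal coefficients in each. *)
Lemma pbw_sum v w u : pbw act_sum (v, w) u = (pbw actV v u, pbw actW w u).
Proof.
elim/(@state_ind C): u => [a x y hx hy|s]; first by rewrite !linearP /= hx hy.
by rewrite /pbw !flinU act_word_sum.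
Qed.

End SumModule.

(** * Bijectivity of the PBW map and the universal property *)

Section Verma.
Context {C : numClosedFieldType}.
Variables (cL p cLa s : C).
Hypothesis cLa0 : cLa != 0.
Hypothesis p0 : forall n : nat, p + n.+1%:R != 0.
Local Notation Fock := (@Fock C).
Local Notation vac := (ket C vac0).
Local Notation L := (Lmode cL p s).
Local Notation act := (SHact cL p cLa s).
Local Notation pbwF := (pbw act vac).
Let modF := SHact_module cL p cLa s.
Let hwF := SHact_vac cL p cLa s.

Lemma L0_ket t : L 0 (ket C t) = (hpr cL p s + (sdeg t)%:R / 2%:R) *: ket C t.
Proof.
have [n] := ubnP (sdeg t); elim: n t => // n IH t.
case: (stateP t) => [->|i t' ->|i t' -> hi].
- by rewrite L0_vac hwtE sdeg_vac0 mul0r addr0.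
- rewrite sdeg_incr => h; have {}IH : L 0 (ket C t') = _ := IH t' _.
  have -> : ket C (incr i t') = bos (if i.1 then dzero cL p s else czero p) i.1 (Negz i.2) (ket C t').
    by rewrite bos.unlock -surjective_pairing bcreateE.
  case: i h => [[] k] h /=; rewrite ?Lmode_c ?Lmode_d IH; try lia.
  + rewrite linearZ /= !add0r NegzE mulrNz -pmulrn /=; mcoeffs.
    by field.
  + rewrite linearZ /= !add0r NegzE mulrNz -pmulrn /=; mcoeffs.
    by field.
- rewrite sdeg_fins // => h; have {}IH : L 0 (ket C t') = _ := IH t' _.
  have -> : ket C (fins i t') = fsign i t'.2 *: fmo i.1 (Negz i.2) (ket C t').
    rewrite fmo.unlock /= -surjective_pairing fcreateE (negbTE hi) scalerA.
    by rewrite fsign_id scale1r.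
  rewrite linearZ /= Lmode_psi IH ?linearZ; last by lia.
  rewrite /= !add0r NegzE mulrNz -pmulrn /=; mcoeffs.
  by field.
Qed.

Lemma L0_mcoeff y t : (L 0 y)@_t = (hpr cL p s + (sdeg t)%:R / 2%:R) * y@_t.
Proof.
elim/(@state_ind C): y => [a x y hx hy|t'].
  by rewrite linearP /= !mcoeffD !mcoeffZ hx hy; ring.
rewrite L0_ket mcoeffZ mcoeff_state.
by case: eqP => [->|_]; rewrite ?mulr0.
Qed.

(** Fock states and PBW words are both eigenvectors of L(0), with eigenvalues that determine the
    degree. *)
Lemma pbw_ket_deg u t : (pbwF (ket C u))@_t != 0 -> sdeg t = sdeg u.
Proof.
rewrite /pbw flinU => h; have := L0_act_word modF hwF (word_of u).
rewrite mdeg_word_of => /(congr1 (mcoeff t)); rewrite L0_mcoeff mcoeffZ => /(mulIf h).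
move=> /addrI /(divIf _) /eqP; rewrite pnatr_eq0 => /(_ isT).
by rewrite eqr_nat => /eqP.
Qed.

Lemma pbw_surj x : exists u, x = pbwF u.
Proof.
have subN : is_submodule act [set x | exists u, x = pbwF u].
  split.
  - by exists 0; rewrite linear0.
  - by move=> _ _ [u ->] [w ->]; exists (u + w); rewrite linearD.
  - by move=> a _ [u ->]; exists (a *: u); rewrite linearZ.
  - move=> g _ [u ->]; have [w hw] := pbw_act modF hwF g u; by exists w.
exact: (vac_generates cLa0 p0 subN (pbw_vac act vac)).
Qed.

(* A surjection preserving the finite-dimensional graded pieces is injective. *)
Lemma pbw_inj u : pbwF u = 0 -> u = 0.
Proof.
move=> hu; apply/malgP => t0; rewrite mcoeff0; pose n := sdeg t0.
have [T hT] : exists2 T : seq state, uniq T & forall s, (s \in T) = (sdeg s == n).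
  have [T hT] := states_finite n; exists (undup [seq s <- T | sdeg s == n]).
    exact: undup_uniq.
  move=> t; rewrite mem_undup mem_filter; case: eqP => //= e.
  by apply: hT; rewrite e.
move=> memT; pose N := size T; pose st (i : 'I_N) := nth vac0 T i.
have stE t : sdeg t = n -> exists i, t = st i.
  move=> /eqP; rewrite -memT => tT; have := tT; rewrite -index_mem => h.
  by exists (Ordinal h); rewrite /st nth_index.
have st_deg i : sdeg (st i) = n by apply/eqP; rewrite -memT mem_nth.
have st_eq i j : (st i == st j) = (i == j) by rewrite /st nth_uniq.
pose A : 'M[C]_N := \matrix_(i, j) (pbwF (ket C (st i)))@_(st j).
have coefE w j : (pbwF w)@_(st j) = \sum_i w@_(st i) * A i j.
  elim/(@state_ind C): w => [a x y hx hy|t].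
    rewrite linearP /= mcoeffD mcoeffZ hx hy mulr_sumr -big_split.
    by apply: eq_bigr => i _; rewrite /= mcoeffD mcoeffZ mulrDl mulrA.
  have [ht|ht] := eqVneq (sdeg t) n.
    have [i ->] := stE t ht; rewrite (bigD1 i) //= big1 => [|k ki].
      by rewrite mcoeff_state eqxx mul1r addr0 mxE.
    by rewrite mcoeff_state st_eq eq_sym (negbTE ki) mul0r.
  rewrite big1 => [|i _]; last first.
    rewrite mcoeff_state; case: eqP => [e|_]; last by rewrite mul0r.
    by rewrite e st_deg eqxx in ht.
  by apply/eqP; apply: contraNT ht => /pbw_ket_deg <-; rewrite st_deg.
have /choice[f hf] : forall i : 'I_N, exists w, ket C (st i) = pbwF w.
  by move=> i; apply: pbw_surj.
(* Row i is the degree n part of a preimage of the i-th basis vector. As the matrices are square, B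
   A = 1 also gives A B = 1, so x A = 0 forces x = 0. *)
pose B : 'M[C]_N := \matrix_(i, j) (f i)@_(st j).
have BA : B *m A = 1%:M.
  apply/matrixP => i j; rewrite !mxE; under eq_bigr => k _ do rewrite mxE.
  by rewrite -coefE -hf mcoeff_state st_eq.
pose x : 'rV[C]_N := \row_i u@_(st i).
have xA : x *m A = 0.
  apply/rowP => j; rewrite !mxE; under eq_bigr => k _ do rewrite mxE.
  by rewrite -coefE hu mcoeff0.
have x0 : x = 0 by rewrite -[x]mulmx1 -(mulmx1C BA) mulmxA xA mul0mx.
have [i ->] := stE t0 erefl.
by have /rowP/(_ i) := x0; rewrite !mxE.
Qed.

Lemma SHact_verma : is_verma cL cLa p s act vac.
Proof.
split=> // W actW w modW hwW.
have [g hg] := choice pbw_surj.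
have gK u : g (pbwF u) = u.
  by apply/eqP; rewrite -subr_eq0; apply/eqP/pbw_inj; rewrite linearB /= -hg subrr.
have modS := act_sum_module modF modW; have hwS := act_sum_hw hwF hwW.
pose f x := pbw actW w (g x).
have g_lin : linear g.
  move=> a x y; rewrite -[RHS]gK linearP /= -!hg //.
have f_lin : linear f by move=> a x y; rewrite /f g_lin linearP.
(* Straightening in the direct sum returns one u that represents the action of x in both components,
   and f sends the first component to the second. *)
have f_act x y : f (act x y) = actW x (f y).
  have [u] := pbw_act modS hwS x (g y); rewrite !pbw_sum /act_sum /= => -[e1 e2].
  by rewrite /f e2 [in LHS](hg y) e1 gK.
have f_vac : f vac = w.
  have [u] := pbw_vac (act_sum act actW) (vac, w).
  by rewrite pbw_sum => -[e1 e2]; rewrite /f [X in g X]e1 gK -e2.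
exists f; split=> // f' [[f'_lin f'_act] f'_vac]; apply/funext => x.
have subN : is_submodule act [set x | f x = f' x].
  split=> [|y z|a y|y z] /=.
  - by rewrite (linear_fun0 f_lin) (linear_fun0 f'_lin).
  - by move=> hy hz; rewrite (linear_funD f_lin) (linear_funD f'_lin) hy hz.
  - by move=> hy; rewrite (linear_funZ f_lin) (linear_funZ f'_lin) hy.
  - by move=> hz; rewrite f_act f'_act hz.
by apply: (vac_generates cLa0 p0 subN); rewrite /= f_vac f'_vac.
Qed.

End Verma.

Theorem theorem4p4 (R : realType) (cL cLa : R[i]) (hcLa : cLa != 0)
    (p : nat) (hp : (0 < p)%N) (hodd : odd p) (r : R[i]) :
  [/\ is_verma cL cLa p%:R r
        (FockAct cL p%:R cLa (s := r)) (vac r),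
      forall n : nat,
        singular (FockAct cL p%:R cLa (s := r)) (u_sing cL p%:R r n)
    & forall n : nat, (0 < n)%N ->
        subsingular (FockAct cL p%:R cLa (s := r)) (w_sub cL p%:R r n)].
Proof.
have [h h0 ->] : exists2 h, (0 < h)%N & p%:R = 2%:R * h%:R - 1 :> R[i].
  exists (uphalf p); first by lia.
  by rewrite -natrM -(natrB _ (n := 1)); [congr (_%:R)|]; lia.
have vacE (q : R[i]) : vac q = ket R[i] vac0 by rewrite ket.unlock.
rewrite FockActE vacE; split=> [|n|n n0].
(* The condition on p reads 2 h + n != 0. *)
- apply: SHact_verma => // n; rewrite addrAC -addrA -natrM -natr1 addrK.
  by rewrite -natrD pnatr_eq0; lia.
- by rewrite /u_sing vacE Qop_ascr scrG_iter_Gscr; apply: uvec_singular.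
- by rewrite /w_sub vacE scrG_iter_Gscr; apply: wvec_subsingular.
Qed.
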